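(* Let $X=(X_t)_{t\in[0,T]}$ be the $\mathbb{R}^{\mathcal{A}}$-valued process defined coordinatewise, for $a=(a_1,a_2,\dots)\in\mathcal{A}$, by $$X_t^{a}=\prod_{i\ge 1}H_{a_i}\Big(\int_0^t h_i(s)\cdot dB_s\Big).$$ Then $X$ satisfies (coordinatewise) the infinite-dimensional linear SDE $$dX_t=b(t,X_t)\,dt+\sigma(t,X_t)\,dB_t,$$ where $b\colon[0,T]\times\mathbb{R}^{\mathcal{A}}\to\mathbb{R}^{\mathcal{A}}$ and $\sigma\colon[0,T]\times\mathbb{R}^{\mathcal{A}}\to\mathbb{R}^{\mathcal{A}\times d}$ are given by $$b(t,x)^{(a_1,a_2,\dots)}=\frac12\sum_{i\ge1}x^{(a_1,\dots,a_i-2,\dots)}|h_i(t)|^2_{\mathbb{R}^d}+\sum_{1\le j<i}x^{(a_1,\dots,a_j-1,\dots,a_i-1,\dots)}\langle h_j(t),h_i(t)\rangle_{\mathbb{R}^d},$$ $$\sigma(t,x)^{(a_1,a_2,\dots)}=\sum_{i\ge1}x^{(a_1,\dots,a_i-1,\dots)}h_i(t),$$ with the convention $x^{a}\equiv0$ whenever $a_i<0$ for some $i\in\mathbb{N}$. The initial condition is determined by the fact that $H_n(0)=0$ whenever $n$ is odd and $H_{2k}(0)=\frac{(-1)^k}{2^k k!}$ for all $k\ge1$ (and $H_0(0)=1$), i.e. $X_0^{a}=\prod_{i\ge1}H_{a_i}(0)$.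
   Context: $T>0$; $B=(B_t)_{t\in[0,T]}$ is a standard $d$-dimensional Brownian motion on a complete probability space $(\Omega,\mathcal{F},\mathbb{P})$. The Hermite polynomials are normalized as $H_0(x)=1$, $H_n(x)=\frac{(-1)^n}{n!}e^{x^2/2}\frac{d^n}{dx^n}(e^{-x^2/2})$ for $n\ge1$. $\mathcal{A}$ is the set of all sequences $a=(a_1,a_2,\dots)$ of non-negative integers with only finitely many nonzero terms. $(h_i)_{i\ge1}$ is an orthonormal basis of $L^2([0,T];\mathbb{R}^d)$. The products and sums above have, for each fixed $a$, only finitely many terms different from $1$ (respectively $0$). *)

(* Defs.v *)
From HB Require Import structures.
From mathcomp Require Import all_boot all_order all_algebra.
From mathcomp Require Import finmap.
From mathcomp Require Import all_classical all_reals all_analysis.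

Set Implicit Arguments.
Unset Strict Implicit.
Unset Printing Implicit Defensive.

Import Order.TTheory GRing.Theory Num.Theory.
Import numFieldNormedType.Exports.

Local Open Scope classical_set_scope.
Local Open Scope ring_scope.

Definition hermite (R : realType) (n : nat) (x : R) : R :=
  if n is 0 then 1
  else (-1) ^+ n / (n`!)%:R * expR (x ^+ 2 / 2) *
       ((fun y : R => expR (- (y ^+ 2 / 2)))^`(n))%classic x.

(* The Euclidean inner product; the library norm on 'rV[R]_d is the sup norm,
   so |u|^2 is written dotp u u. *)
Definition dotp (R : realType) (d : nat) (u v : 'rV[R]_d) : R :=
  \sum_(k < d) u 0 k * v 0 k.

(* Elements of L^2([0,T]; R^d) are given by Borel representatives R -> R^d,
   of which only the values on [0,T] matter. *)
Definition square_integrable (R : realType) (d : nat) (T : R)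
    (f : R -> 'rV[R]_d) : Prop :=
  (forall k, measurable_fun `[0, T] (fun t => f t 0 k)) /\
  (\int[lebesgue_measure]_(t in `[0%R, T]) (dotp (f t) (f t))%:E < +oo)%E.

Definition L2_inner (R : realType) (d : nat) (T : R)
    (f g : R -> 'rV[R]_d) : R :=
  (\int[lebesgue_measure]_(t in `[0, T]) dotp (f t) (g t))%R.

Definition orthonormal_basis (R : realType) (d : nat) (T : R)
    (h : nat -> R -> 'rV[R]_d) : Prop :=
  [/\ forall i, square_integrable T (h i),
      forall i j, L2_inner T (h i) (h j) = (i == j)%:R &
      forall g, square_integrable T g ->
        (\int[lebesgue_measure]_(t in `[0%R, T])
           (let r := (g t - \sum_(i < n) L2_inner T g (h i) *: h i t)%R in
            dotp r r)%:E)%E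
        @[n --> \oo] --> 0%E].

(* A process indexed by [0,T] is a function of t : R whose values outside
   [0,T] play no role. *)

Definition natural_filtration (disp : measure_display)
    (Omega : measurableType disp) (R : realType) (d : nat)
    (B : R -> Omega -> 'rV[R]_d) (t : R) : set (set Omega) :=
  <<s [set A | exists (s : R) (k : 'I_d) (U : set R),
         [/\ 0 <= s <= t, measurable U &
             A = (fun w => B s w 0 k) @^-1` U] ]>>.

Definition augmented_filtration (disp : measure_display)
    (Omega : measurableType disp) (R : realType) (P : probability Omega R)
    (d : nat) (B : R -> Omega -> 'rV[R]_d) (t : R) : set (set Omega) :=
  <<s natural_filtration B t `|` [set N | P.-negligible N] >>.

(* Boxes form a pi-system generating the Borel sets of R^d, so the last two
   clauses say that B_t - B_s is independent of sigma(B_u, u <= s) and has law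
   N(0, (t - s) I_d). The second parameter of normal_prob is the standard
   deviation. *)
Definition standard_brownian_motion (disp : measure_display)
    (Omega : measurableType disp) (R : realType) (P : probability Omega R)
    (d : nat) (T : R) (B : R -> Omega -> 'rV[R]_d) : Prop :=
  let box (s t : R) (A : 'I_d -> set R) :=
    [set w | forall k, A k ((B t w - B s w) 0 k)] in
  [/\ forall t : R, 0 <= t <= T ->
        forall k, measurable_fun setT (fun w => B t w 0 k),
      {ae P, forall w, B 0 w = 0},
      {ae P, forall w, forall k,
        {within `[0, T], continuous (fun t => B t w 0 k)}},
      forall (s t : R) (A : 'I_d -> set R) (G : set Omega),
        0 <= s -> s < t -> t <= T -> (forall k, measurable (A k)) ->
        natural_filtration B s G ->
        P (G `&` box s t A) = (P G * P (box s t A))%E &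
      forall (s t : R) (A : 'I_d -> set R),
        0 <= s -> s < t -> t <= T -> (forall k, measurable (A k)) ->
        P (box s t A) =
        (\prod_(k < d) normal_prob 0%R (Num.sqrt (t - s)%R) (A k))%E].

Definition adapted (R : realType) (Omega : Type) (T : R)
    (F : R -> set (set Omega)) (Y : R -> Omega -> R) : Prop :=
  forall t : R, 0 <= t <= T ->
  forall U : set R, measurable U -> F t (Y t @^-1` U).

(* Data of sum_(k < n) e_k 1_(]t_k, t_(k+1)]). *)
Record simple_process (R : realType) (d : nat) (Omega : Type) :=
  SimpleProcess {
    sp_size : nat;
    sp_time : nat -> R;
    sp_coef : nat -> Omega -> 'rV[R]_d }.

Definition simple_valid (disp : measure_display)
    (Omega : measurableType disp) (R : realType) (P : probability Omega R)
    (d : nat) (T : R) (F : R -> set (set Omega))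
    (S : simple_process R d Omega) : Prop :=
  forall k, (k < sp_size S)%N ->
  [/\ 0 <= sp_time S k, sp_time S k <= sp_time S k.+1, sp_time S k.+1 <= T,
      forall (l : 'I_d) (U : set R), measurable U ->
        F (sp_time S k) ((fun w => sp_coef S k w 0 l) @^-1` U) &
      (\int[P]_w (dotp (sp_coef S k w) (sp_coef S k w))%:E < +oo)%E].

Definition simple_value (R : realType) (d : nat) (Omega : Type)
    (S : simple_process R d Omega) (s : R) (w : Omega) : 'rV[R]_d :=
  \sum_(k < sp_size S)
    (sp_time S k < s <= sp_time S k.+1)%R%:R *: sp_coef S k w.

Definition simple_integral (R : realType) (d : nat) (Omega : Type)
    (B : R -> Omega -> 'rV[R]_d) (S : simple_process R d Omega)
    (t : R) (w : Omega) : R :=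
  \sum_(k < sp_size S)
    dotp (sp_coef S k w)
      (B (Num.min (sp_time S k.+1) t) w - B (Num.min (sp_time S k) t) w).

Definition ito_integrand (disp : measure_display)
    (Omega : measurableType disp) (R : realType) (P : probability Omega R)
    (d : nat) (T : R) (B : R -> Omega -> 'rV[R]_d)
    (phi : R -> Omega -> 'rV[R]_d) : Prop :=
  [/\ forall k, measurable_fun (`[0, T] `*` [set: Omega])
        (fun p : R * Omega => phi p.1 p.2 0 k),
      forall k, adapted T (augmented_filtration P B)
        (fun t w => phi t w 0 k) &
      (\int[P]_w \int[lebesgue_measure]_(t in `[0%R, T])
         (dotp (phi t w) (phi t w))%:E < +oo)%E].

(* Y is a continuous version of (int_0^t phi_s . dB_s)_(t in [0,T]): simple
   adapted processes converge to phi in L^2([0,T] x Omega) and their integrals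
   up to time t converge to Y_t in L^2(Omega) for every t. By the Ito isometry
   Y is determined up to indistinguishability. *)
Definition is_ito_integral (disp : measure_display)
    (Omega : measurableType disp) (R : realType) (P : probability Omega R)
    (d : nat) (T : R) (B : R -> Omega -> 'rV[R]_d)
    (phi : R -> Omega -> 'rV[R]_d) (Y : R -> Omega -> R) : Prop :=
  [/\ ito_integrand P T B phi,
      forall t : R, 0 <= t <= T -> measurable_fun setT (Y t),
      forall w, {within `[0, T], continuous (fun t => Y t w)} &
      exists S : nat -> simple_process R d Omega,
        [/\ forall n, simple_valid P T (augmented_filtration P B) (S n),
            (\int[P]_w \int[lebesgue_measure]_(t in `[0%R, T])
               (let r := (simple_value (S n) t w - phi t w)%R in
                dotp r r)%:E)%E
            @[n --> \oo] --> 0%E &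
            forall t : R, 0 <= t <= T ->
              (\int[P]_w
                 ((simple_integral B (S n) t w - Y t w) ^+ 2)%:E)%E
              @[n --> \oo] --> 0%E]].

(* Indices i >= 1 are shifted to start at 0. *)
Definition multiindex := {fsfun nat -> nat with 0%N}.

(* x^c for an integer sequence c: the coordinate of x at c when c lies in the
   index set, and 0 otherwise, in particular when c has a negative entry. *)
Definition ext_coord (R : realType) (x : multiindex -> R)
    (c : nat -> int) : R :=
  match pselect (exists a : multiindex, forall k, c k = (a k)%:Z) with
  | left e => x (projT1 (cid e))
  | right _ => 0
  end.

Definition unit_seq (i : nat) : nat -> int := fun k => (k == i)%:Z.

Definition to_seq (a : multiindex) : nat -> int := fun k => (a k)%:Z.

(* \big[op/idx]_(i \in A) is the operator over the indices i in A whose term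
   differs from idx, provided that there are finitely many of them. *)
Definition drift (R : realType) (d : nat) (h : nat -> R -> 'rV[R]_d)
    (t : R) (x : multiindex -> R) (a : multiindex) : R :=
  2^-1 * (\sum_(i \in [set: nat])
            ext_coord x (to_seq a - unit_seq i *+ 2) * dotp (h i t) (h i t)) +
  \sum_(p \in [set p : nat * nat | (p.1 < p.2)%N])
     ext_coord x (to_seq a - unit_seq p.1 - unit_seq p.2) *
     dotp (h p.1 t) (h p.2 t).

Definition diffusion (R : realType) (d : nat) (h : nat -> R -> 'rV[R]_d)
    (t : R) (x : multiindex -> R) (a : multiindex) : 'rV[R]_d :=
  \sum_(i \in [set: nat]) ext_coord x (to_seq a - unit_seq i) *: h i t.

Definition satisfies_sde (disp : measure_display)
    (Omega : measurableType disp) (R : realType) (P : probability Omega R)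
    (d : nat) (T : R) (B : R -> Omega -> 'rV[R]_d) (I : Type)
    (b : R -> (I -> R) -> I -> R) (sigma : R -> (I -> R) -> I -> 'rV[R]_d)
    (X : R -> Omega -> I -> R) : Prop :=
  forall a : I,
  [/\ adapted T (augmented_filtration P B) (fun t w => X t w a),
      forall w, {within `[0, T], continuous (fun t => X t w a)},
      {ae P, forall w, (@lebesgue_measure R).-integrable
               `[0, T] (fun t => (b t (X t w) a)%:E)} &
      exists Y : R -> Omega -> R,
        is_ito_integral P T B (fun t w => sigma t (X t w) a) Y /\
        {ae P, forall w, forall t : R, 0 <= t <= T ->
          X t w a = X 0 w a
            + (\int[lebesgue_measure]_(s in `[0, t]) b s (X s w) a)%R
            + Y t w}].

(* To be used with W i t = int_0^t h_i . dB. *)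
Definition hermite_process (R : realType) (Omega : Type)
    (W : nat -> R -> Omega -> R) (t : R) (w : Omega) (a : multiindex) : R :=
  \big[*%R/1]_(i \in [set: nat]) hermite (a i) (W i t w).

(* Main.v *)
(* The Ito formula for the Hermite product X^a is obtained from a discrete
   scheme. Only the first m coordinates W_i = int h_i . dB matter for a given a.
   Each h_i, i < m, is approximated in L^2 by step functions g_i constant on the
   cells of a common uniform grid, so that W_i becomes a sum of g_i times Gaussian
   increments. Since H_n' = H_{n-1}, the second-order Taylor expansion of the
   product along one cell produces exactly the coordinates with shifted index:
   the first-order term is a simple stochastic integral, the second-order term is
   its conditional mean plus a martingale difference, and the remainder is of order
   3/2 in the length of the cell. All factors are polynomials in Gaussian
   variables and have uniformly bounded moments, so the martingale differences and
   the remainders vanish in L^2 as the grid is refined, the conditional means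
   converge to the time integral of the drift, and the simple integrands converge
   to the diffusion coefficient. Hence X_t - X_0 - int_0^t b is the Ito integral. *)

Require Import Defs.
From HB Require Import structures.
From mathcomp Require Import all_boot all_order all_algebra.
From mathcomp Require Import finmap.
From mathcomp Require Import all_classical all_reals all_analysis.
From mathcomp Require Import measurable_realfun.
From mathcomp Require Import ring lra.

Set Implicit Arguments.
Unset Strict Implicit.
Unset Printing Implicit Defensive.

Import Order.TTheory GRing.Theory Num.Theory.
Import numFieldNormedType.Exports.

Local Open Scope classical_set_scope.
Local Open Scope ring_scope.

(** * Hermite polynomials *)

(** The relation [is_ito_integral] asks for simple processes whose integrals converge at every time;
    the discrete expansion exhibits them, and one sequence, frozen at left endpoints, serves for all
    times. The hypothesis on [W i] supplies some simple processes, possibly random, for each [h i]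
    separately. Deterministic ones are extracted so that the discretized [W i] are weighted sums of
    Gaussian increments, with moments bounded independently of the mesh. The squared L^2 errors are
    of order [4^-v]: their sum is finite, so the discretized integrals converge almost surely. Hence
    [W i] is adapted, null sets being in the filtration, and inherits the moment bounds by Fatou.
    Since the [h i] are merely square integrable, the length of a cell does not measure the size of
    an increment; the Taylor expansion is scaled instead by [delta], the variance accumulated over
    the cell. Its sum over the cells stays bounded while its maximum tends to 0, so the sums of
    [delta ^ (3/2)] and of [delta ^ 2] vanish. *)

Section hermite_polynomials.
Context {R : realType}.
Implicit Types (x y : R) (n : nat).

(** Differentiating [p(x) exp(-x^2/2)] gives [-(x p - p') exp(-x^2/2)], whence this recursion.
    Having [hermite] as a polynomial gives exact Taylor expansions and moment bounds later. *)
Fixpoint hermite_poly n : {poly R} :=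
  if n is n'.+1 then
    (n'.+1%:R)^-1 *: ('X * hermite_poly n' - (hermite_poly n')^`())
  else 1.

Arguments hermite_poly : simpl never.

Lemma hermite_polyS n : n.+1%:R *: hermite_poly n.+1 =
  'X * hermite_poly n - (hermite_poly n)^`().
Proof. by rewrite /hermite_poly -/hermite_poly scalerA divff ?scale1r// pnatr_eq0. Qed.

Lemma hermite_poly1 : hermite_poly 1 = 'X.
Proof. by rewrite /hermite_poly invr1 scale1r mulr1 -polyC1 derivC subr0. Qed.

(** Differentiating the recursion for [H_(n+2)] gives [H_(n+1) + X H_n - H_n'], and the last two
    terms are [(n+1) H_(n+1)] by the recursion again. With this normalization differentiation is a
    pure index shift. *)
Lemma deriv_hermite_poly n : (hermite_poly n.+1)^`() = hermite_poly n.
Proof.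
elim: n => [|n IHn]; first by rewrite hermite_poly1 derivX.
apply: (@scalerI _ _ n.+2%:R); first by rewrite pnatr_eq0.
rewrite -derivZ hermite_polyS derivB derivM derivX mul1r IHn.
by rewrite -addrA -hermite_polyS -[n.+2%:R]natr1 scalerDl scale1r addrC.
Qed.

Lemma derive1n_gauss n x :
  ((fun y : R => expR (- (y ^+ 2 / 2)))^`(n))%classic x =
  (-1) ^+ n * n`!%:R * (hermite_poly n).[x] * expR (- (x ^+ 2 / 2)).
Proof.
elim: n x => [|n IHn] x; first by rewrite derive1n0 fact0 hornerC !mul1r.
(* The [n]-th derivative is written with function combinators so that the derivative of the product
   and of the composition can be inferred. *)
rewrite derive1nS (_ : (_^`(n))%classic =
    ((-1) ^+ n * n`!%:R) \*: (horner (hermite_poly n) *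
      (expR \o horner (- (2^-1 *: 'X^2))))); last first.
  apply/funext => y; rewrite IHn !fctE /= -mulrA hornerE hornerZ hornerXn.
  by rewrite [y ^+ 2 / _]mulrC.
rewrite derive1E derive_val derivN derivZ derivXn.
rewrite /GRing.scale /= !(hornerN, hornerZ, hornerXn, hornerMn).
have := congr1 (horner ^~ x) (hermite_polyS n).
rewrite hornerZ hornerD hornerM !hornerN hornerX => e.
have -> : 2^-1 * x ^+ 2 = x ^+ 2 / 2 by rewrite mulrC.
rewrite expr1 -mulr_natr factS [in RHS]exprS natrM.
transitivity (-1 * (-1) ^+ n * n`!%:R * (n.+1%:R * (hermite_poly n.+1).[x])
    * expR (- (x ^+ 2 / 2))); last by rewrite e; field.
by rewrite e; field.
Qed.

Lemma hermiteE n x : hermite n x = (hermite_poly n).[x].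
Proof.
case: n => [|n]; first by rewrite /= hornerC.
rewrite /hermite derive1n_gauss.
have n0 : (n.+1)`!%:R != 0 :> R by rewrite pnatr_eq0 -lt0n fact_gt0.
rewrite [RHS](_ : _ = (-1) ^+ n.+1 * (-1) ^+ n.+1 * ((n.+1)`!%:R / (n.+1)`!%:R)
   * (hermite_poly n.+1).[x] * (expR (x ^+ 2 / 2) * expR (- (x ^+ 2 / 2)))).
  by ring.
rewrite expRN divff// divff ?gt_eqF ?expR_gt0// -expr2 sqrr_sign.
by rewrite !mulr1 mul1r.
Qed.

Lemma hermiteS n x : n.+2%:R * hermite n.+2 x =
  x * hermite n.+1 x - hermite n x.
Proof.
rewrite !hermiteE -hornerZ hermite_polyS deriv_hermite_poly.
by rewrite hornerD hornerM hornerN hornerX.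
Qed.

Lemma hermite1 x : hermite 1 x = x.
Proof. by rewrite hermiteE hermite_poly1 hornerX. Qed.

(** At 0 the recurrence reduces to [(n+2) H_(n+2)(0) = - H_n(0)]. *)
Lemma hermite0_double k :
  hermite k.*2 (0 : R) = (-1) ^+ k / (2 ^+ k * (k`!)%:R).
Proof.
elim: k => [|k IHk]; first by rewrite expr0 fact0 mulr1 divr1.
apply: (@mulfI _ k.*2.+2%:R); first by rewrite pnatr_eq0.
rewrite doubleS hermiteS mul0r sub0r IHk.
rewrite factS exprS exprS natrM -doubleS -mul2n natrM.
by field; rewrite nat1r !pnatr_eq0 -lt0n fact_gt0 expf_neq0 ?pnatr_eq0.
Qed.

Lemma hermite0_odd n : odd n -> hermite n (0 : R) = 0.
Proof.
move=> on; rewrite -[n]odd_double_half on add1n.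
elim: n./2 => [|k IHk]; first by rewrite hermite1.
apply: (@mulfI _ (k.*2.+3)%:R); first by rewrite pnatr_eq0.
by rewrite hermiteS mul0r IHk subr0 mulr0.
Qed.

(* The convention that a coordinate with a negative index vanishes. *)
Definition hermitez (z : int) x : R := if z is Posz n then hermite n x else 0.

End hermite_polynomials.

(** * Families of random variables with bounded moments *)

Section moments.
Context {R : realType} {disp : measure_display} {Omega : measurableType disp}.
Variable P : probability Omega R.
Implicit Types (J K : Type).

(* Only even moments occur, written as powers of the square, so that no
   absolute value is needed. *)
Definition bounded_moments J (U : J -> Omega -> R) : Prop :=
  (forall j, measurable_fun setT (U j)) /\
  forall p, exists C : R, forall j,
    (\int[P]_w ((U j w ^+ 2) ^+ p)%:E <= C%:E)%E.

(** The exponent starts at [p.+1] because the zeroth moment is identically 1. The threshold [N] may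
    depend on the order but is uniform over [J], which later is the set of times. *)
Definition vanishing_moments J (U : nat -> J -> Omega -> R) : Prop :=
  (forall n j, measurable_fun setT (U n j)) /\
  forall p (e : R), 0 < e -> exists N, forall n j, (N <= n)%N ->
    (\int[P]_w ((U n j w ^+ 2) ^+ p.+1)%:E <= e%:E)%E.

Lemma sqr_pow_ge0 (x : R) p : 0 <= (x ^+ 2) ^+ p.
Proof. by rewrite exprn_ge0// sqr_ge0. Qed.

(** The constant comes from [(x + y)^2 <= 4 max (x^2, y^2)]. *)
Lemma sqr_powD (x y : R) p :
  ((x + y) ^+ 2) ^+ p <= 4 ^+ p * ((x ^+ 2) ^+ p + (y ^+ 2) ^+ p).
Proof.
wlog xy : x y / x ^+ 2 <= y ^+ 2.
  move=> H; have [/H//|/ltW/H] := leP (x ^+ 2) (y ^+ 2).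
  by rewrite (addrC y) [(y ^+ 2) ^+ p + _]addrC.
apply: (@le_trans _ _ (4 ^+ p * (y ^+ 2) ^+ p)); last first.
  by rewrite ler_wpM2l ?exprn_ge0// lerDr sqr_pow_ge0.
have y4 : 0 <= 4 * y ^+ 2 by rewrite mulr_ge0// sqr_ge0.
rewrite -exprMn lerXn2r ?nnegrE ?sqr_ge0 ?y4//.
by have := sqr_ge0 (x - y); nra.
Qed.

(** A product of two nonnegative numbers is at most the sum of their squares, so the moments of a
    product are controlled by moments of twice the order of its factors, whatever their
    dependence. *)
Lemma sqr_powM (x y : R) p :
  ((x * y) ^+ 2) ^+ p <= (x ^+ 2) ^+ (p + p) + (y ^+ 2) ^+ (p + p).
Proof.
rewrite !exprMn !exprD.
have := sqr_pow_ge0 x p; have := sqr_pow_ge0 y p.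
move: ((x ^+ 2) ^+ p) ((y ^+ 2) ^+ p) => a b b0 a0.
have := sqr_ge0 (a - b); nra.
Qed.

Lemma le_moment (f g : Omega -> R) (c : R) : measurable_fun setT f ->
  measurable_fun setT g -> (forall w, 0 <= f w) -> (forall w, f w <= g w) ->
  (\int[P]_w (g w)%:E <= c%:E)%E -> (\int[P]_w (f w)%:E <= c%:E)%E.
Proof.
move=> mf mg f0 fg; apply: le_trans; apply: ge0_le_integral => //.
- by move=> w _; rewrite lee_fin.
- exact/measurable_EFinP.
- exact/measurable_EFinP.
- by move=> w _; rewrite lee_fin.
Qed.

Lemma moment_lin (f g : Omega -> R) (a b c c' : R) :
  measurable_fun setT f -> measurable_fun setT g ->
  (forall w, 0 <= f w) -> (forall w, 0 <= g w) -> 0 <= a -> 0 <= b ->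
  (\int[P]_w (f w)%:E <= c%:E)%E -> (\int[P]_w (g w)%:E <= c'%:E)%E ->
  (\int[P]_w (a * f w + b * g w)%:E <= (a * c + b * c')%:E)%E.
Proof.
move=> mf mg f0 g0 a0 b0 fc gc.
under eq_integral do rewrite EFinD !EFinM.
rewrite ge0_integralD//=; first last.
- by apply: emeasurable_funM => //; exact/measurable_EFinP.
- by move=> w _; rewrite -EFinM lee_fin mulr_ge0.
- by apply: emeasurable_funM => //; exact/measurable_EFinP.
- by move=> w _; rewrite -EFinM lee_fin mulr_ge0.
rewrite !ge0_integralZl//=; try exact/measurable_EFinP;
  try by move=> w _; rewrite lee_fin.
by rewrite EFinD !EFinM leeD// lee_wpmul2l// ?lee_fin.
Qed.

Lemma bounded_momentsW J K (U : J -> Omega -> R) (r : K -> J) :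
  bounded_moments U -> bounded_moments (fun k => U (r k)).
Proof.
move=> [mU bU]; split => [k|p]; first exact: mU.
by have [C CU] := bU p; exists C => k.
Qed.

Lemma bounded_moments_eq J (U V : J -> Omega -> R) :
  (forall j w, U j w = V j w) -> bounded_moments U -> bounded_moments V.
Proof.
by move=> UV; rewrite (_ : U = V)//; apply/funext => j; apply/funext => w.
Qed.

Lemma bounded_moments_cst J (c : J -> R) (M : R) :
  (forall j, `|c j| <= M) -> bounded_moments (fun j _ => c j).
Proof.
move=> cM; split => [j|p]; first exact: measurable_cst.
exists ((M ^+ 2) ^+ p) => j; rewrite integral_cst//= probability_setT mule1.
rewrite lee_fin lerXn2r ?nnegrE ?sqr_ge0// -[leLHS]real_normK ?num_real//.
have M0 : 0 <= M by apply: le_trans (cM j).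
by rewrite lerXn2r ?nnegrE.
Qed.

Lemma bounded_momentsD J (U V : J -> Omega -> R) :
  bounded_moments U -> bounded_moments V ->
  bounded_moments (fun j w => U j w + V j w).
Proof.
move=> [mU bU] [mV bV]; split => [j|p]; first exact: measurable_funD.
have [C CU] := bU p; have [C' CV] := bV p.
exists (4 ^+ p * C + 4 ^+ p * C') => j.
have mUj := mU j; have mVj := mV j.
apply: le_moment (moment_lin _ _ _ _ _ _ (CU j) (CV j)).
- by do 2 apply: measurable_funX; exact: measurable_funD.
- by apply: measurable_funD; apply: measurable_funM => //;
    do 2 apply: measurable_funX.
- by move=> w; exact: sqr_pow_ge0.
- by move=> w; rewrite -mulrDr sqr_powD.
- by do 2 apply: measurable_funX.
- by do 2 apply: measurable_funX.
- by move=> w; exact: sqr_pow_ge0.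
- by move=> w; exact: sqr_pow_ge0.
- exact: exprn_ge0.
- exact: exprn_ge0.
Qed.

Lemma bounded_momentsM J (U V : J -> Omega -> R) :
  bounded_moments U -> bounded_moments V ->
  bounded_moments (fun j w => U j w * V j w).
Proof.
move=> [mU bU] [mV bV]; split => [j|p]; first exact: measurable_funM.
have [C CU] := bU (p + p)%N; have [C' CV] := bV (p + p)%N.
exists (1 * C + 1 * C') => j.
have mUj := mU j; have mVj := mV j.
apply: le_moment (moment_lin _ _ _ _ _ _ (CU j) (CV j)) => //.
- by do 2 apply: measurable_funX; exact: measurable_funM.
- by apply: measurable_funD; apply: measurable_funM => //;
    do 2 apply: measurable_funX.
- by move=> w; exact: sqr_pow_ge0.
- by move=> w; rewrite !mul1r sqr_powM.
- by do 2 apply: measurable_funX.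
- by do 2 apply: measurable_funX.
- by move=> w; exact: sqr_pow_ge0.
- by move=> w; exact: sqr_pow_ge0.
Qed.

Lemma bounded_momentsZ J (c : R) (U : J -> Omega -> R) :
  bounded_moments U -> bounded_moments (fun j w => c * U j w).
Proof.
move=> bU; apply: (bounded_momentsM (U := fun _ _ => c)) => //.
exact: (@bounded_moments_cst _ (fun=> c) `|c|).
Qed.

Lemma bounded_momentsB J (U V : J -> Omega -> R) :
  bounded_moments U -> bounded_moments V ->
  bounded_moments (fun j w => U j w - V j w).
Proof.
move=> bU bV; apply: bounded_momentsD => //.
by apply: bounded_moments_eq (bounded_momentsZ (-1) bV) => j w; rewrite mulN1r.
Qed.

Lemma bounded_moments0 J : bounded_moments (fun (_ : J) (_ : Omega) => 0 : R).
Proof. by apply: (@bounded_moments_cst _ (fun=> 0) 0) => _; rewrite normr0. Qed.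

Lemma bounded_moments_sum J I (r : seq I) (U : I -> J -> Omega -> R) :
  (forall i, bounded_moments (U i)) ->
  bounded_moments (fun j w => \sum_(i <- r) U i j w).
Proof.
move=> bU; elim: r => [|i r IHr].
  by apply: bounded_moments_eq (bounded_moments0 J) => j w; rewrite big_nil.
by apply: bounded_moments_eq (bounded_momentsD (bU i) IHr) => j w; rewrite big_cons.
Qed.

Lemma bounded_momentsX J (U : J -> Omega -> R) n :
  bounded_moments U -> bounded_moments (fun j w => U j w ^+ n).
Proof.
move=> bU; elim: n => [|n IHn].
  apply: (@bounded_moments_cst _ (fun=> 1) 1) => _; by rewrite normr1.
by apply: bounded_moments_eq (bounded_momentsM bU IHn) => j w; rewrite exprS.
Qed.

Lemma bounded_moments_horner J (p : {poly R}) (U : J -> Omega -> R) :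
  bounded_moments U -> bounded_moments (fun j w => p.[U j w]).
Proof.
move=> bU; apply: bounded_moments_eq (@bounded_moments_sum _ _
  (index_enum 'I_(size p)) (fun (i : 'I_(size p)) j w => p`_i * U j w ^+ i)
  (fun i => bounded_momentsZ p`_i (bounded_momentsX i bU))).
by move=> j w; rewrite horner_coef.
Qed.

(** [|U| <= 1 + U^2], and the second moment is finite. *)
Lemma bounded_moments_integrable J (U : J -> Omega -> R) j :
  bounded_moments U -> P.-integrable setT (EFin \o U j).
Proof.
move=> [mU bU]; apply/integrableP; split; first exact/measurable_EFinP.
have [C CU] := bU 1%N.
have le : (\int[P]_w (1 + (U j w ^+ 2) ^+ 1)%:E <= (1 + C)%:E)%E.
  have : (\int[P]_w (1 * cst (1 : R) w + 1 * (U j w ^+ 2) ^+ 1)%:E <=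
      (1 * 1 + 1 * C)%:E)%E.
    apply: moment_lin => //; last first.
      by rewrite (@integral_cst _ _ _ P _ measurableT 1%:E) /= probability_setT mule1.
    - by move=> w; exact: sqr_pow_ge0.
    - by do 2 apply: measurable_funX; exact: mU.
  by rewrite !mul1r; under eq_integral do rewrite !mul1r.
apply: le_lt_trans (ltry (1 + C)); apply: (@le_moment _ _ _ _ _ _ _ le).
- exact: measurableT_comp.
- by apply: measurable_funD => //; do 2 apply: measurable_funX; exact: mU.
- by [].
- move=> w; rewrite expr1 -[_ ^+ 2]real_normK ?num_real//.
  by have := sqr_ge0 (`|U j w| - 1); nra.
Qed.

Lemma vanishing_moments_eq J (U V : nat -> J -> Omega -> R) :
  (forall n j w, U n j w = V n j w) ->
  vanishing_moments U -> vanishing_moments V.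
Proof.
move=> UV; rewrite (_ : U = V)//.
by apply/funext => n; apply/funext => j; apply/funext => w.
Qed.

Lemma vanishing_momentsD J (U V : nat -> J -> Omega -> R) :
  vanishing_moments U -> vanishing_moments V ->
  vanishing_moments (fun n j w => U n j w + V n j w).
Proof.
move=> [mU bU] [mV bV]; split => [n j|p e e0]; first exact: measurable_funD.
have e'0 : 0 < e / (2 * 4 ^+ p.+1) by rewrite divr_gt0// mulr_gt0// exprn_gt0.
have [N NU] := bU p _ e'0; have [N' NV] := bV p _ e'0.
exists (maxn N N') => n j; rewrite geq_max => /andP[Nn N'n].
have -> : e = 4 ^+ p.+1 * (e / (2 * 4 ^+ p.+1)) + 4 ^+ p.+1 * (e / (2 * 4 ^+ p.+1)).
  by field; rewrite expf_neq0.
have mUj := mU n j; have mVj := mV n j.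
apply: le_moment (moment_lin _ _ _ _ _ _ (NU n j Nn) (NV n j N'n)).
- by do 2 apply: measurable_funX; exact: measurable_funD.
- by apply: measurable_funD; apply: measurable_funM => //;
    do 2 apply: measurable_funX.
- by move=> w; exact: sqr_pow_ge0.
- by move=> w; rewrite -mulrDr sqr_powD.
- by do 2 apply: measurable_funX.
- by do 2 apply: measurable_funX.
- by move=> w; exact: sqr_pow_ge0.
- by move=> w; exact: sqr_pow_ge0.
- exact: exprn_ge0.
- exact: exprn_ge0.
Qed.

(* Weighted AM-GM replaces Hoelder: [xy <= x^2 / (2 s) + s y^2 / 2] with [s]
   small compared with the moments of [V]. *)
Lemma vanishing_momentsM J (U V : nat -> J -> Omega -> R) :
  vanishing_moments U -> bounded_moments (fun z : nat * J => V z.1 z.2) ->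
  vanishing_moments (fun n j w => U n j w * V n j w).
Proof.
move=> [mU bU] [mV' bV].
have mV n j : measurable_fun setT (V n j) by exact: (mV' (n, j)).
split => [n j|p e e0]; first exact: measurable_funM.
have [C0 CV0] := bV (p.+1 + p.+1)%N; pose C : R := `|C0| + 1.
have C_gt0 : 0 < C by rewrite /C ltr_wpDl.
have CV n j : (\int[P]_w ((V n j w ^+ 2) ^+ (p.+1 + p.+1))%:E <= C%:E)%E.
  by apply: le_trans (CV0 (n, j)) _; rewrite lee_fin /C ler_wpDr// ler_norm.
pose s := e / (2 * C).
have s0 : 0 < s by rewrite divr_gt0// mulr_gt0.
have se0 : 0 < s * e / 2 by apply: divr_gt0 => //; exact: mulr_gt0.
have [N NU] := bU (p + p.+1)%N _ se0; exists N => n j Nn.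
have -> : e = s^-1 * (s * e / 2) + s * C.
  by rewrite /s; field; rewrite !gt_eqF.
have mUj := mU n j; have mVj := mV n j.
apply: le_moment (moment_lin _ _ _ _ _ _ (NU n j Nn) (CV n j)).
- by do 2 apply: measurable_funX; exact: measurable_funM.
- by apply: measurable_funD; apply: measurable_funM => //;
    do 2 apply: measurable_funX.
- by move=> w; exact: sqr_pow_ge0.
- move=> w; rewrite (exprMn 2) exprMn -addSn.
  rewrite (exprD (U n j w ^+ 2)) (exprD (V n j w ^+ 2)).
  have := sqr_pow_ge0 (U n j w) p.+1; have := sqr_pow_ge0 (V n j w) p.+1.
  move: ((U n j w ^+ 2) ^+ _) ((V n j w ^+ 2) ^+ _) => x y y0 x0.
  rewrite -subr_ge0.
  rewrite (_ : _ - _ = s^-1 * ((x - s * y) ^+ 2 + s * (x * y))).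
    rewrite mulr_ge0 ?invr_ge0 ?(ltW s0)// addr_ge0 ?sqr_ge0//.
    by apply: mulr_ge0; [exact: ltW|exact: mulr_ge0].
  by field; rewrite gt_eqF.
- by do 2 apply: measurable_funX.
- by do 2 apply: measurable_funX.
- by move=> w; exact: sqr_pow_ge0.
- by move=> w; exact: sqr_pow_ge0.
- by rewrite invr_ge0 ltW.
- exact: ltW.
Qed.

Lemma vanishing_moments0 J :
  vanishing_moments (fun _ (_ : J) (_ : Omega) => 0 : R).
Proof.
split => [n j|p e e0]; first exact: measurable_cst.
exists 0%N => n j _; rewrite expr0n/= expr0n/= integral0 lee_fin; exact: ltW.
Qed.

(* Interpolation between [L^2] and a bounded higher moment. *)
Lemma vanishing_moments_L2 J (U : nat -> J -> Omega -> R) :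
  bounded_moments (fun z : nat * J => U z.1 z.2) ->
  (forall e : R, 0 < e -> exists N, forall n j, (N <= n)%N ->
     (\int[P]_w (U n j w ^+ 2)%:E <= e%:E)%E) ->
  vanishing_moments U.
Proof.
move=> [mU' bU] L2.
have mU n j : measurable_fun setT (U n j) by exact: (mU' (n, j)).
split => [//|p e e0].
have [C0 CV0] := bU (p.+1 + p)%N; pose C : R := `|C0| + 1.
have C_gt0 : 0 < C by rewrite /C ltr_wpDl.
have CV n j : (\int[P]_w ((U n j w ^+ 2) ^+ (p.+1 + p))%:E <= C%:E)%E.
  by apply: le_trans (CV0 (n, j)) _; rewrite lee_fin /C ler_wpDr// ler_norm.
pose s := e / (2 * C).
have s0 : 0 < s by rewrite divr_gt0// mulr_gt0.
have se0 : 0 < s * e / 2 by apply: divr_gt0 => //; exact: mulr_gt0.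
have [N NU] := L2 _ se0; exists N => n j Nn.
have -> : e = s^-1 * (s * e / 2) + s * C.
  by rewrite /s; field; rewrite !gt_eqF.
have mUj := mU n j.
apply: le_moment (moment_lin _ _ _ _ _ _ (NU n j Nn) (CV n j)).
- by do 2 apply: measurable_funX.
- by apply: measurable_funD; apply: measurable_funM => //;
    do ?apply: measurable_funX.
- by move=> w; exact: sqr_pow_ge0.
- move=> w; rewrite (exprD (U n j w ^+ 2)) !(exprS (U n j w ^+ 2) p).
  have := sqr_pow_ge0 (U n j w) p; have := sqr_ge0 (U n j w).
  move: (U n j w ^+ 2) => x; move: (x ^+ p) => y x0 y0.
  rewrite -subr_ge0.
  rewrite (_ : _ - _ = s^-1 * (x * ((1 - s * y) ^+ 2 + s * y))).
    rewrite mulr_ge0 ?invr_ge0 ?(ltW s0)// mulr_ge0// addr_ge0 ?sqr_ge0//.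
    by rewrite mulr_ge0// ltW.
  by field; rewrite gt_eqF.
- exact: measurable_funX.
- by do 2 apply: measurable_funX.
- by move=> w; exact: sqr_ge0.
- by move=> w; exact: sqr_pow_ge0.
- by rewrite invr_ge0 ltW.
- exact: ltW.
Qed.

End moments.

(** * Gaussian integrals *)

Section gaussian.
Context {R : realType}.
Notation mu := (@lebesgue_measure R).

(** The normal law is absolutely continuous, and its Radon-Nikodym derivative agrees almost
    everywhere with [normal_pdf] because both have the same integral over every measurable set. *)
Lemma ge0_integral_normal (s : R) (g : R -> \bar R) :
  measurable_fun setT g -> (forall x, 0 <= g x)%E ->
  (\int[normal_prob 0 s]_x g x = \int[mu]_x (g x * (normal_pdf 0 s x)%:E))%E.
Proof.
move=> mg g0.
rewrite -(Radon_Nikodym_SigmaFinite.change_of_variables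
  (normal_prob_dominates 0 s))//.
apply: ae_eq_integral => //.
- apply: emeasurable_funM => //; apply: (measurable_int mu).
  by apply: Radon_Nikodym_SigmaFinite.f_integrable; exact: normal_prob_dominates.
- apply: emeasurable_funM => //; apply/measurable_EFinP.
  exact: measurable_normal_pdf.
apply: ae_eqe_mul2l; apply: integral_ae_eq => //.
- by apply: Radon_Nikodym_SigmaFinite.f_integrable; exact: normal_prob_dominates.
- by apply/measurable_EFinP; exact: measurable_normal_pdf.
- move=> E _ mE; rewrite -Radon_Nikodym_SigmaFinite.f_integral//.
  exact: normal_prob_dominates.
Qed.

(** Completing the square: [exp (l x)] times the centered density is a constant times the density
    with mean [l * s ^+ 2]. *)
Lemma normal_mgf (s l : R) : 0 < s ->
  (\int[normal_prob 0 s]_x (expR (l * x))%:E = (expR (l ^+ 2 * s ^+ 2 / 2))%:E)%E.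
Proof.
move=> s0; have sn0 : s != 0 by rewrite gt_eqF.
have mexp : measurable_fun setT (fun x : R => expR (l * x)).
  by apply: measurableT_comp => //; exact: measurable_funM.
rewrite ge0_integral_normal; first last.
- by move=> x; rewrite lee_fin expR_ge0.
- exact/measurable_EFinP.
transitivity (\int[mu]_x ((expR (l ^+ 2 * s ^+ 2 / 2))%:E *
    (normal_pdf (l * s ^+ 2) s x)%:E))%E; last first.
  rewrite ge0_integralZl//=.
  - by rewrite integral_normal_pdf mule1.
  - by apply/measurable_EFinP; exact: measurable_normal_pdf.
  - by move=> x _; rewrite lee_fin normal_pdf_ge0.
apply: eq_integral => x _.
rewrite !normal_pdfE// /normal_fun -!EFinM; congr EFin.
rewrite !(mulrCA (expR _)) -!expRD; congr (_ * expR _).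
by field.
Qed.

Lemma variance_ratio (v k p : R) : 0 < v -> 0 < k -> 0 < p ->
  (v * p *+ 2)^-1 * (v / k * p *+ 2) * k = 1.
Proof. by move=> v0 k0 p0; field; rewrite !gt_eqF. Qed.

(** The integrand times the density is a multiple of a normal density with the smaller standard
    deviation [s / sqrt (1 + 2 t s^2)]. The value [(1 + 2 t s^2)^(-1/2)] is described by its square,
    the form used in [inv_sqrt_bounds]. *)
Lemma normal_gauss (s t : R) : 0 < s -> 0 < t -> exists2 r : R,
  (\int[normal_prob 0 s]_x (expR (- (t * x ^+ 2)))%:E = r%:E)%E &
  0 <= r /\ r ^+ 2 * (1 + 2 * t * s ^+ 2) = 1.
Proof.
move=> s0 t0; have sn0 : s != 0 by rewrite gt_eqF.
have k0 : 0 < 1 + 2 * t * s ^+ 2 by rewrite addr_gt0// !mulr_gt0// exprn_gt0.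
pose q := Num.sqrt (1 + 2 * t * s ^+ 2).
have q0 : 0 < q by rewrite sqrtr_gt0.
have q2 : q ^+ 2 = 1 + 2 * t * s ^+ 2 by rewrite sqr_sqrtr// ltW.
pose s' := s / q.
have s'0 : 0 < s' by rewrite divr_gt0.
have s'n0 : s' != 0 by rewrite gt_eqF.
have mexp : measurable_fun setT (fun x : R => expR (- (t * x ^+ 2))).
  apply: measurableT_comp => //; apply: measurableT_comp => //.
  by apply: measurable_funM => //; exact: measurable_funX.
exists (normal_peak s / normal_peak s'); last split.
- rewrite ge0_integral_normal; first last.
  + by move=> x; rewrite lee_fin expR_ge0.
  + exact/measurable_EFinP.
  transitivity (\int[mu]_x ((normal_peak s / normal_peak s')%:E *
      (normal_pdf 0 s' x)%:E))%E; last first.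
    rewrite ge0_integralZl//=.
    - by rewrite integral_normal_pdf mule1.
    - by apply/measurable_EFinP; exact: measurable_normal_pdf.
    - by move=> x _; rewrite lee_fin normal_pdf_ge0.
    - by rewrite lee_fin divr_ge0// normal_peak_ge0.
  apply: eq_integral => x _.
  rewrite !normal_pdfE// /normal_fun -!EFinM; congr EFin.
  rewrite [RHS]mulrA divfK ?gt_eqF ?normal_peak_gt0//.
  rewrite mulrCA -expRD; congr (_ * expR _).
  rewrite /s' expr_div_n q2 !subr0.
  by field; rewrite sn0 gt_eqF.
- by rewrite divr_ge0// normal_peak_ge0.
- rewrite /normal_peak invrK exprMn exprVn !sqr_sqrtr.
  + rewrite /s' expr_div_n q2.
    by apply: variance_ratio; rewrite ?exprn_gt0 ?pi_gt0.
  + by rewrite mulrn_wge0// mulr_ge0 ?sqr_ge0 ?pi_ge0.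
  + by rewrite mulrn_wge0// mulr_ge0 ?sqr_ge0 ?pi_ge0.
Qed.

(** One term of the exponential series at [|x|]; the two exponentials cover both signs. Every even
    moment is thereby controlled by the moment generating function. *)
Lemma expR_ge_sqr_pow (x : R) p :
  (x ^+ 2) ^+ p <= (2 * p)`!%:R * (expR x + expR (- x)).
Proof.
wlog x0 : x / 0 <= x.
  move=> H; have [/H//|x0] := leP 0 x.
  by have := H (- x); rewrite sqrrN opprK [expR (- x) + _]addrC; apply; lra.
have f0 : (2 * p)`!%:R != 0 :> R by rewrite pnatr_eq0 -lt0n fact_gt0.
have /= ex : (x ^+ (2 * p)) / (2 * p)`!%:R <= expR x.
  case: p f0 => [|p] f0; first by rewrite expr0 fact0 divr1 (le_trans _ (expR_ge1Dx x))// lerDl.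
  apply: le_trans (expR_ge1Dxn (2 * p).+1 x0).
  by rewrite (_ : (2 * p).+2 = 2 * p.+1)%N ?mulnS// lerDr.
rewrite -exprM; move: ex; rewrite ler_pdivrMr; last first.
  by rewrite ltr0n fact_gt0.
move/le_trans; apply; by rewrite mulrC ler_wpM2l// lerDl expR_ge0.
Qed.

(** From [exp y >= (1 + y/2)^2] and [(1 - y + y^2)(1 + y/2)^2 >= 1] for [y >= 0]. *)
Lemma expRN_le_quad (y : R) : 0 <= y -> expR (- y) <= 1 - y + y ^+ 2.
Proof.
move=> y0; rewrite expRN -[X in X <= _]mul1r ler_pdivrMr ?expR_gt0//.
have h : 1 + y + y ^+ 2 / 4 <= expR y.
  rewrite (_ : y = 2%:R * (y / 2)); last by field.
  rewrite expRM_natl (_ : _ + _ = (1 + y / 2) ^+ 2); last by field.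
  by rewrite lerXn2r ?nnegrE ?expR_ge0 ?expR_ge1Dx// addr_ge0// divr_ge0.
have y2 : 0 <= 1 - y + y ^+ 2 by nra.
apply: le_trans (ler_wpM2l y2 h).
have := mulr_ge0 y0 (sqr_ge0 y); have := sqr_ge0 (y ^+ 2); nra.
Qed.

Lemma normal_moment (s : R) p : 0 < s ->
  (\int[normal_prob 0 s]_x ((x ^+ 2) ^+ p)%:E <=
   ((2 * p)`!%:R * (expR (s ^+ 2 / 2) * 2))%:E)%E.
Proof.
move=> s0; apply: (@le_trans _ _ (\int[normal_prob 0 s]_x
    ((2 * p)`!%:R%:E * ((expR (1 * x))%:E + (expR (-1 * x))%:E)))%E).
  apply: ge0_le_integral => //.
  - by move=> x _; rewrite lee_fin sqr_pow_ge0.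
  - by apply/measurable_EFinP; do 2 apply: measurable_funX.
  - apply/measurable_EFinP; apply: measurable_funM => //.
    by apply: measurable_funD; apply: measurableT_comp => //; exact: measurable_funM.
  - by move=> x _; rewrite -EFinD -EFinM lee_fin mul1r mulN1r expR_ge_sqr_pow.
have mexp l : measurable_fun setT (fun x : R => (expR (l * x))%:E).
  by apply/measurable_EFinP; apply: measurableT_comp => //; exact: measurable_funM.
rewrite ge0_integralZl//=; last 2 first.
- exact: (emeasurable_funD (mexp 1) (mexp (-1))).
- by move=> x _; rewrite -EFinD lee_fin addr_ge0// expR_ge0.
rewrite ge0_integralD//; try exact: mexp;
  try by move=> x _; rewrite lee_fin expR_ge0.
rewrite !normal_mgf// -EFinD -EFinM sqrrN expr1n mul1r.
by rewrite lee_fin mulr_natr mulr2n.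
Qed.

Lemma integrable_normal_id (s : R) : 0 < s ->
  (normal_prob 0 s).-integrable setT (fun x : R => x%:E).
Proof.
move=> s0.
apply: (@bounded_moments_integrable _ _ _ (normal_prob 0 s) unit (fun _ x => x) tt).
split=> // p; eexists => _; exact: normal_moment.
Qed.

(** The mean is the slope at [l = 0] of the moment generating function: [1 + l m] lies below
    [exp (l^2 s^2 / 2)], which is flat to first order at 0. *)
Lemma normal_mean (s : R) : 0 < s ->
  (\int[normal_prob 0 s]_x x%:E = 0)%E.
Proof.
move=> s0; have ix := integrable_normal_id s0.
have : (\int[normal_prob 0 s]_x x%:E)%E \is a fin_num.
  exact: integrable_fin_num.
move=> /fineK <-; set m := fine _.
have mE : (\int[normal_prob 0 s]_x x%:E = m%:E)%E by rewrite fineK// integrable_fin_num.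
have key l : 1 + l * m <= expR (l ^+ 2 * s ^+ 2 / 2).
  rewrite -lee_fin -normal_mgf//.
  have -> : ((1 + l * m)%:E = \int[normal_prob 0 s]_x (1 + l%:E * x%:E))%E.
    rewrite integralD//=; last exact: integrableZl.
    - by rewrite integral_cst//= probability_setT mule1 integralZl// mE.
    - by apply: finite_measure_integrable_cst.
  apply: le_integral => //=.
  - by apply: integrableD => //=; [exact: finite_measure_integrable_cst|exact: integrableZl].
  - apply/integrableP; split.
      apply/measurable_EFinP; apply: measurableT_comp => //; exact: measurable_funM.
    under eq_integral do rewrite /= ger0_norm ?expR_ge0//.
    by rewrite normal_mgf// ltry.
  - by move=> x _; rewrite -EFinM -EFinD lee_fin expR_ge1Dx.
apply/eqP; rewrite eqe; apply/negPn/negP => m0.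
have a0 : 0 < s ^+ 2 / 2 by rewrite divr_gt0// exprn_gt0.
have m2 : 0 < m ^+ 2 by rewrite exprn_even_gt0.
(* Test the inequality [1 + l m <= exp (a l ^ 2)] at [l = c m] with [c] small. *)
have [c c0 [ca cm]] : exists2 c : R, 0 < c &
    s ^+ 2 / 2 * c <= 1 / 2 /\ c * m ^+ 2 <= 1 / 2.
  move: (s ^+ 2 / 2) (m ^+ 2) a0 m2 => a u a0 u0.
  have d0 : 0 < 2 * (a + 1) * (1 + u) by rewrite !mulr_gt0// addr_gt0.
  exists (2 * (a + 1) * (1 + u))^-1; first by rewrite invr_gt0.
  by split; [rewrite ler_pdivrMr//|rewrite mulrC ler_pdivrMr//]; nra.
have := key (c * m).
have -> : (c * m) ^+ 2 * s ^+ 2 / 2 = c * m ^+ 2 * (s ^+ 2 / 2 * c) by ring.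
have -> : c * m * m = c * m ^+ 2 by ring.
move: (s ^+ 2 / 2 * c) (c * m ^+ 2) ca cm (mulr_gt0 c0 m2) => b u b1 u1 u0.
have e1 : 1 - u * b <= expR (- (u * b)) by exact: expR_ge1Dx.
have e2 : expR (u * b) * expR (- (u * b)) = 1 by rewrite expRxMexpNx_1.
have e3 := expR_gt0 (- (u * b)).
move=> e4.
have : (1 + u) * expR (- (u * b)) <= 1.
  by rewrite -[leRHS]e2 ler_pM2r.
have : (1 + u) * (1 - u * b) <= (1 + u) * expR (- (u * b)).
  by rewrite ler_wpM2l// ltW// addr_gt0.
by nra.
Qed.

(** Here [r] is [(1 + u)^(-1/2)]; both bounds are obtained by comparing squares, and [u <= 2] makes
    the lower one nonnegative. *)
Lemma inv_sqrt_bounds (r u : R) : 0 <= r -> 0 < u -> u <= 2 ->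
  r ^+ 2 * (1 + u) = 1 -> 1 - u / 2 <= r /\ r <= 1 - u / 2 + u ^+ 2 / 2.
Proof.
move=> r0 u0 u2 r2; have u10 : 0 < 1 + u by rewrite addr_gt0.
split.
  have h : 0 <= 1 - u / 2 by lra.
  have e : (1 - u / 2) ^+ 2 * (1 + u) = 1 - u ^+ 2 * (3 / 4 - u / 4) by field.
  rewrite -(@ler_sqr _ _ r) ?nnegrE// -(ler_pM2r u10) r2 e gerBl.
  by rewrite mulr_ge0 ?sqr_ge0//; lra.
have h : 0 <= 1 - u / 2 + u ^+ 2 / 2 by have := sqr_ge0 (1 - u); nra.
have e : (1 - u / 2 + u ^+ 2 / 2) ^+ 2 * (1 + u) =
  1 + u ^+ 2 * (1 / 4 + u * (3 / 4 - u / 4 + u ^+ 2 / 4)) by field.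
rewrite -(@ler_sqr _ r) ?nnegrE// -(ler_pM2r u10) r2 e lerDl.
rewrite mulr_ge0 ?sqr_ge0// addr_ge0// mulr_ge0 ?(ltW u0)//.
by have := sqr_ge0 (u - 1); nra.
Qed.

(* The second moment is read off from the expansion at [c = 0] of the integral
   of [expR (- c x ^+ 2)], which is explicit. *)
Lemma normal_var (s : R) : 0 < s ->
  (\int[normal_prob 0 s]_x (x ^+ 2)%:E = (s ^+ 2)%:E)%E.
Proof.
move=> s0.
have bm : bounded_moments (normal_prob 0 s) (fun (_ : unit) (x : R) => x).
  by split=> // p; eexists => _; exact: normal_moment.
have ip p : (normal_prob 0 s).-integrable setT (fun x : R => ((x ^+ 2) ^+ p)%:E).
  exact: (bounded_moments_integrable tt (bounded_momentsX p (bounded_momentsX 2 bm))).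
have [m2 E2] : exists m2, (\int[normal_prob 0 s]_x ((x ^+ 2) ^+ 1)%:E = m2%:E)%E.
  by exists (fine (\int[normal_prob 0 s]_x ((x ^+ 2) ^+ 1)%:E)%E); rewrite fineK// integrable_fin_num.
have [m4 E4] : exists m4, (\int[normal_prob 0 s]_x ((x ^+ 2) ^+ 2)%:E = m4%:E)%E.
  by exists (fine (\int[normal_prob 0 s]_x ((x ^+ 2) ^+ 2)%:E)%E); rewrite fineK// integrable_fin_num.
have m40 : 0 <= m4.
  by rewrite -lee_fin -E4; apply: integral_ge0 => x _; rewrite lee_fin sqr_pow_ge0.
rewrite [LHS]E2; congr EFin.
have lin (a b : R) : (\int[normal_prob 0 s]_x
    (1 + (a%:E * ((x ^+ 2) ^+ 1)%:E + b%:E * ((x ^+ 2) ^+ 2)%:E)) =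
    (1 + (a * m2 + b * m4))%:E)%E.
  rewrite integralD//=; first last.
  - by apply: integrableD => //=; exact: integrableZl.
  - exact: finite_measure_integrable_cst.
  rewrite integral_cst//= probability_setT mule1.
  rewrite integralD//=; try exact: integrableZl.
  by rewrite !integralZl//= E2 E4.
have ilin (a b : R) : (normal_prob 0 s).-integrable setT (fun x : R =>
    (1 + (a%:E * ((x ^+ 2) ^+ 1)%:E + b%:E * ((x ^+ 2) ^+ 2)%:E))%E).
  apply: integrableD => //=; first exact: finite_measure_integrable_cst.
  by apply: integrableD => //=; exact: integrableZl.
have bound (t : R) : 0 < t -> 2 * t * s ^+ 2 <= 2 ->
    s ^+ 2 - 2 * t * (s ^+ 2) ^+ 2 <= m2 /\ m2 <= s ^+ 2 + t * m4.
  move=> t0 ts; have [r rE [r0 r2]] := normal_gauss s0 t0.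
  have ie : (normal_prob 0 s).-integrable setT
      (fun x : R => (expR (- (t * x ^+ 2)))%:E).
    apply/integrableP; split.
      apply/measurable_EFinP; apply: measurableT_comp => //.
      apply: measurableT_comp => //.
      by apply: measurable_funM => //; exact: measurable_funX.
    under eq_integral do rewrite /= ger0_norm ?expR_ge0//.
    by rewrite rE ltry.
  have lo : 1 + (- t * m2 + 0 * m4) <= r.
    rewrite -lee_fin -rE -lin; apply: le_integral => // x _.
    rewrite -!EFinM -!EFinD lee_fin mul0r addr0 expr1 mulNr.
    exact: expR_ge1Dx.
  have up : r <= 1 + (- t * m2 + t ^+ 2 * m4).
    rewrite -lee_fin -rE -lin; apply: le_integral => // x _.
    rewrite -!EFinM -!EFinD lee_fin expr1 mulNr -exprMn.
    rewrite addrA; apply: expRN_le_quad.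
    by rewrite mulr_ge0 ?sqr_ge0// ltW.
  move: (s ^+ 2) (exprn_gt0 2 s0) r2 ts => v v0 r2 ts.
  pose u := 2 * t * v; have u0 : 0 < u by rewrite !mulr_gt0.
  have [r3 r1] := inv_sqrt_bounds r0 u0 ts r2.
  split.
  - rewrite -(ler_pM2l t0); move: lo r1; rewrite /u; nra.
  - rewrite -(ler_pM2l t0); move: up r3; rewrite /u; nra.
have v0 : 0 < s ^+ 2 by rewrite exprn_gt0.
have small (e : R) : 0 < e -> `|m2 - s ^+ 2| <= e.
  move=> e0.
  have D0 : 0 < s ^+ 2 + (2 * (s ^+ 2) ^+ 2 + m4) / e.
    by rewrite ltr_pwDl// divr_ge0 ?(ltW e0)// addr_ge0// mulr_ge0// sqr_ge0.
  (* This [t] makes both [t s^2 <= 1] and [t (2 s^4 + m4) <= e], so both errors in [bound] are at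
     most [e]. *)
  pose t := (s ^+ 2 + (2 * (s ^+ 2) ^+ 2 + m4) / e)^-1.
  have t0 : 0 < t by rewrite invr_gt0.
  have tE : t * (s ^+ 2 * e + (2 * (s ^+ 2) ^+ 2 + m4)) = e.
    rewrite (_ : _ + _ = (s ^+ 2 + (2 * (s ^+ 2) ^+ 2 + m4) / e) * e).
      by rewrite mulrA mulVf ?mul1r// gt_eqF.
    by rewrite [RHS]mulrDl divfK// gt_eqF.
  have /bound : 0 < t by [].
  move: (s ^+ 2) v0 t0 tE {bound D0} => v v0; move: t => {}t t0 tE.
  have p1 : 0 <= t * v * e by rewrite !mulr_ge0// ltW.
  have p2 : 0 <= t * (2 * v ^+ 2) by rewrite !mulr_ge0// ?ltW// exprn_gt0.
  have p3 : 0 <= t * m4 by rewrite mulr_ge0// ltW.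
  have tv : t * v <= 1 by rewrite -(ler_pM2r e0); nra.
  by case; [lra|move=> b1 b2; rewrite ler_norml; apply/andP; split; lra].
apply/eqP; rewrite -subr_eq0 -normr_le0; apply/ler_addgt0Pr => e e0.
by rewrite add0r small.
Qed.

End gaussian.

Definition mfun_of {d1 d2} {T1 : measurableType d1} {T2 : measurableType d2}
    (f : T1 -> T2) (mf : measurable_fun setT f) : {mfun T1 >-> T2} :=
  HB.pack f (isMeasurableFun.Build _ _ _ _ _ mf).

(** * Independence *)

Section independence.
Context {R : realType} {disp : measure_display} {Omega : measurableType disp}.
Variable P : probability Omega R.

Definition indep {d1 d2} {T1 : measurableType d1} {T2 : measurableType d2}
    (X : Omega -> T1) (Y : Omega -> T2) : Prop :=
  forall A B, measurable A -> measurable B ->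
    P (X @^-1` A `&` Y @^-1` B) = (P (X @^-1` A) * P (Y @^-1` B))%E.

Section pair.
Context {d1 d2} {T1 : measurableType d1} {T2 : measurableType d2}.
Variables (X : Omega -> T1) (Y : Omega -> T2).
Hypotheses (mX : measurable_fun setT X) (mY : measurable_fun setT Y).

Lemma measurable_pair_fun : measurable_fun setT (fun w => (X w, Y w)).
Proof. exact: measurable_fun_pair. Qed.

Let lX := distribution P (mfun_of mX).
Let lY := distribution P (mfun_of mY).
Let lXY := distribution P (mfun_of measurable_pair_fun).

Lemma indep_joint_law : indep X Y -> forall C, measurable C ->
  (lX \x lY)%E C = lXY C.
Proof.
move=> iXY; apply: product_measure_unique => A B mA mB.
by rewrite /lX /lY /lXY /distribution /pushforward -iXY//; congr (P _).
Qed.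

Lemma ge0_indepM (f : T1 -> \bar R) (g : T2 -> \bar R) : indep X Y ->
  measurable_fun setT f -> measurable_fun setT g ->
  (forall x, 0 <= f x)%E -> (forall y, 0 <= g y)%E ->
  (\int[P]_w (f (X w) * g (Y w)) = (\int[P]_w f (X w)) * \int[P]_w g (Y w))%E.
Proof.
move=> iXY mf mg f0 g0.
have mfg : measurable_fun setT (fun z : T1 * T2 => f z.1 * g z.2)%E.
  by apply: emeasurable_funM; exact: measurableT_comp.
have fg0 (z : T1 * T2) : (0 <= f z.1 * g z.2)%E by rewrite mule_ge0.
have -> : (\int[P]_w (f (X w) * g (Y w)) = \int[lXY]_z (f z.1 * g z.2))%E.
  by rewrite (ge0_integral_distribution (mfun_of measurable_pair_fun) mfg fg0).
rewrite (eq_measure_integral (lX \x lY)%E); last first.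
  by move=> C mC _; apply/esym; exact: indep_joint_law.
rewrite fubini_tonelli1//= /fubini_F.
have -> : (\int[P]_w f (X w) = \int[lX]_x f x)%E.
  by rewrite (ge0_integral_distribution (mfun_of mX) mf f0).
have -> : (\int[P]_w g (Y w) = \int[lY]_y g y)%E.
  by rewrite (ge0_integral_distribution (mfun_of mY) mg g0).
rewrite -ge0_integralZr//; last exact: integral_ge0.
by apply: eq_integral => x _; rewrite /= ge0_integralZl.
Qed.

End pair.

Lemma indep_integrable (X Y : Omega -> R) : indep X Y ->
  P.-integrable setT (EFin \o X) -> P.-integrable setT (EFin \o Y) ->
  P.-integrable setT (fun w => (X w * Y w)%:E).
Proof.
move=> iXY /integrableP[/measurable_EFinP mX iX] /integrableP[/measurable_EFinP mY iY].
apply/integrableP; split.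
  by apply/measurable_EFinP; apply: measurable_funM.
under eq_integral do rewrite EFinM abseM.
have mabs : measurable_fun setT (fun x : R => `|x%:E|%E).
  by apply: measurableT_comp => //; exact/measurable_EFinP.
rewrite (ge0_indepM mX mY iXY mabs mabs)//.
apply: lte_mul_pinfty => //; first exact: integral_ge0.
by rewrite ge0_fin_numE//; exact: integral_ge0.
Qed.

Lemma indep_expectationM (X Y : Omega -> R) : indep X Y ->
  P.-integrable setT (EFin \o X) -> P.-integrable setT (EFin \o Y) ->
  (\int[P]_w (X w * Y w)%:E = (\int[P]_w (X w)%:E) * \int[P]_w (Y w)%:E)%E.
Proof.
move=> iXY iX iY; have iXYM := indep_integrable iXY iX iY.
have /measurable_EFinP mX := measurable_int _ iX.
have /measurable_EFinP mY := measurable_int _ iY.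
have mfg : measurable_fun setT (fun z : R * R => (z.1 * z.2)%:E).
  by apply/measurable_EFinP; exact: measurable_funM.
have mid : measurable_fun setT (fun x : R => x%:E) by exact/measurable_EFinP.
have law := indep_joint_law mX mY iXY.
have -> : (\int[P]_w (X w * Y w)%:E =
    \int[distribution P (mfun_of (measurable_pair_fun mX mY))]_z (z.1 * z.2)%:E)%E.
  by rewrite (integral_distribution (X := mfun_of (measurable_pair_fun mX mY)) mfg).
rewrite (eq_measure_integral (distribution P (mfun_of mX) \x distribution P (mfun_of mY))%E); last first.
  by move=> C mC _; apply/esym; exact: law.
have iprod : (distribution P (mfun_of mX) \x distribution P (mfun_of mY))%E.-integrable
    setT (fun z : R * R => (z.1 * z.2)%:E).
  apply/integrableP; split=> //.
  rewrite (eq_measure_integral (distribution P (mfun_of (measurable_pair_fun mX mY)))); last first.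
    by move=> C mC _; exact: law.
  rewrite (ge0_integral_distribution (mfun_of (measurable_pair_fun mX mY)))//.
  - by move/integrableP : iXYM => [].
  - exact: measurableT_comp.
rewrite -integral12_prod_meas1//= /fubini_F /=.
have iYd : (distribution P (mfun_of mY)).-integrable setT (fun y : R => y%:E).
  exact: (integrable_pushforward mY mid).
have iXd : (distribution P (mfun_of mX)).-integrable setT (fun y : R => y%:E).
  exact: (integrable_pushforward mX mid).
have EY : (\int[distribution P (mfun_of mY)]_y y%:E = \int[P]_w (Y w)%:E)%E.
  by rewrite (integral_distribution (X := mfun_of mY) mid).
have EX : (\int[distribution P (mfun_of mX)]_y y%:E = \int[P]_w (X w)%:E)%E.
  by rewrite (integral_distribution (X := mfun_of mX) mid).
have fY : (\int[P]_w (Y w)%:E)%E \is a fin_num by exact: integrable_fin_num.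
rewrite -EX -(fineK fY) -integralZr//.
apply: eq_integral => x _; under eq_integral do rewrite EFinM.
by rewrite integralZl// EY fineK.
Qed.

Lemma dynkin_indep d1 (T : measurableType d1) (X : Omega -> T) (D : set Omega) :
  measurable_fun setT X -> measurable D ->
  dynkin [set C | measurable C /\ P (X @^-1` C `&` D) = (P (X @^-1` C) * P D)%E].
Proof.
move=> mX mD.
have mpre C : measurable C -> measurable (X @^-1` C).
  by move=> mC; rewrite -[_ @^-1` _]setTI; exact: mX.
split.
- by split=> //; rewrite preimage_setT setTI probability_setT mul1e.
- move=> C [mC CD]; split; first exact: measurableC.
  have mXC := mpre _ mC; rewrite (_ : X @^-1` (~` C) = ~` (X @^-1` C))//.
  have fD : P D \is a fin_num by exact: fin_num_measure.
  have fC : P (X @^-1` C) \is a fin_num by exact: fin_num_measure.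
  have -> : (P (~` (X @^-1` C)) * P D = P D - P (X @^-1` C) * P D)%E.
    have gen (a b : \bar R) : a \is a fin_num -> b \is a fin_num ->
        ((1 - a) * b = b - a * b)%E.
      case: a b => [a| |] [b| |]// _ _.
      have e : (1 - a) * b = b - a * b by ring.
      exact: (congr1 EFin e).
    by rewrite probability_setC// gen.
  rewrite -CD.
  by rewrite setIC -setDE [in RHS]setIC measureD// ltey_eq fD.
- move=> F tF HF; split; first by apply: bigcupT_measurable => n; case: (HF n).
  have mF n : measurable (X @^-1` F n) by apply: mpre; case: (HF n).
  rewrite preimage_bigcup setI_bigcupl.
  have tF' : trivIset setT (fun n => X @^-1` F n).
    by move=> i j _ _ [w [/= Fi Fj]]; apply: tF => //; exists (X w).
  rewrite measure_bigcup//=; last 2 first.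
  + by move=> n _; exact: measurableI.
  + by move=> i j _ _ [w [/= [Fi _] [Fj _]]]; apply: tF => //; exists (X w).
  rewrite [in RHS]measure_bigcup//= muleC.
  have fD : P D \is a fin_num by exact: fin_num_measure.
  rewrite -(fineK fD) -nneseriesZl//.
  by apply: eq_eseriesr => n _; rewrite fineK//; case: (HF n) => _ ->; rewrite muleC.
Qed.

(** Rectangles form a pi-system generating the product sigma-algebra, so the product formula passes
    from them to every event depending on the pair, in particular through [f]. It is applied with
    [f] the multiplication of a past variable by one component of an increment. *)
Lemma indep_restr {d1 d2 d3} {T1 : measurableType d1} {T2 : measurableType d2}
    {T3 : measurableType d3} (X : Omega -> T1) (Y : Omega -> T2)
    (f : T1 * T2 -> T3) (D : set Omega) :
  measurable_fun setT X -> measurable_fun setT Y ->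
  measurable D -> measurable_fun setT f ->
  (forall A B, measurable A -> measurable B ->
    P (X @^-1` A `&` Y @^-1` B `&` D) = (P (X @^-1` A `&` Y @^-1` B) * P D)%E) ->
  forall C, measurable C ->
    P ((fun w => f (X w, Y w)) @^-1` C `&` D) =
    (P ((fun w => f (X w, Y w)) @^-1` C) * P D)%E.
Proof.
move=> mX mY mD mf H C mC.
have dI := dynkin_indep (measurable_pair_fun mX mY) mD.
have mfC : measurable (f @^-1` C) by rewrite -[_ @^-1` _]setTI; exact: mf.
suff [//] : [set E | measurable E /\ P ((fun w => (X w, Y w)) @^-1` E `&` D) =
    (P ((fun w => (X w, Y w)) @^-1` E) * P D)%E] (f @^-1` C).
move: mfC; rewrite {1}measurable_prod_measurableType.
rewrite -setI_closed_g_dynkin_g_sigma_algebra; last first.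
  move=> _ _ [A mA [B mB <-]] [A' mA' [B' mB' <-]].
  exists (A `&` A'); first exact: measurableI.
  exists (B `&` B'); first exact: measurableI.
  by rewrite setXI.
apply; split=> // _ [A mA [B mB <-]]; split; first exact: measurableX.
by have := H _ _ mA mB.
Qed.

End independence.

(** * Integrability bundled with the value of the integral *)

Section has_integral.
Context {R : realType} {disp : measure_display} {S : measurableType disp}.
Variables (mu : {measure set S -> \bar R}) (D : set S) (mD : measurable D).

(** Carrying integrability along with the value lets linear combinations and nested finite sums be
    integrated without proving integrability of every summand anew. *)
Definition has_integral (f : S -> R) (c : R) : Prop :=
  mu.-integrable D (EFin \o f) /\ (\int[mu]_(x in D) (f x)%:E = c%:E)%E.

Lemma has_integral_eq f g c : {in D, f =1 g} -> has_integral f c ->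
  has_integral g c.
Proof.
move=> fg [i e]; split.
  by apply: eq_integrable i => // x xD; rewrite /= fg.
by rewrite -e; apply: eq_integral => x xD; rewrite fg.
Qed.

Lemma has_integral_integrable f : mu.-integrable D (EFin \o f) ->
  has_integral f (fine (\int[mu]_(x in D) (f x)%:E)%E).
Proof. by move=> i; split => //; rewrite fineK// integrable_fin_num. Qed.

Lemma has_integral_unique f c c' : has_integral f c -> has_integral f c' ->
  c = c'.
Proof. by move=> [_ e] [_]; rewrite e => -[]. Qed.

Lemma has_integralZ f c k : has_integral f c ->
  has_integral (fun x => k * f x) (k * c).
Proof.
move=> [i e]; split; first by apply: eq_integrable (integrableZl mD k i).
by under eq_integral do rewrite EFinM; rewrite integralZl// e.
Qed.

Lemma has_integralD f g c c' : has_integral f c -> has_integral g c' ->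
  has_integral (fun x => f x + g x) (c + c').
Proof.
move=> [i e] [i' e']; split; first by apply: eq_integrable (integrableD mD i i').
by under eq_integral do rewrite EFinD; rewrite integralD// e e'.
Qed.

Lemma has_integral0 : has_integral (fun=> 0) 0.
Proof. by split; [exact: integrable0|rewrite integral0]. Qed.

Lemma has_integral_sum I (r : seq I) (f : I -> S -> R) (c : I -> R) :
  (forall i, has_integral (f i) (c i)) ->
  has_integral (fun x => \sum_(i <- r) f i x) (\sum_(i <- r) c i).
Proof.
move=> H; elim: r => [|i r IHr].
  rewrite big_nil; apply: has_integral_eq has_integral0 => x _.
  by rewrite big_nil.
rewrite big_cons; apply: has_integral_eq (has_integralD (H i) IHr) => x _.
by rewrite big_cons.
Qed.

Lemma integrable_mul_L2 (f g : S -> R) :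
  measurable_fun D f -> measurable_fun D g ->
  (\int[mu]_(x in D) (f x ^+ 2)%:E < +oo)%E ->
  (\int[mu]_(x in D) (g x ^+ 2)%:E < +oo)%E ->
  mu.-integrable D (fun x => (f x * g x)%:E).
Proof.
move=> mf mg f2 g2.
have i2 (h : S -> R) : measurable_fun D h -> (\int[mu]_(x in D) (h x ^+ 2)%:E < +oo)%E ->
    mu.-integrable D (fun x => (h x ^+ 2)%:E).
  move=> mh h2; apply/integrableP; split.
    by apply/measurable_EFinP; exact: measurable_funX.
  by under eq_integral do rewrite /= ger0_norm ?sqr_ge0//.
apply: (le_integrable mD _ _ (integrableD mD (i2 _ mf f2) (i2 _ mg g2))).
  by apply/measurable_EFinP; exact: measurable_funM.
move=> x Dx /=; rewrite lee_fin [leRHS]ger0_norm ?addr_ge0 ?sqr_ge0//.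
rewrite normrM -[f x ^+ 2]real_normK ?num_real// -[g x ^+ 2]real_normK ?num_real//.
have := sqr_ge0 (`|f x| - `|g x|); have := normr_ge0 (f x); have := normr_ge0 (g x).
by nra.
Qed.

End has_integral.

(** * Brownian motion and its augmented filtration *)

Section brownian.
Context {R : realType} {disp : measure_display} {Omega : measurableType disp}.
Variables (P : probability Omega R) (d : nat) (T : R) (B : R -> Omega -> 'rV[R]_d).
Hypothesis Pcomplete : measure_is_complete P.
Hypothesis BM : standard_brownian_motion P T B.

Notation F := (augmented_filtration P B).

Lemma measurable_BM t l : 0 <= t <= T -> measurable_fun setT (fun w => B t w 0 l).
Proof. by case: BM => mB _ _ _ _ /mB. Qed.

Lemma natural_filtration_measurable t A : 0 <= t <= T ->
  natural_filtration B t A -> measurable A.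
Proof.
move=> /andP[t0 tT]; apply: smallest_sub; first exact: sigma_algebra_measurable.
move=> _ [s [l [U [/andP[s0 st] mU ->]]]].
rewrite -[_ @^-1` _]setTI; apply: measurable_BM => //.
by rewrite s0 (le_trans st).
Qed.

(** Negligible sets are measurable by completeness of [P]; this is what turns adaptedness into
    measurability. *)
Lemma augmented_filtration_measurable t A : 0 <= t <= T -> F t A -> measurable A.
Proof.
move=> t0T; apply: smallest_sub; first exact: sigma_algebra_measurable.
move=> A' [/natural_filtration_measurable|]; [exact|exact: Pcomplete].
Qed.

Lemma natural_filtration_le s t : s <= t ->
  natural_filtration B s `<=` natural_filtration B t.
Proof.
move=> st; apply: sub_smallest2r; first exact: smallest_sigma_algebra.
move=> _ [u [l [U [/andP[u0 us] mU ->]]]].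
by exists u, l, U; split=> //; rewrite u0 (le_trans us).
Qed.

Lemma augmented_filtration_le s t : s <= t -> F s `<=` F t.
Proof.
move=> st; apply: sub_smallest2r; first exact: smallest_sigma_algebra.
move=> A [nA|nA]; [left|by right].
exact: natural_filtration_le nA.
Qed.

Definition adm (t : R) (Z : Omega -> R) : Prop :=
  forall U, measurable U -> F t (Z @^-1` U).

Let G t := natural_filtration B t `|` [set N | P.-negligible N].

(** On [g_sigma_algebraType] adaptedness is plain measurability, so the closure properties of
    measurable functions carry over. *)
Lemma adm_measurableP t (Z : Omega -> R) : adm t Z <->
  measurable_fun (T := g_sigma_algebraType (G t)) setT Z.
Proof.
split=> [aZ _ U mU|mZ U mU]; first by rewrite setTI; exact: aZ.
by have := mZ measurableT U mU; rewrite setTI.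
Qed.

Lemma adm_le s t Z : s <= t -> adm s Z -> adm t Z.
Proof. by move=> st aZ U mU; exact: augmented_filtration_le (aZ U mU). Qed.

Lemma adm_measurable t Z : 0 <= t <= T -> adm t Z -> measurable_fun setT Z.
Proof.
by move=> t0T aZ _ U mU; rewrite setTI; exact: augmented_filtration_measurable (aZ U mU).
Qed.

Lemma adm_cst t c : adm t (fun=> c).
Proof. by apply/adm_measurableP; exact: measurable_cst. Qed.

Lemma admD t X Y : adm t X -> adm t Y -> adm t (fun w => X w + Y w).
Proof.
move=> /adm_measurableP aX /adm_measurableP aY; apply/adm_measurableP.
exact: measurable_funD.
Qed.

Lemma admM t X Y : adm t X -> adm t Y -> adm t (fun w => X w * Y w).
Proof.
move=> /adm_measurableP aX /adm_measurableP aY; apply/adm_measurableP.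
exact: measurable_funM.
Qed.

Lemma adm_eq t X Y : adm t X -> X =1 Y -> adm t Y.
Proof. by move=> aX /funext <-. Qed.

Lemma admB t X Y : adm t X -> adm t Y -> adm t (fun w => X w - Y w).
Proof.
move=> aX aY; apply: admD => //.
by refine (adm_eq (admM (@adm_cst t (-1)) aY) _) => w; rewrite mulN1r.
Qed.

Lemma adm_sum t I (r : seq I) (X : I -> Omega -> R) :
  (forall i, adm t (X i)) -> adm t (fun w => \sum_(i <- r) X i w).
Proof.
move=> aX; elim: r => [|i r IHr].
  by refine (adm_eq (@adm_cst t 0) _) => w; rewrite big_nil.
by refine (adm_eq (admD (aX i) IHr) _) => w; rewrite big_cons.
Qed.

Lemma adm_prod t I (r : seq I) (X : I -> Omega -> R) :
  (forall i, adm t (X i)) -> adm t (fun w => \prod_(i <- r) X i w).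
Proof.
move=> aX; elim: r => [|i r IHr].
  by refine (adm_eq (@adm_cst t 1) _) => w; rewrite big_nil.
by refine (adm_eq (admM (aX i) IHr) _) => w; rewrite big_cons.
Qed.

Lemma adm_comp t (f : R -> R) X : measurable_fun setT f -> adm t X ->
  adm t (f \o X).
Proof.
move=> mf /adm_measurableP aX; apply/adm_measurableP.
exact: measurableT_comp.
Qed.

Lemma adm_BM s t l : 0 <= s -> s <= t -> adm t (fun w => B s w 0 l).
Proof.
move=> s0 st U mU; apply: sub_sigma_algebra; left; apply: sub_sigma_algebra.
by exists s, l, U; rewrite s0.
Qed.

(** All negligible sets belong to the augmented filtration at every time, so modifying a variable on
    one of them preserves adaptedness. *)
Lemma adm_ae t X Y : {ae P, forall w, X w = Y w} -> adm t X -> adm t Y.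
Proof.
move=> XY aX U mU.
pose N := ~` [set w | X w = Y w].
have nN : P.-negligible N by [].
have FN N' : P.-negligible N' -> F t N'.
  by move=> nN'; apply: sub_sigma_algebra; right.
have -> : Y @^-1` U = (X @^-1` U `&` ~` N) `|` (Y @^-1` U `&` N).
  rewrite /N; apply/seteqP; split=> w /=.
    by case: (pselect (X w = Y w)) => [e|ne]; [left; rewrite e; split => //; exact|right].
  by move=> [[+ /contrapT <-]|[]].
have FI : @measurable _ (g_sigma_algebraType (G t)) ((X @^-1` U `&` ~` N) `|` (Y @^-1` U `&` N)).
  apply: measurableU.
    by apply: measurableI; [exact: aX|apply: measurableC; exact: FN].
  by apply: FN; apply: negligibleS nN => w [].
exact: FI.
Qed.

Lemma adm_lim t (X : nat -> Omega -> R) (Y : Omega -> R) : (forall n, adm t (X n)) ->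
  {ae P, forall w, X n w @[n --> \oo] --> Y w} -> adm t Y.
Proof.
move=> aX XY.
pose N := ~` [set w | X n w @[n --> \oo] --> Y w].
have nN : P.-negligible N by [].
have FN : @measurable _ (g_sigma_algebraType (G t)) (~` N).
  by apply: measurableC; apply: sub_sigma_algebra; right.
have a1 : adm t (\1_(~` N) : Omega -> R).
  by apply/adm_measurableP; exact: measurable_indic.
(* Multiplying by the indicator of the convergence set makes the convergence hold everywhere, with
   limit 0 on the exceptional set. *)
apply: (@adm_ae _ (fun w => \1_(~` N) w * Y w)).
  apply: filterS XY => w XYw; rewrite indicE mem_set ?mul1r//.
apply/adm_measurableP; apply: (@measurable_fun_cvg _ (g_sigma_algebraType (G t)) R setT
  (fun n w => \1_(~` N) w * X n w)).
  by move=> n; apply/adm_measurableP; exact: admM.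
move=> w _; rewrite indicE.
case: (pselect (N w)) => Nw.
  rewrite memNset ?mul0r; last by move=> /(_ Nw).
  by under eq_fun do rewrite mul0r; exact: cvg_cst.
rewrite mem_set// mul1r; under eq_fun do rewrite mul1r.
by move: Nw => /contrapT.
Qed.

End brownian.

(** * Law and independence of Brownian increments *)

Section increments.
Context {R : realType} {disp : measure_display} {Omega : measurableType disp}.
Variables (P : probability Omega R) (d : nat) (T : R) (B : R -> Omega -> 'rV[R]_d).
Hypothesis Pcomplete : measure_is_complete P.
Hypothesis BM : standard_brownian_motion P T B.

Notation F := (augmented_filtration P B).
Notation adm := (adm P B).

Definition incr (s t : R) (l : 'I_d) (w : Omega) : R := B t w 0 l - B s w 0 l.

Lemma measurable_incr s t l : 0 <= s <= T -> 0 <= t <= T ->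
  measurable_fun setT (incr s t l).
Proof.
by move=> sT tT; apply: measurable_funB; exact: (measurable_BM BM).
Qed.

Lemma incrxx t l w : incr t t l w = 0. Proof. by rewrite /incr subrr. Qed.

Lemma adm_incr s t u l : 0 <= s -> s <= t -> t <= u -> adm u (incr s t l).
Proof.
move=> s0 st tu; apply: admB; apply: adm_BM => //.
- exact: le_trans st.
- exact: le_trans tu.
Qed.

Lemma negligible_setD_measure (A A' : set Omega) : measurable A -> measurable A' ->
  P.-negligible (A `\` A') -> P A = P (A `&` A').
Proof.
move=> mA mA' nA; rewrite -[in LHS](setDUK (A := A `&` A') (B := A)); last by move=> w [].
rewrite measureU; first last.
- by rewrite setDE setICA setICr setI0.
- by apply: measurableD => //; exact: measurableI.
- exact: measurableI.
rewrite [X in (_ + X)%E]measure_negligible ?adde0//; first by apply: measurableD => //; exact: measurableI.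
by apply: negligibleS nA => w [Aw nAA']; split => // A'w; apply: nAA'.
Qed.

(* The hypothesis gives independence of the increments from the natural
   filtration only; it extends to the augmented one since a set of the latter
   differs from a set of the former by a null set. *)
Lemma augmented_filtration_approx s A : F s A ->
  exists2 A', natural_filtration B s A' &
    P.-negligible ((A `\` A') `|` (A' `\` A)).
Proof.
pose H := [set A | exists2 A', natural_filtration B s A' &
    P.-negligible ((A `\` A') `|` (A' `\` A))].
have sN : sigma_algebra setT (natural_filtration B s) by exact: smallest_sigma_algebra.
suff : F s `<=` H by exact.
apply: smallest_sub; first split.
- exists set0; first by case: sN.
  by rewrite !setD0 setU0; exact: negligible_set0.
- move=> E [E' nE' nEE']; exists (~` E').
    by case: sN => _ /(_ _ nE'); rewrite setTD.
  apply: negligibleS nEE' => w /= [[[_ nE]]|[nE'w nnE]].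
    by move=> /contrapT E'w; right.
  by left; split=> //; apply: contrapT => nEw; apply: nnE.
- move=> E HE; have /choice[E' HE'] : forall n, exists E', natural_filtration B s E' /\
      P.-negligible ((E n `\` E') `|` (E' `\` E n)).
    by move=> n; have [E' ? ?] := HE n; exists E'.
  exists (\bigcup_n E' n); first by case: sN => _ _; apply => n; case: (HE' n).
  apply: negligibleS (negligible_bigcup (fun n => (HE' n).2)) => w /= [[[n _ En] nE']|[[n _ E'n] nE]].
    by exists n => //; left; split => // E'n; apply: nE'; exists n.
  by exists n => //; right; split => // En; apply: nE; exists n.
- move=> E [nE|nE]; first by exists E => //; rewrite !setDv setU0; exact: negligible_set0.
  exists set0; first by case: sN.
  by rewrite setD0 set0D setU0.
Qed.

Definition incr_box s t (A : 'I_d -> set R) : set Omega :=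
  [set w | forall k, A k (incr s t k w)].

Lemma incr_boxE s t A :
  incr_box s t A = [set w | forall k, A k ((B t w - B s w) 0 k)].
Proof.
by apply/seteqP; split=> w /= + k => /(_ k); rewrite /incr !mxE.
Qed.

Lemma measurable_incr_box s t A : 0 <= s <= T -> 0 <= t <= T ->
  (forall k, measurable (A k)) -> measurable (incr_box s t A).
Proof.
move=> sT tT mA.
have -> : incr_box s t A = \big[setI/setT]_k (incr s t k @^-1` (A k)).
  apply/seteqP; split => w /=.
    by move=> Aw; elim/big_ind : _ => //= X Y; split.
  by move=> + k; rewrite (bigD1 k)//= => -[].
apply: big_ind => //; first by move=> X Y; exact: measurableI.
by move=> k _; rewrite -[_ @^-1` _]setTI; exact: measurable_incr.
Qed.

Lemma augmented_indep_box s t A E : 0 <= s -> s < t -> t <= T ->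
  (forall k, measurable (A k)) -> F s E ->
  P (E `&` incr_box s t A) = (P E * P (incr_box s t A))%E.
Proof.
move=> s0 st tT mA FE.
have sT : 0 <= s <= T by rewrite s0 (le_trans (ltW st)).
have tT' : 0 <= t <= T by rewrite tT (le_trans s0)// ltW.
have [E' nE' nEE'] := augmented_filtration_approx FE.
have mE : measurable E := augmented_filtration_measurable Pcomplete BM sT FE.
have mE' : measurable E' := natural_filtration_measurable BM sT nE'.
have mb := measurable_incr_box sT tT' mA.
have nEE'1 : P.-negligible (E `\` E') by apply: negligibleS nEE' => w; left.
have nEE'2 : P.-negligible (E' `\` E) by apply: negligibleS nEE' => w; right.
have PE : P E = P E'.
  by rewrite (negligible_setD_measure mE mE')// setIC -(negligible_setD_measure mE' mE).
have PEb : P (E `&` incr_box s t A) = P (E' `&` incr_box s t A).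
  rewrite (negligible_setD_measure (A' := E' `&` incr_box s t A)); try exact: measurableI.
    rewrite setIC -(negligible_setD_measure (A' := E `&` incr_box s t A)) //; try exact: measurableI.
    by apply: negligibleS nEE'2 => w [[E'w bw] nE]; split=> // Ew; apply: nE.
  by apply: negligibleS nEE'1 => w [[Ew bw] nE]; split=> // E'w; apply: nE.
rewrite PE PEb incr_boxE.
by case: BM => _ _ _ /(_ s t A E' s0 st tT mA nE').
Qed.

Lemma incr_box_law s t A : 0 <= s -> s < t -> t <= T ->
  (forall k, measurable (A k)) ->
  P (incr_box s t A) = (\prod_(k < d) normal_prob 0 (Num.sqrt (t - s)) (A k))%E.
Proof.
by move=> s0 st tT mA; rewrite incr_boxE; case: BM => _ _ _ _ /(_ s t A s0 st tT mA).
Qed.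

(** A box constraining the component [l] alone; the other factors of the product law have
    probability 1. *)
Let slab (l : 'I_d) (U : set R) (k : 'I_d) := if k == l then U else setT.

Let measurable_slab l U k : measurable U -> measurable (slab l U k).
Proof. by rewrite /slab; case: ifP. Qed.

Lemma incr_preimage s t l U : incr s t l @^-1` U = incr_box s t (slab l U).
Proof.
apply/seteqP; split=> w /=; last by move/(_ l); rewrite /slab eqxx.
by move=> Uw k; rewrite /slab; case: eqP => [->|].
Qed.

Lemma incr_law s t l U : 0 <= s -> s < t -> t <= T -> measurable U ->
  P (incr s t l @^-1` U) = normal_prob 0 (Num.sqrt (t - s)) U.
Proof.
move=> s0 st tT mU; rewrite incr_preimage incr_box_law//; last first.
  by move=> k; exact: measurable_slab.
rewrite (bigD1 l)//= /slab eqxx big1 ?mule1// => k /negbTE ->.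
exact: probability_setT.
Qed.

Lemma incr2_law s t l m U V : l != m -> 0 <= s -> s < t -> t <= T ->
  measurable U -> measurable V ->
  P (incr s t l @^-1` U `&` incr s t m @^-1` V) =
  (P (incr s t l @^-1` U) * P (incr s t m @^-1` V))%E.
Proof.
move=> lm s0 st tT mU mV; rewrite !incr_law//.
have -> : incr s t l @^-1` U `&` incr s t m @^-1` V =
    incr_box s t (fun k => if k == l then U else slab m V k).
  apply/seteqP; split=> w /=.
    by move=> [Uw Vw] k; rewrite /slab; case: eqP => [->//|_]; case: eqP => [->|].
  move=> H; split; first by have := H l; rewrite eqxx.
  by have := H m; rewrite eq_sym (negbTE lm) /slab eqxx.
rewrite incr_box_law//; last by move=> k; case: ifP => // _; exact: measurable_slab.
have ml : m != l by rewrite eq_sym.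
rewrite (bigD1 l)//= eqxx (bigD1 m)//= (negbTE ml) /slab eqxx.
rewrite big1 ?mule1// => k /andP[/negbTE -> /negbTE ->].
exact: probability_setT.
Qed.

Lemma indep_incr s t l Z : 0 <= s -> s < t -> t <= T -> adm s Z ->
  indep P Z (incr s t l).
Proof.
move=> s0 st tT aZ U V mU mV; rewrite incr_preimage.
by apply: augmented_indep_box => //; [move=> k; exact: measurable_slab|exact: aZ].
Qed.

(** Different components of one increment are independent of each other and jointly of the past.
    This gives [Z * incr l * incr m] mean zero for [l != m], so that the second-order terms produce
    inner products of the [h i]. *)
Lemma indep_incr2 s t l m Z : l != m -> 0 <= s -> s < t -> t <= T -> adm s Z ->
  indep P (fun w => Z w * incr s t l w) (incr s t m).
Proof.
move=> lm s0 st tT aZ U V mU mV.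
have sT : 0 <= s <= T by rewrite s0 (le_trans (ltW st)).
have tT' : 0 <= t <= T by rewrite tT (le_trans s0)// ltW.
have mZ := adm_measurable Pcomplete BM sT aZ.
apply: (indep_restr (f := fun z : R * R => z.1 * z.2) mZ (measurable_incr l sT tT')) => //.
- by rewrite -[_ @^-1` _]setTI; exact: measurable_incr.
- exact: measurable_funM.
move=> A A' mA mA'; rewrite (indep_incr l s0 st tT aZ)//.
rewrite -setIA -muleA -incr2_law//.
have -> : incr s t l @^-1` A' `&` incr s t m @^-1` V =
    incr_box s t (fun k => if k == l then A' else slab m V k).
  apply/seteqP; split=> w /=.
    by move=> [Uw Vw] k; rewrite /slab; case: eqP => [->//|_]; case: eqP => [->|].
  move=> H; split; first by have := H l; rewrite eqxx.
  by have := H m; rewrite eq_sym (negbTE lm) /slab eqxx.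
apply: augmented_indep_box => //; last exact: aZ.
by move=> k; case: ifP => // _; exact: measurable_slab.
Qed.

Lemma ge0_integral_incr s t l (g : R -> \bar R) : 0 <= s -> s < t -> t <= T ->
  measurable_fun setT g -> (forall x, 0 <= g x)%E ->
  (\int[P]_w g (incr s t l w) = \int[normal_prob 0 (Num.sqrt (t - s))]_x g x)%E.
Proof.
move=> s0 st tT mg g0.
have sT : 0 <= s <= T by rewrite s0 (le_trans (ltW st)).
have tT' : 0 <= t <= T by rewrite tT (le_trans s0)// ltW.
have mi := measurable_incr l sT tT'.
pose mi' : measurable_fun (U := measurableTypeR R) setT (incr s t l) := mi.
rewrite -[LHS](ge0_integral_distribution (mfun_of mi') mg g0).
apply: eq_measure_integral => U mU _.
exact: incr_law.
Qed.

Lemma has_integral_incr_sqr s t l : 0 <= s -> s <= t -> t <= T ->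
  has_integral P setT (fun w => incr s t l w ^+ 2) (t - s).
Proof.
move=> s0; rewrite le_eqVlt => /predU1P[<-|st] tT.
  rewrite subrr; apply: has_integral_eq (has_integral0 P _) => // w _.
  by rewrite incrxx expr0n.
have sT : 0 <= s <= T by rewrite s0 (le_trans (ltW st)).
have tT' : 0 <= t <= T by rewrite tT (le_trans s0)// ltW.
have e : (\int[P]_w (incr s t l w ^+ 2)%:E = (t - s)%:E)%E.
  rewrite (ge0_integral_incr l (g := fun x => (x ^+ 2)%:E))//.
  - by rewrite normal_var ?sqrtr_gt0 ?subr_gt0// sqr_sqrtr// subr_ge0 ltW.
  - by apply/measurable_EFinP; exact: measurable_funX.
  - by move=> x; rewrite lee_fin sqr_ge0.
split=> //; apply/integrableP; split.
  by apply/measurable_EFinP; apply: measurable_funX; exact: measurable_incr.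
by under eq_integral do rewrite /= ger0_norm ?sqr_ge0//; rewrite e ltry.
Qed.

Lemma integrable_incr s t l : 0 <= s -> s <= t -> t <= T ->
  P.-integrable setT (EFin \o incr s t l).
Proof.
move=> s0 st tT.
have sT : 0 <= s <= T by rewrite s0 (le_trans st).
have tT' : 0 <= t <= T by rewrite tT (le_trans s0).
have [i e] := has_integral_incr_sqr l s0 st tT.
have e' : (\int[P]_w (incr s t l w ^+ 2)%:E < +oo)%E by rewrite e ltry.
have c : (\int[P]_w ((cst 1 : Omega -> R) w ^+ 2)%:E < +oo)%E.
  under eq_integral do rewrite expr1n.
  by rewrite integral_cst//= probability_setT mule1 ltry.
have := integrable_mul_L2 measurableT (measurable_incr l sT tT')
  (@measurable_cst _ _ _ _ setT (1 : R)) e' c.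
by apply: eq_integrable => // w _ /=; rewrite mulr1.
Qed.

Lemma has_integral_incr s t l : 0 <= s -> s <= t -> t <= T ->
  has_integral P setT (incr s t l) 0.
Proof.
move=> s0 st tT; split; first exact: integrable_incr.
move: st; rewrite le_eqVlt => /predU1P[<-|st].
  by apply: integral0_eq => w _; rewrite incrxx.
have sT : 0 <= s <= T by rewrite s0 (le_trans (ltW st)).
have tT' : 0 <= t <= T by rewrite tT (le_trans s0)// ltW.
have mi := measurable_incr l sT tT'.
have mid : measurable_fun setT (fun x : R => x%:E) by exact/measurable_EFinP.
pose mi' : measurable_fun (U := measurableTypeR R) setT (incr s t l) := mi.
have -> : (\int[P]_w (incr s t l w)%:E = \int[distribution P (mfun_of mi')]_x x%:E)%E.
  rewrite (integral_distribution (X := mfun_of mi') mid)//.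
  exact: integrable_incr (ltW st) tT.
rewrite (eq_measure_integral (normal_prob 0 (Num.sqrt (t - s)))); last first.
  by move=> U mU _; exact: incr_law.
by rewrite normal_mean// sqrtr_gt0 subr_gt0.
Qed.

Lemma has_integral_adm_incr s t l Z c : 0 <= s -> s <= t -> t <= T ->
  adm s Z -> has_integral P setT Z c ->
  has_integral P setT (fun w => Z w * incr s t l w) 0.
Proof.
move=> s0 + tT aZ [iZ eZ]; rewrite le_eqVlt => /predU1P[<-|st].
  apply: has_integral_eq (has_integral0 P _) => // w _.
  by rewrite incrxx mulr0.
have [iI eI] := has_integral_incr l s0 (ltW st) tT.
have ii := indep_incr l s0 st tT aZ.
split; first exact: indep_integrable.
by rewrite (indep_expectationM ii)// eZ eI mule0.
Qed.

(** This is the conditional covariance matrix of the increment given the past, phrased without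
    conditional expectations by testing against adapted [Z]. *)
Lemma has_integral_adm_incr2 s t l m Z c : 0 <= s -> s <= t -> t <= T ->
  adm s Z -> has_integral P setT Z c ->
  has_integral P setT (fun w => Z w * (incr s t l w * incr s t m w))
    (c * ((t - s) *+ (l == m))).
Proof.
move=> s0 + tT aZ [iZ eZ]; rewrite le_eqVlt => /predU1P[<-|st].
  rewrite subrr mul0rn mulr0; apply: has_integral_eq (has_integral0 P _) => // w _.
  by rewrite incrxx mul0r mulr0.
have [iI eI] := has_integral_incr m s0 (ltW st) tT.
have [<-|lm] := eqVneq l m.
  have [iI2 eI2] := has_integral_incr_sqr l s0 (ltW st) tT.
  have ii : indep P Z (fun w => incr s t l w ^+ 2).
    move=> U V mU mV.
    have := indep_incr l s0 st tT aZ mU.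
    move=> /(_ ((fun x : R => x ^+ 2) @^-1` V)); apply.
    by rewrite -[_ @^-1` _]setTI; exact: measurable_funX.
  split; first exact: indep_integrable ii _ _.
  by rewrite mulr1n EFinM -eI2 -eZ -(indep_expectationM ii).
have ii := indep_incr2 lm s0 st tT aZ.
have [iZl eZl] := has_integral_adm_incr l s0 (ltW st) tT aZ (conj iZ eZ).
rewrite mulr0n mulr0.
apply: (@has_integral_eq _ _ _ _ _ measurableT
  (fun w => (Z w * incr s t l w) * incr s t m w)).
  by move=> w _; rewrite /= mulrA.
split; first exact: (indep_integrable ii).
by rewrite (indep_expectationM ii)// eZl mul0e.
Qed.

End increments.

(** * Ito isometry for simple processes *)

Section isometry.
Context {R : realType} {disp : measure_display} {Omega : measurableType disp}.
Variables (P : probability Omega R) (d : nat) (T : R) (B : R -> Omega -> 'rV[R]_d).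
Hypothesis Pcomplete : measure_is_complete P.
Hypothesis BM : standard_brownian_motion P T B.

Notation F := (augmented_filtration P B).
Notation adm := (adm P B).
Notation incr := (incr B).

(** The length of the intersection of []a, b]] and []a', b']]. With it the isometry holds for
    arbitrary families of intervals, and no common refinement of two subdivisions is formed. *)
Definition overlap (a b a' b' : R) : R :=
  Num.max 0 (Num.min b b' - Num.max a a').

Lemma overlapC a b a' b' : overlap a b a' b' = overlap a' b' a b.
Proof. by rewrite /overlap [Num.min b _]minC [Num.max a _]maxC. Qed.

Let square_finite (e : Omega -> R) := (\int[P]_w (e w ^+ 2)%:E < +oo)%E.

Let expect (f : Omega -> R) : R := fine (\int[P]_w (f w)%:E)%E.

Lemma square_finite_adm_incr a b l e : 0 <= a -> a <= b -> b <= T -> adm a e ->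
  square_finite e -> square_finite (fun w => e w * incr a b l w).
Proof.
move=> a0 ab bT ae e2.
have aT : 0 <= a <= T by rewrite a0 (le_trans ab).
have me := adm_measurable Pcomplete BM aT ae.
have i2 : P.-integrable setT (fun w => (e w * e w)%:E) by exact: integrable_mul_L2.
have [_ h] := has_integral_adm_incr2 Pcomplete BM l l a0 ab bT (admM ae ae)
  (has_integral_integrable measurableT i2).
rewrite /square_finite; under eq_integral.
  move=> w _; rewrite (_ : _ ^+ 2 = e w * e w * (incr a b l w * incr a b l w)); last by ring.
  over.
by rewrite h ltry.
Qed.

(** With [a <= a'], cut both intervals at [a'] and at the smaller right end [c]. A product
    containing one increment later than all its other factors has mean zero, so only the common
    stretch []a', c]] contributes. *)
Lemma has_integral_cov a b a' b' l m e e' :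
  0 <= a -> a <= b -> b <= T -> 0 <= a' -> a' <= b' -> b' <= T ->
  adm a e -> adm a' e' -> square_finite e -> square_finite e' ->
  has_integral P setT (fun w => (e w * incr a b l w) * (e' w * incr a' b' m w))
    (expect (fun w => e w * e' w) * (overlap a b a' b' *+ (l == m))).
Proof.
wlog aa' : a b a' b' l m e e' / a <= a'.
  move=> H a0 ab bT a'0 a'b' b'T ae ae' e2 e'2.
  have [aa'|/ltW a'a] := leP a a'; first exact: H.
  have := H a' b' a b m l e' e a'a a'0 a'b' b'T a0 ab bT ae' ae e'2 e2.
  rewrite eq_sym overlapC (_ : expect _ = expect (fun w => e w * e' w)).
    by apply: has_integral_eq => // w _; rewrite mulrC.
  by rewrite /expect; congr fine; apply: eq_integral => w _; rewrite mulrC.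
move=> a0 ab bT a'0 a'b' b'T ae ae' e2 e'2.
have aT : 0 <= a <= T by rewrite a0 (le_trans ab).
have a'T : 0 <= a' <= T by rewrite a'0 (le_trans a'b').
have me := adm_measurable Pcomplete BM aT ae.
have me' := adm_measurable Pcomplete BM a'T ae'.
have bT' : 0 <= b <= T by rewrite bT (le_trans a0).
have b'T' : 0 <= b' <= T by rewrite b'T (le_trans a'0).
have mi s t k : 0 <= s <= T -> 0 <= t <= T -> measurable_fun setT (incr s t k).
  exact: measurable_incr BM _ _ _.
have hE (X Y : Omega -> R) : measurable_fun setT X -> measurable_fun setT Y ->
    square_finite X -> square_finite Y ->
    has_integral P setT (fun w => X w * Y w) (expect (fun w => X w * Y w)).
  move=> mX mY X2 Y2; apply: has_integral_integrable => //.
  exact: integrable_mul_L2.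
have ae1 : adm a' e by exact: adm_le ae.
have [ba'|a'b] := leP b a'.
  have -> : overlap a b a' b' = 0.
    rewrite /overlap (max_idPr aa'); apply/max_idPl; rewrite subr_le0.
    by rewrite (le_trans _ ba')// ge_min lexx.
  rewrite mul0rn mulr0.
  have aZ : adm a' (fun w => (e w * incr a b l w) * e' w).
    by apply: admM => //; apply: admM => //; exact: adm_incr.
  have hZ := hE _ _ (measurable_funM me (mi _ _ l aT bT')) me'
    (square_finite_adm_incr l a0 ab bT ae e2) e'2.
  apply: has_integral_eq (has_integral_adm_incr Pcomplete BM m a'0 a'b' b'T aZ hZ) => //.
  by move=> w _; rewrite mulrA.
have a'leb := ltW a'b.
have h1 : has_integral P setT
    (fun w => ((e w * incr a a' l w) * e' w) * incr a' b' m w) 0.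
  have aZ : adm a' (fun w => (e w * incr a a' l w) * e' w).
    by apply: admM => //; apply: admM => //; exact: adm_incr.
  apply: (has_integral_adm_incr Pcomplete BM m a'0 a'b' b'T aZ).
  apply: hE => //; first exact: measurable_funM me (mi _ _ l aT a'T).
  by apply: square_finite_adm_incr => //; exact: le_trans bT.
pose c := Num.min b b'.
have a'c : a' <= c by rewrite le_min a'leb.
have cb : c <= b by rewrite ge_min lexx.
have cb' : c <= b' by rewrite ge_min lexx orbT.
have cT : c <= T by exact: le_trans bT.
have c0 : 0 <= c by exact: le_trans a'c.
have cT' : 0 <= c <= T by rewrite c0.
have -> : overlap a b a' b' = c - a'.
  by rewrite /overlap (max_idPr aa'); apply/max_idPr; rewrite subr_ge0.
have h2 := has_integral_adm_incr2 Pcomplete BM l m a'0 a'c cT (admM ae1 ae')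
  (hE _ _ me me' e2 e'2).
have h3 : has_integral P setT
    (fun w => (e w * incr a' c l w * e' w) * incr c b' m w) 0.
  have aZ : adm c (fun w => (e w * incr a' c l w) * e' w).
    apply: admM; last exact: adm_le ae'.
    by apply: admM; [exact: adm_le ae1|exact: adm_incr].
  apply: (has_integral_adm_incr Pcomplete BM m c0 cb' b'T aZ).
  apply: hE => //; first exact: measurable_funM me (mi _ _ l a'T cT').
  exact: square_finite_adm_incr.
have h4 : has_integral P setT
    (fun w => (e w * (e' w * incr a' c m w)) * incr c b l w) 0.
  have aZ : adm c (fun w => e w * (e' w * incr a' c m w)).
    apply: admM; first exact: adm_le ae1.
    by apply: admM; [exact: adm_le ae'|exact: adm_incr].
  apply: (has_integral_adm_incr Pcomplete BM l c0 cb bT aZ).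
  apply: hE => //; first exact: measurable_funM me' (mi _ _ m a'T cT').
  exact: square_finite_adm_incr.
have := has_integralD measurableT h1 (has_integralD measurableT h2
  (has_integralD measurableT h3 h4)).
rewrite add0r !addr0; apply: has_integral_eq => // w _.
(* The four products add up to the full one because one of the two tails beyond [c] is empty. *)
have cbb' : c = b \/ c = b'.
  by rewrite /c; case: (leP b b') => _; [left|right].
by rewrite /incr; case: cbb' => ->; ring.
Qed.

Section finite_sums.
Variables (I : finType) (e : I -> 'I_d -> Omega -> R) (a b : I -> R).
Hypotheses (a0 : forall i, 0 <= a i) (ab : forall i, a i <= b i)
  (bT : forall i, b i <= T) (ae : forall i l, adm (a i) (e i l))
  (e2 : forall i l, square_finite (e i l)).

Let energy (w : Omega) : R :=
  \sum_i \sum_j \sum_l overlap (a i) (b i) (a j) (b j) * (e i l w * e j l w).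

(** The index type is any finite one and the intervals may overlap, so the difference of two simple
    integrals is an instance. The energy is kept as a double sum over overlaps, which
    [integral_step_energy] recognizes as a time integral. *)
Lemma ito_isometry :
  (\int[P]_w ((\sum_i \sum_l e i l w * incr (a i) (b i) l w) ^+ 2)%:E =
   \int[P]_w (energy w)%:E)%E.
Proof.
have hz (i j : I) (l m : 'I_d) := has_integral_cov l m (a0 i) (ab i) (bT i) (a0 j) (ab j) (bT j)
  (@ae i l) (@ae j m) (@e2 i l) (@e2 j m).
have me i l : measurable_fun setT (e i l).
  by apply: (adm_measurable Pcomplete BM _ (@ae i l)); rewrite a0 (le_trans (ab i)).
have he (i j : I) (l : 'I_d) : has_integral P setT (fun w => e i l w * e j l w)
    (expect (fun w => e i l w * e j l w)).
  apply: has_integral_integrable => //.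
  exact: (integrable_mul_L2 measurableT (me i l) (me j l) (@e2 i l) (@e2 j l)).
have hE := has_integral_sum measurableT (index_enum I) (fun i =>
  has_integral_sum measurableT (index_enum I) (fun j =>
  has_integral_sum measurableT (index_enum 'I_d) (fun l =>
  has_integralZ measurableT (overlap (a i) (b i) (a j) (b j)) (he i j l)))).
have hS := has_integral_sum measurableT (index_enum I) (fun i =>
  has_integral_sum measurableT (index_enum I) (fun j =>
  has_integral_sum measurableT (index_enum 'I_d) (fun l =>
  has_integral_sum measurableT (index_enum 'I_d) (fun m => hz i j l m)))).
rewrite [RHS](proj2 hE).
have /(_ (fun w => (\sum_i \sum_l e i l w * incr (a i) (b i) l w) ^+ 2)) {}hS :=
  fun f fE => proj2 (@has_integral_eq _ _ _ P setT measurableT _ f _ fE hS).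
rewrite [LHS]hS; last first.
  move=> w _; rewrite expr2 big_distrlr; apply: eq_bigr => i _.
  by apply: eq_bigr => j _; rewrite big_distrlr.
congr EFin.
apply: eq_bigr => i _; apply: eq_bigr => j _; apply: eq_bigr => l _.
rewrite (bigD1 l)//= big1 ?addr0 ?eqxx ?mulr1n 1?mulrC// => m.
by rewrite eq_sym => /negbTE ->; rewrite mulr0n mulr0.
Qed.

Lemma measurable_energy : measurable_fun setT energy.
Proof.
have me i l : measurable_fun setT (e i l).
  by apply: (adm_measurable Pcomplete BM _ (@ae i l)); rewrite a0 (le_trans (ab i)).
apply: measurable_sum => i; apply: measurable_sum => j.
apply: measurable_sum => l; apply: measurable_funM => //.
exact: measurable_funM.
Qed.

End finite_sums.

Lemma has_integral_indic_itv (a b a' b' : R) :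
  0 <= a -> b <= T ->
  has_integral (@lebesgue_measure R) `[0, T]
    (fun s => ((a < s <= b)%R%:R : R) * (a' < s <= b')%R%:R)
    (overlap a b a' b').
Proof.
move=> a0 bT.
have E s : ((a < s <= b)%R%:R : R) * (a' < s <= b')%R%:R =
    \1_(`]Num.max a a', Num.min b b']) s.
  rewrite indicE mem_setE in_itv /= gt_max le_min -natrM mulnb.
  by congr (_%:R); case: (a < s); case: (s <= b); case: (a' < s).
rewrite (_ : (fun s => _) = \1_(`]Num.max a a', Num.min b b'])); last exact/funext.
split; first by apply: (integrableS measurableT) => //; exact: integrable_indic_itv.
rewrite integral_indic//= setIidl; last first.
  move=> s /=; rewrite !in_itv /= gt_max le_min.
  case/and3P => /andP[ltas _] sb _.
  by rewrite (ltW (le_lt_trans a0 ltas)) (le_trans sb).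
rewrite lebesgue_measure_itv/= lte_fin /overlap.
case: ltP => h; first by rewrite -EFinB; congr EFin; apply/esym/max_idPr; rewrite subr_ge0 ltW.
by congr EFin; apply/esym/max_idPl; rewrite subr_le0.
Qed.

Lemma integral_step_energy (I : finType) (c : I -> 'I_d -> R) (a b : I -> R) :
  (forall i, 0 <= a i) -> (forall i, b i <= T) ->
  (\int[@lebesgue_measure R]_(s in `[0%R, T])
     (\sum_l (\sum_i c i l * (a i < s <= b i)%R%:R) ^+ 2)%:E =
   (\sum_i \sum_j \sum_l overlap (a i) (b i) (a j) (b j) * (c i l * c j l))%:E)%E.
Proof.
move=> a0 bT.
have mD : measurable (`[0, T] : set (measurableTypeR R)) by exact: measurable_itv.
have hS := has_integral_sum mD (index_enum I) (fun i =>
  has_integral_sum mD (index_enum I) (fun j =>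
  has_integral_sum mD (index_enum 'I_d) (fun l =>
  has_integralZ mD (c i l * c j l)
    (has_integral_indic_itv (a j) (b j) (a0 i) (bT i))))).
have /(_ (fun s => \sum_l (\sum_i c i l * (a i < s <= b i)%R%:R) ^+ 2)) {}hS :=
  fun f fE => proj2 (@has_integral_eq _ _ _ _ _ mD _ f _ fE hS).
rewrite [LHS]hS; last first.
  move=> s _; rewrite [in RHS](eq_bigr (fun l => \sum_i \sum_j (c i l * (a i < s <= b i)%R%:R) *
    (c j l * (a j < s <= b j)%R%:R))); last by move=> l _; rewrite expr2 big_distrlr.
  rewrite [RHS]exchange_big /=; apply: eq_bigr => i _.
  rewrite [RHS]exchange_big /=; apply: eq_bigr => j _.
  by apply: eq_bigr => l _; ring.
congr EFin.
apply: eq_bigr => i _; apply: eq_bigr => j _; apply: eq_bigr => l _.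
by rewrite mulrC.
Qed.

End isometry.

Lemma cvge0_le {R : realType} (u : nat -> \bar R) (e : R) :
  u n @[n --> \oo] --> 0%E -> 0 < e -> exists N, forall n, (N <= n)%N -> (u n <= e%:E)%E.
Proof.
move=> u0 e0.
have : nbhs (0%E : \bar R) [set y | (y < e%:E)%E].
  by apply: open_nbhs_nbhs; split; [exact: open_ereal_lt_ereal|rewrite /= lte_fin].
by move=> /u0 [N _ HN]; exists N => n /HN/ltW.
Qed.

Lemma le_cvge0 {R : realType} (u : nat -> \bar R) :
  (forall n, 0 <= u n)%E ->
  (forall e : R, 0 < e -> exists N, forall n, (N <= n)%N -> (u n <= e%:E)%E) ->
  u n @[n --> \oo] --> 0%E.
Proof.
move=> u0 H.
have fu n : (exists e : R, (u n <= e%:E)%E) -> u n = (fine (u n))%:E.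
  by move=> [e ue]; rewrite fineK// ge0_fin_numE// (le_lt_trans ue)// ltry.
have [N0 HN0] := H 1 ltr01.
apply: cvg_trans (_ : (fine (u n))%:E @[n --> \oo] --> 0%E).
  apply: near_eq_cvg; exists N0 => // n /= Nn; apply/esym/fu.
  by exists 1; exact: HN0.
apply/fine_cvgP; split; first by near=> n.
apply/cvgrPdist_le => e e0; have [N HN] := H e e0.
exists (maxn N N0) => // n /=; rewrite geq_max => /andP[Nn N0n].
rewrite sub0r normrN ger0_norm ?fine_ge0// -lee_fin -fu ?HN//.
by exists 1; exact: HN0.
Unshelve. all: by end_near. Qed.

Lemma measurable_step {R : realType} (D : set (measurableTypeR R)) (a b : R) :
  measurable_fun D (fun s : measurableTypeR R => (a < s <= b)%R%:R : R).
Proof.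
rewrite (_ : (fun s => _) = \1_(`]a, b] : set (measurableTypeR R))).
  by apply: measurable_funTS; exact: measurable_indic.
by apply/funext => s; rewrite indicE mem_setE in_itv.
Qed.

Lemma integral_le_lin2 {R : realType} d (S : measurableType d)
    (mu : {measure set S -> \bar R}) (D : set S) (f f1 f2 : S -> \bar R) (a b : R) :
  measurable D -> measurable_fun D f -> measurable_fun D f1 -> measurable_fun D f2 ->
  (forall x, 0 <= f x)%E -> (forall x, 0 <= f1 x)%E -> (forall x, 0 <= f2 x)%E ->
  0 <= a -> 0 <= b ->
  (forall x, D x -> f x <= a%:E * f1 x + b%:E * f2 x)%E ->
  (\int[mu]_(x in D) f x <=
   a%:E * \int[mu]_(x in D) f1 x + b%:E * \int[mu]_(x in D) f2 x)%E.
Proof.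
move=> mD mf mf1 mf2 f0 f10 f20 a0 b0 H.
have m1 : measurable_fun D (fun x => a%:E * f1 x)%E by exact: emeasurable_funM.
have m2 : measurable_fun D (fun x => b%:E * f2 x)%E by exact: emeasurable_funM.
rewrite -!ge0_integralZl// -ge0_integralD//; first last.
- by move=> x _; rewrite mule_ge0// lee_fin.
- by move=> x _; rewrite mule_ge0// lee_fin.
apply: ge0_le_integral => //.
exact: emeasurable_funD.
Qed.

Lemma measurable_section {R : realType} d d1 d2 (S1 : measurableType d1)
    (S2 : measurableType d2) (S3 : measurableType d) (D : set S1) (f : S1 * S2 -> S3) w :
  measurable D -> measurable_fun (D `*` setT) f -> measurable_fun D (fun s => f (s, w)).
Proof.
move=> mD mf; apply: (measurable_comp (F := D `*` setT)) mf _ => //.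
- exact: measurableX.
- by move=> _ [s Ds <-].
- by apply: measurable_funTS; apply: measurable_fun_pair => //; exact: measurable_cst.
Qed.

Lemma measurable_dotpB {R : realType} d n (S : measurableType d) (D : set S)
    (u v : S -> 'rV[R]_n) :
  (forall l, measurable_fun D (fun x => u x 0 l)) ->
  (forall l, measurable_fun D (fun x => v x 0 l)) ->
  measurable_fun D (fun x => dotp (u x - v x) (u x - v x)).
Proof.
move=> mu mv; apply: measurable_sum => l.
suff m1 : measurable_fun D (fun x => (u x - v x) 0 l) by exact: measurable_funM.
rewrite (_ : (fun x => _) = fun x => u x 0 l - v x 0 l).
  exact: measurable_funB.
by apply/funext => x; rewrite !mxE.
Qed.

(** * Exchange of expectation and time integral *)

Section tonelli.
Context {R : realType} {disp : measure_display} {Omega : measurableType disp}.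
Variables (P : probability Omega R) (D : set (measurableTypeR R)).
Hypothesis mD : measurable D.
Notation leb := (@lebesgue_measure R).
Variable f : measurableTypeR R * Omega -> R.
Hypothesis mf : measurable_fun (D `*` setT) f.
Hypothesis f0 : forall z, 0 <= f z.

(** The extension by 0 off [D] to the whole product space, where Tonelli's theorem applies. *)
Let g : measurableTypeR R * Omega -> \bar R := (fun z => (f z)%:E) \_ (D `*` setT).

Let mg : measurable_fun setT g.
Proof.
apply/(measurable_restrictT _ _).1 => //; first exact: measurableX.
exact/measurable_EFinP.
Qed.

Let g0 z : (0 <= g z)%E.
Proof. by rewrite /g patchE; case: ifP => // _; rewrite lee_fin. Qed.

Let sectionE w : (\int[leb]_(s in D) (f (s, w))%:E = \int[leb]_s g (s, w))%E.
Proof.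
rewrite integral_mkcond; apply: eq_integral => s _; rewrite /g !patchE.
by rewrite in_setX in_setT andbT.
Qed.

Lemma measurable_section_integral :
  measurable_fun setT (fun w => \int[leb]_(s in D) (f (s, w))%:E)%E.
Proof.
rewrite (_ : (fun w => _) = fubini_G leb g).
  exact: measurable_fun_fubini_tonelli_G.
by apply/funext => w; rewrite sectionE.
Qed.

Lemma tonelli_swap :
  (\int[P]_w \int[leb]_(s in D) (f (s, w))%:E =
   \int[leb]_(s in D) \int[P]_w (f (s, w))%:E)%E.
Proof.
under eq_integral do rewrite sectionE.
rewrite -(fubini_tonelli g)// [RHS]integral_mkcond.
apply: eq_integral => s _; rewrite /g patchE; case: ifPn => sD.
  by apply: eq_integral => w _; rewrite patchE in_setX sD in_setT.
apply: integral0_eq => w _; rewrite patchE in_setX (negbTE sD)//.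
Qed.

End tonelli.

(** * Simple processes and the distance between their integrals *)

Section simple_processes.
Context {R : realType} {disp : measure_display} {Omega : measurableType disp}.
Variables (P : probability Omega R) (d : nat) (T : R) (B : R -> Omega -> 'rV[R]_d).
Hypothesis Pcomplete : measure_is_complete P.
Hypothesis BM : standard_brownian_motion P T B.

Notation F := (augmented_filtration P B).
Notation adm := (adm P B).
Notation incr := (incr B).
Notation leb := (@lebesgue_measure R).
Implicit Types S g : simple_process R d Omega.

Lemma dotp_ge0 (u : 'rV[R]_d) : 0 <= dotp u u.
Proof. by apply: sumr_ge0 => k _; rewrite -expr2 sqr_ge0. Qed.

Lemma sqr_le_dotp (u : 'rV[R]_d) l : u 0 l ^+ 2 <= dotp u u.
Proof.
rewrite /dotp (bigD1 l)//= -expr2 lerDl; apply: sumr_ge0 => k _.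
by rewrite -expr2 sqr_ge0.
Qed.

Lemma simple_integralE S t w : simple_integral B S t w =
  \sum_(k < sp_size S) \sum_l sp_coef S k w 0 l *
    incr (Num.min (sp_time S k) t) (Num.min (sp_time S k.+1) t) l w.
Proof.
by apply: eq_bigr => k _; apply: eq_bigr => l _; rewrite !mxE.
Qed.

Lemma simple_valueE S s w l : simple_value S s w 0 l =
  \sum_(k < sp_size S) sp_coef S k w 0 l *
    (sp_time S k < s <= sp_time S k.+1)%R%:R.
Proof.
by rewrite /simple_value summxE; apply: eq_bigr => k _; rewrite mxE mulrC.
Qed.

Lemma simple_valid_adm S k l : simple_valid P T F S -> (k < sp_size S)%N ->
  adm (sp_time S k) (fun w => sp_coef S k w 0 l).
Proof. by move=> vS kS; have [_ _ _ aS _] := vS _ kS; exact: aS. Qed.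

Lemma simple_valid_time S k : simple_valid P T F S -> (k < sp_size S)%N ->
  0 <= sp_time S k <= T.
Proof.
by move=> vS kS; have [-> tS ? _ _] := vS _ kS; rewrite (le_trans tS).
Qed.

Lemma measurable_simple_coef S k l : simple_valid P T F S -> (k < sp_size S)%N ->
  measurable_fun setT (fun w => sp_coef S k w 0 l).
Proof.
move=> vS kS; apply: (adm_measurable Pcomplete BM _ (simple_valid_adm l vS kS)).
exact: simple_valid_time.
Qed.

Lemma measurable_simple_integral S t : 0 <= t <= T -> simple_valid P T F S ->
  measurable_fun setT (simple_integral B S t).
Proof.
move=> /andP[t0 tT] vS; rewrite (_ : simple_integral B S t = fun w =>
    \sum_(k < sp_size S) \sum_l sp_coef S k w 0 l *
    incr (Num.min (sp_time S k) t) (Num.min (sp_time S k.+1) t) l w); last first.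
  by apply/funext => w; exact: simple_integralE.
apply: measurable_sum => k; apply: measurable_sum => l.
have [S0 SS ST _ _] := vS k (ltn_ord k).
apply: measurable_funM; first exact: measurable_simple_coef.
apply: (measurable_incr BM); rewrite le_min t0 ge_min tT orbT ?S0//.
by rewrite (le_trans S0).
Qed.

Lemma simple_coef_square_finite S k l : simple_valid P T F S -> (k < sp_size S)%N ->
  (\int[P]_w (sp_coef S k w 0 l ^+ 2)%:E < +oo)%E.
Proof.
move=> vS kS; have [_ _ _ _] := vS _ kS; apply: le_lt_trans.
have mS i := measurable_simple_coef i vS kS.
apply: ge0_le_integral => //.
- by move=> w _; rewrite lee_fin sqr_ge0.
- by apply/measurable_EFinP; exact: measurable_funX.
- apply/measurable_EFinP; apply: measurable_sum => i.
  exact: measurable_funM.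
- by move=> w _; rewrite lee_fin sqr_le_dotp.
Qed.

Section distance.
Variables (S g : simple_process R d Omega).
Hypotheses (vS : simple_valid P T F S) (vg : simple_valid P T F g).

(** Both processes are merged into one family over a disjoint sum of index types, the coefficients
    of [g] being negated, so that the isometry applies to the difference at once. *)
Let I := ('I_(sp_size S) + 'I_(sp_size g))%type.
Let ta (i : I) := match i with inl k => sp_time S k | inr k => sp_time g k end.
Let tb (i : I) := match i with inl k => sp_time S k.+1 | inr k => sp_time g k.+1 end.
Let e (i : I) l w := match i with
  | inl k => sp_coef S k w 0 l | inr k => - sp_coef g k w 0 l end.

Let ta0 i : 0 <= ta i.
Proof. by case: i => k /=; [case: (vS (ltn_ord k))|case: (vg (ltn_ord k))]. Qed.

Let tab i : ta i <= tb i.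
Proof. by case: i => k /=; [case: (vS (ltn_ord k))|case: (vg (ltn_ord k))]. Qed.

Let tbT i : tb i <= T.
Proof. by case: i => k /=; [case: (vS (ltn_ord k))|case: (vg (ltn_ord k))]. Qed.

Let ae i l : adm (ta i) (e i l).
Proof.
case: i => k /=; first exact: simple_valid_adm.
refine (adm_eq (admM (@adm_cst _ _ _ P _ B _ (-1)) (simple_valid_adm l vg (ltn_ord k))) _).
by move=> w; rewrite mulN1r.
Qed.

Let e2 i l : (\int[P]_w (e i l w ^+ 2)%:E < +oo)%E.
Proof.
case: i => k /=; first exact: simple_coef_square_finite.
by under eq_integral do rewrite sqrrN; exact: simple_coef_square_finite.
Qed.

Let diffE s w : dotp (simple_value S s w - simple_value g s w)
    (simple_value S s w - simple_value g s w) =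
  \sum_l (\sum_i e i l w * (ta i < s <= tb i)%R%:R) ^+ 2.
Proof.
apply: eq_bigr => l _; rewrite big_sumType /= expr2 !mxE !simple_valueE.
by rewrite -!sumrN; congr (_ * _); congr (_ + _); apply: eq_bigr => k _; rewrite mulNr.
Qed.

Lemma simple_integral_dist t : 0 <= t <= T ->
  (\int[P]_w ((simple_integral B S t w - simple_integral B g t w) ^+ 2)%:E <=
   \int[P]_w \int[leb]_(s in `[0%R, T])
     (let r := simple_value S s w - simple_value g s w in dotp r r)%:E)%E.
Proof.
move=> /andP[t0 tT].
pose a i := Num.min (ta i) t; pose b i := Num.min (tb i) t.
(* When [ta i > t] the coefficient need not be known at the stopped time [min (ta i) t = t]. Its
   stopped interval is then empty, so it may be replaced by 0, which restores adaptedness. *)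
pose c i l w := (ta i <= t)%R%:R * e i l w.
have a0 i : 0 <= a i by rewrite le_min ta0.
have ab i : a i <= b i by rewrite le_min2.
have bT i : b i <= T by rewrite ge_min tT orbT.
have ac i l : adm (a i) (c i l).
  rewrite /a /c; case: (leP (ta i) t) => tat.
    by refine (adm_eq (@ae i l) _) => w; rewrite mul1r.
  by refine (adm_eq (@adm_cst _ _ _ P _ B _ 0) _) => w; rewrite mul0r.
have c2 i l : (\int[P]_w (c i l w ^+ 2)%:E < +oo)%E.
  rewrite /c; case: (leP (ta i) t) => tat.
    by under eq_integral do rewrite mul1r; exact: e2.
  by under eq_integral do rewrite mul0r expr0n; rewrite integral0 ltry.
have -> : (\int[P]_w ((simple_integral B S t w - simple_integral B g t w) ^+ 2)%:E =
    \int[P]_w ((\sum_i \sum_l c i l w * incr (a i) (b i) l w) ^+ 2)%:E)%E.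
  apply: eq_integral => w _; congr (_ ^+ 2)%:E.
  rewrite !simple_integralE big_sumType /= -sumrN; congr (_ + _).
    apply: eq_bigr => k _; apply: eq_bigr => l _.
    rewrite /c /a /b /=; case: (leP (sp_time S k) t) => [tat|/ltW tat].
      by rewrite mul1r.
    have [_ SS _ _ _] := vS (ltn_ord k).
    by rewrite (min_idPr (le_trans tat SS)) !incrxx !mulr0.
  apply: eq_bigr => k _; rewrite -sumrN; apply: eq_bigr => l _.
  rewrite /c /a /b /=; case: (leP (sp_time g k) t) => [tat|/ltW tat].
    by rewrite mul1r mulNr.
  have [_ SS _ _ _] := vg (ltn_ord k).
  by rewrite (min_idPr (le_trans tat SS)) !incrxx !mulr0 oppr0.
rewrite (ito_isometry Pcomplete BM a0 ab bT ac c2).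
under [leRHS]eq_integral.
  move=> w _; under eq_integral do rewrite /= diffE.
  rewrite (integral_step_energy (fun i l => e i l w) ta0 tbT).
  over.
apply: ge0_le_integral => //.
- move=> w _; rewrite -(integral_step_energy (fun i l => c i l w) a0 bT).
  by apply: integral_ge0 => s _; rewrite lee_fin; apply: sumr_ge0 => l _; exact: sqr_ge0.
- by apply/measurable_EFinP; exact: (measurable_energy Pcomplete BM).
- by apply/measurable_EFinP; exact: (measurable_energy Pcomplete BM).
move=> w _; rewrite -(integral_step_energy (fun i l => c i l w) a0 bT).
rewrite -(integral_step_energy (fun i l => e i l w) ta0 tbT).
apply: ge0_le_integral => //.
- by move=> s _; rewrite lee_fin; apply: sumr_ge0 => l _; exact: sqr_ge0.
- apply/measurable_EFinP; apply: measurable_sum => l; apply: measurable_funX.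
  by apply: measurable_sum => i; apply: measurable_funM => //; exact: measurable_step.
- apply/measurable_EFinP; apply: measurable_sum => l; apply: measurable_funX.
  by apply: measurable_sum => i; apply: measurable_funM => //; exact: measurable_step.
move=> s _; rewrite lee_fin; apply: ler_sum => l _.
(* Stopping the intervals at [t] multiplies the integrand by the indicator of [s <= t], which can
   only decrease the energy. *)
have -> : \sum_i c i l w * (a i < s <= b i)%R%:R =
    (s <= t)%R%:R * \sum_i e i l w * (ta i < s <= tb i)%R%:R.
  rewrite mulr_sumr; apply: eq_bigr => i _; rewrite /c /a /b gt_min le_min.
  have := tab i; have [tat|tat] := leP (ta i) t; have [st|st] := leP s t => tb_;
    rewrite ?mul1r ?mul0r ?andbF ?andbT ?mulr0 ?orbF//.
  by rewrite (ltNge (ta i)) (le_trans st (ltW tat)) mulr0.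
rewrite exprMn; case: (s <= t); rewrite ?expr1n ?mul1r// expr0n mul0r.
exact: sqr_ge0.
Qed.

End distance.

Lemma dotpD_le (u v : 'rV[R]_d) : dotp (u + v) (u + v) <= 2 * dotp u u + 2 * dotp v v.
Proof.
rewrite /dotp !mulr_sumr -big_split; apply: ler_sum => k _ /=; rewrite !mxE.
by have := sqr_ge0 (u 0 k - v 0 k); nra.
Qed.

Lemma measurable_simple_value S l : simple_valid P T F S ->
  measurable_fun setT (fun z : measurableTypeR R * Omega => simple_value S z.1 z.2 0 l).
Proof.
move=> vS; rewrite (_ : (fun z => _) = fun z : measurableTypeR R * Omega =>
    \sum_(k < sp_size S) sp_coef S k z.2 0 l *
    (sp_time S k < z.1 <= sp_time S k.+1)%R%:R); last first.
  by apply/funext => z; exact: simple_valueE.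
apply: measurable_sum => k; apply: measurable_funM.
  by apply: (measurableT_comp (measurable_simple_coef l vS (ltn_ord k))).
exact: (measurableT_comp (@measurable_step R setT (sp_time S k) (sp_time S k.+1))
  (@measurable_fst _ _ (measurableTypeR R) Omega)).
Qed.

(** An approximating sequence of [Y] serves as intermediary, since two simple integrals are no
    further apart than their integrands. Two uses of [(x + y)^2 <= 2 x^2 + 2 y^2] give the constant
    4; the tolerance [e / 6] is spent with total weight [2 + 4]. *)
Lemma ito_integral_dist (h : R -> 'rV[R]_d) (Y : R -> Omega -> R) g (c : R -> 'rV[R]_d) t :
  is_ito_integral P T B (fun t _ => h t) Y ->
  simple_valid P T F g -> (forall s w, simple_value g s w = c s) ->
  0 <= t <= T ->
  (\int[P]_w ((Y t w - simple_integral B g t w) ^+ 2)%:E <=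
   4%:E * \int[leb]_(s in `[0%R, T]) (let r := h s - c s in dotp r r)%:E)%E.
Proof.
move=> [[mh _ _] mY _ [S [vS SX SI]]] vg gc t0T.
have mD : measurable (`[0, T] : set (measurableTypeR R)) by exact: measurable_itv.
set A := (\int[leb]_(s in `[0%R, T]) _)%E.
have mS S' l : simple_valid P T F S' -> measurable_fun (`[0, T] `*` setT)
    (fun z : measurableTypeR R * Omega => simple_value S' z.1 z.2 0 l).
  by move=> vS'; apply: measurable_funTS; exact: measurable_simple_value.
have mSh n : measurable_fun (`[0, T] `*` setT) (fun z : measurableTypeR R * Omega =>
    dotp (simple_value (S n) z.1 z.2 - h z.1) (simple_value (S n) z.1 z.2 - h z.1)).
  by apply: measurable_dotpB => l; [exact: mS|exact: mh].
have mSg n : measurable_fun (`[0, T] `*` setT) (fun z : measurableTypeR R * Omega =>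
    dotp (simple_value (S n) z.1 z.2 - simple_value g z.1 z.2)
      (simple_value (S n) z.1 z.2 - simple_value g z.1 z.2)).
  by apply: measurable_dotpB => l; exact: mS.
have mhc : measurable_fun (`[0, T] `*` setT) (fun z : measurableTypeR R * Omega =>
    dotp (h z.1 - c z.1) (h z.1 - c z.1)).
  apply: measurable_dotpB => l; first exact: mh.
  by have := mS g l vg; apply: eq_measurable_fun => z _; rewrite gc.
apply/lee_addgt0Pr => e e0.
have e6 : 0 < e / 6 by rewrite divr_gt0.
have [N1 H1] := cvge0_le SX e6.
have [N2 H2] := cvge0_le (SI t t0T) e6.
pose n := maxn N1 N2.
have {}H1 := H1 n (leq_maxl _ _); have {}H2 := H2 n (leq_maxr _ _).
have mYt := mY t t0T; have mSt := measurable_simple_integral t0T (vS n).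
have mgt := measurable_simple_integral t0T vg.
have sq (X Z : Omega -> R) : measurable_fun setT X -> measurable_fun setT Z ->
    measurable_fun setT (fun w : Omega => ((X w - Z w) ^+ 2)%:E : \bar R).
  by move=> mX mZ; apply/measurable_EFinP; apply: measurable_funX; exact: measurable_funB.
have D1 : (\int[P]_w ((Y t w - simple_integral B g t w) ^+ 2)%:E <=
    2%:E * \int[P]_w ((simple_integral B (S n) t w - Y t w) ^+ 2)%:E +
    2%:E * \int[P]_w ((simple_integral B (S n) t w - simple_integral B g t w) ^+ 2)%:E)%E.
  apply: integral_le_lin2 => //; try exact: sq;
    try by move=> w; rewrite lee_fin sqr_ge0.
  move=> w _; rewrite -!EFinM -EFinD lee_fin.
  move: (Y t w) (simple_integral B g t w) (simple_integral B (S n) t w) => y i s.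
  by have := sqr_ge0 ((s - y) + (s - i)); nra.
have D2 := simple_integral_dist (vS n) vg t0T.
have D3 : (\int[P]_w \int[leb]_(s in `[0%R, T])
     (let r := simple_value (S n) s w - simple_value g s w in dotp r r)%:E <=
   2%:E * \int[P]_w \int[leb]_(s in `[0%R, T])
     (let r := (simple_value (S n) s w - h s)%R in dotp r r)%:E +
   2%:E * \int[P]_w A)%E.
  apply: integral_le_lin2 => //.
  - exact: (measurable_section_integral mD (mSg n) (fun=> dotp_ge0 _)).
  - exact: (measurable_section_integral mD (mSh n) (fun=> dotp_ge0 _)).
  - by move=> w; apply: integral_ge0 => s _; rewrite lee_fin dotp_ge0.
  - by move=> w; apply: integral_ge0 => s _; rewrite lee_fin dotp_ge0.
  - by move=> w; apply: integral_ge0 => s _; rewrite lee_fin dotp_ge0.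
  move=> w _; apply: integral_le_lin2 => //.
  - by apply/measurable_EFinP; exact: (measurable_section w mD (mSg n)).
  - by apply/measurable_EFinP; exact: (measurable_section w mD (mSh n)).
  - by apply/measurable_EFinP; exact: (measurable_section w mD mhc).
  - by move=> s; rewrite lee_fin dotp_ge0.
  - by move=> s; rewrite lee_fin dotp_ge0.
  - by move=> s; rewrite lee_fin dotp_ge0.
  move=> s _; rewrite -!EFinM -EFinD lee_fin gc.
  rewrite (_ : simple_value (S n) s w - c s = (simple_value (S n) s w - h s) + (h s - c s)).
    exact: dotpD_le.
  by rewrite addrA subrK.
have A0 : (0 <= A)%E by apply: integral_ge0 => s _; rewrite lee_fin dotp_ge0.
rewrite integral_cst//= probability_setT mule1 in D3.
apply: (le_trans D1); apply: (@le_trans _ _ (2%:E * (e / 6)%:E +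
    2%:E * (2%:E * (e / 6)%:E + 2%:E * A))%E).
  apply: leeD; first exact: lee_wpmul2l.
  apply: lee_wpmul2l => //; apply: (le_trans D2); apply: (le_trans D3).
  by apply: leeD => //; exact: lee_wpmul2l.
rewrite muleDr// ?ge0_adde_def ?inE ?mule_ge0// ?lee_fin ?(ltW e6)//.
rewrite !muleA -!EFinM addeA -EFinD addeC.
by apply: leeD; [rewrite -natrM|rewrite lee_fin; lra].
Qed.

End simple_processes.

(** * Exponential and even moments of weighted sums of increments *)

Section gaussian_sums.
Context {R : realType} {disp : measure_display} {Omega : measurableType disp}.
Variables (P : probability Omega R) (d : nat) (T : R) (B : R -> Omega -> 'rV[R]_d).
Hypothesis Pcomplete : measure_is_complete P.
Hypothesis BM : standard_brownian_motion P T B.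

Notation adm := (adm P B).
Notation incr := (incr B).

Lemma incr_mgf a b l c : 0 <= a -> a <= b -> b <= T ->
  (\int[P]_w (expR (c * incr a b l w))%:E = (expR (c ^+ 2 * (b - a) / 2))%:E)%E.
Proof.
move=> a0 + bT; rewrite le_eqVlt => /predU1P[<-|ab].
  under eq_integral do rewrite incrxx mulr0 expR0.
  by rewrite subrr mulr0 mul0r expR0 integral_cst//= probability_setT mule1.
rewrite (ge0_integral_incr BM l (g := fun x => (expR (c * x))%:E) a0 ab bT).
- by rewrite normal_mgf ?sqrtr_gt0 ?subr_gt0// sqr_sqrtr// subr_ge0 ltW.
- apply/measurable_EFinP; apply: measurableT_comp => //; exact: measurable_funM.
- by move=> x; rewrite lee_fin expR_ge0.
Qed.

(** The last increment is independent of the preceding sum, which is known at its starting time, so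
    the expectation factorizes. *)
Lemma gauss_sum_mgf (s c : nat -> R) l q :
  (forall k, 0 <= s k) -> (forall k, s k <= s k.+1) -> (forall k, s k <= T) ->
  (\int[P]_w (expR (\sum_(k < q) c k * incr (s k) (s k.+1) l w))%:E =
   (expR ((\sum_(k < q) c k ^+ 2 * (s k.+1 - s k)) / 2))%:E)%E.
Proof.
move=> s0 ss sT; elim: q => [|q IHq].
  under eq_integral do rewrite big_ord0 expR0.
  by rewrite big_ord0 mul0r expR0 integral_cst//= probability_setT mule1.
under eq_integral do rewrite big_ord_recr /= expRD EFinM.
rewrite big_ord_recr /= mulrDl expRD EFinM -IHq.
rewrite -(incr_mgf l (c q) (s0 q) (ss q) (sT q.+1)).
have smono : {homo s : i j / (i <= j)%N >-> i <= j}.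
  by apply: homo_leq => //; exact: le_trans.
have [sq|sq] := eqVneq (s q) (s q.+1).
  under eq_integral do rewrite -sq incrxx mulr0 expR0 mule1.
  rewrite -sq; under [X in (_ = _ * X)%E]eq_integral do rewrite incrxx mulr0 expR0.
  by rewrite integral_cst//= probability_setT !mule1.
have {}sq : s q < s q.+1 by rewrite lt_neqAle sq ss.
have aZ : adm (s q) (fun w => \sum_(k < q) c k * incr (s k) (s k.+1) l w).
  apply: adm_sum => k; apply: admM; first exact: adm_cst.
  by apply: adm_incr => //; apply: smono.
have sqT : 0 <= s q <= T by rewrite s0 sT.
have sqT' : 0 <= s q.+1 <= T by rewrite s0 sT.
have ii := indep_incr Pcomplete BM l (s0 q) sq (sT q.+1) aZ.
apply: (ge0_indepM (adm_measurable Pcomplete BM sqT aZ) (measurable_incr BM l sqT sqT') ii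
  (f := fun x : R => (expR x)%:E) (g := fun x : R => (expR (c q * x))%:E)).
- by apply/measurable_EFinP; exact: measurable_expR.
- by apply/measurable_EFinP; apply: measurableT_comp => //; exact: measurable_funM.
- by move=> x; rewrite lee_fin expR_ge0.
- by move=> x; rewrite lee_fin expR_ge0.
Qed.

(** The bound involves the variance bound [K] but not the number [q] of summands; this is the source
    of the moment estimates uniform in the mesh. *)
Lemma gauss_sum_moment (s c : nat -> R) l q K p :
  (forall k, 0 <= s k) -> (forall k, s k <= s k.+1) -> (forall k, s k <= T) ->
  \sum_(k < q) c k ^+ 2 * (s k.+1 - s k) <= K ->
  (\int[P]_w (((\sum_(k < q) c k * incr (s k) (s k.+1) l w) ^+ 2) ^+ p)%:E <=
   ((2 * p)`!%:R * (expR (K / 2) * 2))%:E)%E.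
Proof.
move=> s0 ss sT cK.
have sT' k : 0 <= s k <= T by rewrite s0 sT.
pose Z (c : nat -> R) w := \sum_(k < q) c k * incr (s k) (s k.+1) l w.
have mZ c' : measurable_fun setT (Z c').
  by apply: measurable_sum => k; apply: measurable_funM => //; exact: (measurable_incr BM).
have mexp c' : measurable_fun setT (fun w => expR (Z c' w)).
  exact: measurableT_comp.
have mgf (c' : nat -> R) : \sum_(k < q) c' k ^+ 2 * (s k.+1 - s k) <= K ->
    (\int[P]_w (expR (Z c' w))%:E <= (expR (K / 2))%:E)%E.
  by move=> c'K; rewrite gauss_sum_mgf// lee_fin ler_expR ler_pM2r.
have ZN w : Z (fun k => - c k) w = - Z c w.
  by rewrite /Z -sumrN; apply: eq_bigr => k _; rewrite mulNr.
have f0 : 0 <= (2 * p)`!%:R :> R by [].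
have -> : (2 * p)`!%:R * (expR (K / 2) * 2) =
    (2 * p)`!%:R * expR (K / 2) + (2 * p)`!%:R * expR (K / 2) by ring.
have h := moment_lin (mexp c) (mexp (fun k => - c k)) _ _ f0 f0 (mgf c cK) (mgf (fun k => - c k) _).
apply: le_moment (h _ _ _).
- by do 2 apply: measurable_funX; exact: mZ.
- by apply: measurable_funD; exact: measurable_funM.
- by move=> w; exact: sqr_pow_ge0.
- by move=> w; rewrite -mulrDr ZN expR_ge_sqr_pow.
- by move=> w; exact: expR_ge0.
- by move=> w; exact: expR_ge0.
- by under eq_bigr do rewrite sqrrN.
Qed.

(** When [s = t], which happens for grid cells beyond the current time, the quotient is 0 and
    [incr_normalized] still holds. *)
Definition normalized_incr (s t : R) l w := incr s t l w / Num.sqrt (t - s).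

Lemma incr_normalized s t l w : s <= t ->
  incr s t l w = Num.sqrt (t - s) * normalized_incr s t l w.
Proof.
rewrite /normalized_incr le_eqVlt => /predU1P[<-|st]; first by rewrite incrxx mul0r mulr0.
by rewrite mulrCA divff ?mulr1// gt_eqF// sqrtr_gt0 subr_gt0.
Qed.

Lemma normalized_incr_bounded (J : Type) (s t : J -> R) l :
  (forall j, 0 <= s j) -> (forall j, s j <= t j) -> (forall j, t j <= T) ->
  bounded_moments P (fun j => normalized_incr (s j) (t j) l).
Proof.
move=> s0 st tT; split=> [j|p].
  apply: measurable_funM => //; apply: (measurable_incr BM).
    by rewrite s0 (le_trans (st j)).
  by rewrite tT (le_trans (s0 j)).
exists ((2 * p)`!%:R * (expR (1 / 2) * 2)) => j.
pose s' k := if k is 0 then s j else t j.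
pose c (k : nat) := (Num.sqrt (t j - s j))^-1.
have := @gauss_sum_moment s' c l 1 1 p.
under eq_integral do rewrite big_ord1 /= mulrC.
apply.
- by case=> [|k] //=; rewrite (le_trans (s0 j)).
- by case=> [|k] /=.
- by case=> [|k] //=; rewrite (le_trans (st j)).
rewrite big_ord1 /= exprVn sqr_sqrtr ?subr_ge0//.
have [->|ts] := eqVneq (t j) (s j); first by rewrite subrr mulr0.
by rewrite mulVf// subr_eq0.
Qed.

End gaussian_sums.

(** * Approximation by deterministic step functions *)

Section grid.
Context {R : realType}.
Variable T : R.
Hypothesis T0 : 0 < T.
Notation leb := (@lebesgue_measure R).

Definition grid (n k : nat) : R := T * k%:R / n%:R.

Lemma grid0 n : grid n 0 = 0. Proof. by rewrite /grid mulr0 mul0r. Qed.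

Lemma gridn n : (0 < n)%N -> grid n n = T.
Proof. by move=> n0; rewrite /grid mulfK// pnatr_eq0 -lt0n. Qed.

Lemma grid_le n i j : (i <= j)%N -> grid n i <= grid n j.
Proof.
move=> ij; rewrite /grid ler_wpM2r ?invr_ge0// ler_wpM2l ?(ltW T0)//.
by rewrite ler_nat.
Qed.

Lemma grid_ge0 n k : 0 <= grid n k.
Proof. by rewrite -(grid0 n) grid_le. Qed.

Lemma grid_leT n k : (0 < n)%N -> (k <= n)%N -> grid n k <= T.
Proof. by move=> n0 kn; rewrite -[leRHS](gridn n0) grid_le. Qed.

Lemma grid_step n k : grid n k.+1 - grid n k = T / n%:R.
Proof. by rewrite /grid -mulrBl -mulrBr -natrB// subSnn mulr1. Qed.

(** The cells are open on the left, so each [s > 0] lies in exactly one of them and a sum weighted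
    by their indicators collapses. The module [V] is arbitrary because both real and vector valued
    sums occur. *)
Lemma grid_cell n s : (0 < n)%N -> 0 < s -> s <= T ->
  exists k : nat, [/\ (k < n)%N, grid n k < s <= grid n k.+1 &
    forall (V : lmodType R) (f : nat -> V),
      \sum_(j < n) (grid n j < s <= grid n j.+1)%R%:R *: f j = f k].
Proof.
move=> n0 s0 sT.
have ex : exists k, s <= grid n k.+1 by exists n.-1; rewrite prednK// gridn.
pose k := ex_minn ex.
have [sk kmin] : s <= grid n k.+1 /\ forall j, s <= grid n j.+1 -> (k <= j)%N.
  by rewrite /k; case: ex_minnP.
have kn : (k < n)%N.
  by rewrite -[n]prednK// ltnS kmin// prednK// gridn.
have ks : grid n k < s.
  case: k kmin {sk kn} => [|k] kmin; first by rewrite grid0.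
  by rewrite ltNge; apply/negP => /kmin; rewrite ltnn.
exists k; split=> //; first by rewrite ks.
move=> V f; rewrite (bigD1 (Ordinal kn))//= ks sk scale1r big1 ?addr0// => j jk.
case: (ltnP j k) => h.
  rewrite (_ : _ < _ <= _ = false) ?scale0r//; apply/negbTE/nandP; right.
  rewrite -ltNge; apply: le_lt_trans ks; exact: grid_le.
rewrite (_ : _ < _ <= _ = false) ?scale0r//; apply/negbTE/nandP; left.
rewrite -leNgt; apply: (le_trans sk); apply: grid_le.
by rewrite ltn_neqAle h andbT eq_sym.
Qed.

Lemma integral_step_itv (a b : R) : a <= b ->
  (\int[leb]_(s in `[0%R, T]) ((a < s <= b)%R%:R)%:E <= (b - a)%:E)%E.
Proof.
move=> ab.
have E : (fun s : measurableTypeR R => (a < s <= b)%R%:R : R) =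
    \1_(`]a, b] : set (measurableTypeR R)).
  by apply/funext => s; rewrite indicE mem_setE in_itv.
under eq_integral => s _ do rewrite (congr1 (fun f => f s) E).
rewrite integral_indic//=.
apply: (@le_trans _ _ (leb `]a, b])).
  by apply: le_measure; rewrite ?inE//; exact: measurableI.
rewrite lebesgue_measure_itv/= lte_fin.
by case: ltP => // ba; rewrite lee_fin subr_ge0.
Qed.

(** Moving the argument to the right by at most [de] changes the indicator only if an endpoint is
    crossed, that is, only if [s] lies within [de] to the left of [a] or [b]. *)
Lemma step_sample (a b s r de : R) : s <= r -> r <= s + de ->
  ((a < s <= b)%R%:R - (a < r <= b)%R%:R) ^+ 2 <=
  (a - de < s <= a)%R%:R + (b - de < s <= b)%R%:R :> R.
Proof.
move=> sr rs.
have h0 (x y : bool) : 0 <= (x%:R + y%:R : R) by rewrite addr_ge0.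
have h1 (x : bool) : 1 <= (1 + x%:R : R) by rewrite lerDl.
have h2 (x : bool) : 1 <= (x%:R + 1 : R) by rewrite lerDr.
case: (ltP a s) => as_; case: (leP s b) => sb; case: (ltP a r) => ar; case: (leP r b) => rb;
  rewrite /= ?subrr ?expr0n ?subr0 ?sub0r ?sqrrN ?expr1n ?h0//; try lra.
- by rewrite (_ : b - de < s = true) ?andbT ?h2//; apply/idP; lra.
- by rewrite (_ : a - de < s = true) ?h1//; apply/idP; lra.
Qed.

End grid.

(** Cauchy-Schwarz with weights, termwise from [2 x_i x_j <= x_i^2 + x_j^2] once both sides are
    double sums. *)
Lemma weighted_sqr_sum_le {R : realType} I (s : seq I) (a x : I -> R) :
  (forall i, 0 <= a i) ->
  (\sum_(i <- s) a i * x i) ^+ 2 <= (\sum_(i <- s) a i) * \sum_(i <- s) a i * x i ^+ 2.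
Proof.
move=> a0; rewrite expr2 big_distrlr /=.
set A := \sum_(i <- s) a i; set S := \sum_(i <- s) a i * x i ^+ 2.
have inner i : \sum_(j <- s) a i * a j * (x i ^+ 2 + x j ^+ 2) / 2 =
    (a i * x i ^+ 2 * A + a i * S) / 2.
  rewrite -mulr_suml /A /S !mulr_sumr -big_split /=; congr (_ / 2).
  by apply: eq_bigr => j _; ring.
have -> : A * S = \sum_(i <- s) \sum_(j <- s) a i * a j * (x i ^+ 2 + x j ^+ 2) / 2.
  under eq_bigr do rewrite inner.
  by rewrite -mulr_suml big_split /= -!mulr_suml -/A -/S; field.
apply: ler_sum => i _; apply: ler_sum => j _.
have := sqr_ge0 (x i - x j); have := mulr_ge0 (a0 i) (a0 j); nra.
Qed.

Lemma sqr_sum_fin_le {R : realType} (I : finType) (x : I -> R) :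
  (\sum_i x i) ^+ 2 <= #|I|%:R * \sum_i x i ^+ 2.
Proof.
have := @weighted_sqr_sum_le R I (index_enum I) (fun=> 1) x (fun=> ler01).
rewrite sumr_const.
by under eq_bigr do rewrite mul1r; under [X in _ * X]eq_bigr do rewrite mul1r.
Qed.

Section approximation.
Context {R : realType} {disp : measure_display} {Omega : measurableType disp}.
Variables (P : probability Omega R) (d : nat) (T : R) (B : R -> Omega -> 'rV[R]_d).
Hypothesis Pcomplete : measure_is_complete P.
Hypothesis BM : standard_brownian_motion P T B.
Hypothesis T0 : 0 < T.

Notation F := (augmented_filtration P B).
Notation adm := (adm P B).
Notation leb := (@lebesgue_measure R).
Notation grid := (grid T).

Definition det_process (n : nat) (g : nat -> 'rV[R]_d) : simple_process R d Omega :=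
  SimpleProcess n (grid n) (fun k _ => g k).

Definition step (n : nat) (g : nat -> 'rV[R]_d) (s : R) : 'rV[R]_d :=
  \sum_(k < n) (grid n k < s <= grid n k.+1)%R%:R *: g k.

Lemma det_process_valid n g : (0 < n)%N -> simple_valid P T F (det_process n g).
Proof.
move=> n0 k kn; split.
- exact: grid_ge0.
- exact: grid_le.
- exact: grid_leT.
- by move=> l U mU; exact: (@adm_cst _ _ _ P _ B _ (g k 0 l)).
- rewrite (@integral_cst _ _ _ P _ measurableT (dotp (g k) (g k))%:E).
  by rewrite /= probability_setT mule1 ltry.
Qed.

Lemma measurable_row_step n g l (D : set (measurableTypeR R)) :
  measurable_fun D (fun s : measurableTypeR R => step n g s 0 l).
Proof.
rewrite (_ : (fun s => _) = fun s : measurableTypeR R =>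
    \sum_(k < n) g k 0 l * (grid n k < s <= grid n k.+1)%R%:R).
  by apply: measurable_sum => k; apply: measurable_funM => //; exact: measurable_step.
by apply/funext => s; rewrite summxE; apply: eq_bigr => k _; rewrite mxE mulrC.
Qed.

(* Averaging over [w], some path of a simple process that is [L^2]-close to [h]
   is itself close to [h]; being a step function, it is changed little when it is
   sampled on a fine enough uniform grid. *)
Lemma det_approx (h : R -> 'rV[R]_d) (Y : R -> Omega -> R) (e : R) :
  is_ito_integral P T B (fun t _ => h t) Y -> 0 < e ->
  exists N, forall n, (N <= n)%N -> (0 < n)%N -> exists2 g : nat -> 'rV[R]_d,
    (\int[leb]_(s in `[0%R, T]) (let r := h s - step n g s in dotp r r)%:E <= e%:E)%E &
    forall k, dotp (g k) (g k) * (T / n%:R) <= e.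
Proof.
move=> [[mh _ _] _ _ [S [vS SX _]]] e0.
have mD : measurable (`[0, T] : set (measurableTypeR R)) by exact: measurable_itv.
have e8 : 0 < e / 8 by rewrite divr_gt0.
have [n0 /(_ n0 (leqnn _)) {}SX] := cvge0_le SX e8.
move: (S n0) (vS n0) SX => {}S {}vS {n0}SX.
have mSh : measurable_fun (`[0, T] `*` setT) (fun z : measurableTypeR R * Omega =>
    dotp (simple_value S z.1 z.2 - h z.1) (simple_value S z.1 z.2 - h z.1)).
  apply: measurable_dotpB => l; last exact: mh.
  by apply: measurable_funTS; exact: (measurable_simple_value Pcomplete BM).
have [w Hw] : exists w, (\int[leb]_(s in `[0%R, T])
    (let r := (simple_value S s w - h s)%R in dotp r r)%:E <= (e / 4)%:E)%E.
  apply: contrapT => /forallNP H.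
  have : ((e / 4)%:E <= (e / 8)%:E :> \bar R)%E; last by rewrite lee_fin; lra.
  apply: le_trans SX.
  rewrite -[leLHS]mule1 -(probability_setT P) -(integral_cst P)//.
  apply: ge0_le_integral => //.
  - by move=> w _; rewrite lee_fin ltW// divr_gt0.
  - exact: (measurable_section_integral mD mSh (fun=> dotp_ge0 _)).
  - by move=> w _; have /negP := H w; rewrite -ltNge => /ltW.
pose q := sp_size S.
pose c (j : 'I_q) l := sp_coef S j w 0 l.
pose a (j : 'I_q) := sp_time S j; pose b (j : 'I_q) := sp_time S j.+1.
pose ga s := simple_value S s w.
have gaE s l : ga s 0 l = \sum_j c j l * (a j < s <= b j)%R%:R.
  exact: simple_valueE.
have mga l : measurable_fun `[0, T] (fun s : measurableTypeR R => ga s 0 l).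
  have m : measurable_fun (setT `*` setT)
      (fun z : measurableTypeR R * Omega => simple_value S z.1 z.2 0 l).
    by rewrite setXTT; exact: (measurable_simple_value Pcomplete BM).
  by apply: measurable_funTS; exact: (measurable_section w measurableT m).
(* Cauchy-Schwarz over the [q] steps gives the factor [q]; each step has two endpoints near which
   sampling can fail, whence the factor 2. The same [K] bounds the squared norm of the path at every
   time, which yields the second claim. *)
pose K := \sum_l \sum_j q%:R * c j l ^+ 2 * 2.
have Kjl l j : 0 <= q%:R * c j l ^+ 2 by rewrite mulr_ge0// sqr_ge0.
have K0 : 0 <= K.
  by apply: sumr_ge0 => l _; apply: sumr_ge0 => j _; rewrite mulr_ge0.
have e4 : 0 < e / 4 by rewrite divr_gt0.
have [N HN] : exists N : nat, forall n, (N <= n)%N -> (0 < n)%N -> K * (T / n%:R) <= e / 4.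
  exists (Num.truncn (K * T / (e / 4))).+1 => n Nn n_gt0.
  rewrite mulrA ler_pdivrMr ?ltr0n// [leRHS]mulrC -ler_pdivrMr//; apply: ltW.
  by apply: lt_le_trans (truncnS_gt _) _; rewrite ler_nat.
(* The path is fixed, so sampling at the right endpoint raises no question of adaptedness, and it
   moves the argument to the right as [step_sample] requires. *)
exists N => n Nn n_gt0; exists (fun k => ga (grid n k.+1)).
  have cell s : 0 <= s <= T -> dotp (ga s - step n (fun k => ga (grid n k.+1)) s)
      (ga s - step n (fun k => ga (grid n k.+1)) s) <=
      \sum_l \sum_j q%:R * c j l ^+ 2 *
        ((a j - T / n%:R < s <= a j)%R%:R + (b j - T / n%:R < s <= b j)%R%:R).
    move=> /andP[]; rewrite le_eqVlt => /predU1P[<-|s0] sT.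
      rewrite (_ : dotp _ _ = 0).
        apply: sumr_ge0 => l _; apply: sumr_ge0 => j _.
        by rewrite mulr_ge0// addr_ge0.
      apply: big1 => l _; rewrite !mxE gaE big1 => [|j _].
        rewrite summxE big1 ?subr0 ?mul0r// => k _.
        by rewrite mxE ltNge grid_ge0// mul0r.
      have [aj0 _ _ _ _] := vS _ (ltn_ord j).
      by rewrite ltNge aj0/= mulr0.
    have [k [kn /andP[ks sk] kE]] := grid_cell T0 n_gt0 s0 sT.
    rewrite /step (kE _ (fun k => ga (grid n k.+1))).
    apply: ler_sum => l _; rewrite !mxE -expr2 !gaE.
    rewrite -sumrB; apply: le_trans (sqr_sum_fin_le _) _.
    rewrite card_ord mulr_sumr; apply: ler_sum => j _.
    rewrite -mulrBr exprMn mulrA ler_wpM2l// step_sample//.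
    by rewrite -(grid_step T n k) addrC -addrA lerDl; lra.
  have step4 : (\int[leb]_(s in `[0%R, T])
     (let r := (ga s - step n (fun k => ga (grid n k.+1)) s)%R in dotp r r)%:E <= (e / 4)%:E)%E.
    have mg l : measurable_fun `[0, T]
        (fun s : measurableTypeR R => step n (fun k => ga (grid n k.+1)) s 0 l).
      exact: measurable_row_step.
    have mcell : measurable_fun `[0, T] (fun s : measurableTypeR R =>
        dotp (ga s - step n (fun k => ga (grid n k.+1)) s)
          (ga s - step n (fun k => ga (grid n k.+1)) s)).
      exact: measurable_dotpB.
    have de0 : 0 <= T / n%:R by rewrite divr_ge0// ltW.
    have hind u : has_integral leb `[0, T]
        (fun s => (u - T / n%:R < s <= u)%R%:R : R)
        (fine (\int[leb]_(s in `[0%R, T]) ((u - T / n%:R < s <= u)%R%:R)%:E)%E).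
      apply: has_integral_integrable => //; apply/integrableP; split.
        by apply/measurable_EFinP; exact: measurable_step.
      under eq_integral do rewrite /= normr_nat.
      apply: le_lt_trans (integral_step_itv T _) (ltry _).
      by rewrite gerBl.
    have vind u : fine (\int[leb]_(s in `[0%R, T]) ((u - T / n%:R < s <= u)%R%:R)%:E)%E
        <= T / n%:R.
      rewrite -lee_fin -(proj2 (hind u)); apply: le_trans (integral_step_itv T _) _.
        by rewrite gerBl.
      by rewrite opprB addrCA subrr addr0.
    have hsum := has_integral_sum mD (index_enum 'I_d) (fun l =>
      has_integral_sum mD (index_enum 'I_q) (fun j =>
      has_integralZ mD (q%:R * c j l ^+ 2) (has_integralD mD (hind (a j)) (hind (b j))))).
    apply: (@le_trans _ _ (K * (T / n%:R))%:E); last by rewrite lee_fin HN.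
    apply: (@le_trans _ _ (\int[leb]_(s in `[0%R, T]) (\sum_l \sum_j q%:R * c j l ^+ 2 *
        ((a j - T / n%:R < s <= a j)%R%:R + (b j - T / n%:R < s <= b j)%R%:R))%:E)%E).
      apply: ge0_le_integral => //.
      - by move=> s _; rewrite lee_fin dotp_ge0.
      - exact/measurable_EFinP.
      - exact: (measurable_int leb (proj1 hsum)).
    rewrite (proj2 hsum) lee_fin /K mulr_suml; apply: ler_sum => l _.
    rewrite [leRHS]mulr_suml; apply: ler_sum => j _; rewrite -[leRHS]mulrA ler_wpM2l//.
    by rewrite mulr2n mulrDl mul1r lerD.
  apply: (@le_trans _ _ (2%:E * (e / 4)%:E + 2%:E * (e / 4)%:E)%E); last first.
    by rewrite -!EFinM -EFinD lee_fin; lra.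
  apply: le_trans (_ : _ <= 2%:E * _ + 2%:E * _)%E (leeD (lee_wpmul2l _ Hw) (lee_wpmul2l _ step4)) => //.
  have mh0 l : measurable_fun `[0, T] (fun s : measurableTypeR R => h s 0 l).
    exact: (measurable_section w mD (mh l)).
  apply: integral_le_lin2 => //.
  - by apply/measurable_EFinP; apply: measurable_dotpB => // l; exact: measurable_row_step.
  - by apply/measurable_EFinP; exact: measurable_dotpB.
  - by apply/measurable_EFinP; apply: measurable_dotpB => // l; exact: measurable_row_step.
  - by move=> s; rewrite lee_fin dotp_ge0.
  - by move=> s; rewrite lee_fin dotp_ge0.
  - by move=> s; rewrite lee_fin dotp_ge0.
  move=> s _; rewrite -!EFinM -EFinD lee_fin /=.
  have -> : dotp (simple_value S s w - h s) (simple_value S s w - h s) =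
      dotp (h s - ga s) (h s - ga s).
    by apply: eq_bigr => l _; rewrite !mxE; ring.
  rewrite [h s - step _ _ _](_ : _ = (h s - ga s) + (ga s - step n (fun k => ga (grid n k.+1)) s)).
    exact: dotpD_le.
  by rewrite addrA subrK.
move=> k; apply: (@le_trans _ _ (K * (T / n%:R))).
  rewrite ler_wpM2r ?divr_ge0 ?(ltW T0)//; apply: ler_sum => l _.
  rewrite -expr2 gaE; apply: le_trans (sqr_sum_fin_le _) _.
  rewrite card_ord mulr_sumr; apply: ler_sum => j _.
  rewrite exprMn mulrA ler_wpM2l//.
  by case: (_ < _ <= _); rewrite ?expr1n ?expr0n// ler1n.
by apply: le_trans (HN _ Nn n_gt0) _; lra.
Qed.

(** One grid of size [n v] is shared by all [i < m], because the Taylor expansion moves all factors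
    over the same cell. *)
Lemma det_sequence (m : nat) (h : nat -> R -> 'rV[R]_d) (W : nat -> R -> Omega -> R) :
  (forall i, is_ito_integral P T B (fun t _ => h i t) (W i)) ->
  exists (n : nat -> nat) (g : nat -> nat -> nat -> 'rV[R]_d),
    forall v, (0 < n v)%N /\ forall i, (i < m)%N ->
    (\int[leb]_(s in `[0%R, T]) (let r := h i s - step (n v) (g v i) s in dotp r r)%:E
      <= ((2^-1 ^+ v) ^+ 2)%:E)%E /\
    forall k, dotp (g v i k) (g v i k) * (T / (n v)%:R) <= (2^-1 ^+ v) ^+ 2.
Proof.
move=> hW.
have /choice[n Hn] : forall v, exists n, (0 < n)%N /\ forall i, (i < m)%N ->
    exists g : nat -> 'rV[R]_d,
    (\int[leb]_(s in `[0%R, T]) (let r := h i s - step n g s in dotp r r)%:E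
      <= ((2^-1 ^+ v) ^+ 2)%:E)%E /\
    forall k, dotp (g k) (g k) * (T / n%:R) <= (2^-1 ^+ v) ^+ 2.
  move=> v.
  have e0 : 0 < (2^-1 ^+ v) ^+ 2 :> R by rewrite !exprn_gt0.
  have /choice[N HN] := fun i => det_approx (hW i) e0.
  exists (\max_(i < m) N i).+1; split=> // i im.
  have [|//|g g1 g2] := HN i (\max_(i < m) N i).+1.
    by apply: leqW; exact: (leq_bigmax (Ordinal im)).
  by exists g.
have /choice[g Hg] : forall v, exists g : nat -> nat -> 'rV[R]_d, forall i, (i < m)%N ->
    (\int[leb]_(s in `[0%R, T]) (let r := h i s - step (n v) (g i) s in dotp r r)%:E
      <= ((2^-1 ^+ v) ^+ 2)%:E)%E /\
    forall k, dotp (g i k) (g i k) * (T / (n v)%:R) <= (2^-1 ^+ v) ^+ 2.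
  move=> v; have [_ gv] := Hn v.
  have /choice[g Hg] : forall i, exists g : nat -> 'rV[R]_d, (i < m)%N ->
      (\int[leb]_(s in `[0%R, T]) (let r := h i s - step (n v) g s in dotp r r)%:E
        <= ((2^-1 ^+ v) ^+ 2)%:E)%E /\
      forall k, dotp (g k) (g k) * (T / (n v)%:R) <= (2^-1 ^+ v) ^+ 2.
    move=> i; case: (ltnP i m) => im; last by exists (fun=> 0).
    by have [g Hg] := gv i im; exists g.
  by exists g.
by exists n, g => v; split; [case: (Hn v)|exact: Hg].
Qed.

End approximation.

(** * Almost sure convergence and moments of limits *)

Section almost_sure_limits.
Context {R : realType} {disp : measure_display} {Omega : measurableType disp}.
Variable P : probability Omega R.

(** The series of squares has finite expectation, hence converges almost surely, and its terms tend
    to 0. *)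
Lemma ae_cvg_summable (U : nat -> Omega -> R) (a : R) : 0 <= a ->
  (forall v, measurable_fun setT (U v)) ->
  (forall v, \int[P]_w (U v w ^+ 2)%:E <= (a * (2^-1 ^+ v) ^+ 2)%:E)%E ->
  {ae P, forall w, U v w @[v --> \oo] --> 0}.
Proof.
move=> a0 mU Ua.
pose S w := (\sum_(v <oo) (U v w ^+ 2)%:E)%E.
have mU2 v : measurable_fun setT (fun w => (U v w ^+ 2)%:E).
  by apply/measurable_EFinP; exact: measurable_funX.
have U2_ge0 v w : (0 <= (U v w ^+ 2)%:E)%E by rewrite lee_fin sqr_ge0.
have S0 w : (0 <= S w)%E by apply: nneseries_ge0.
have mS : measurable_fun setT S.
  exact: (ge0_emeasurable_sum (fun v w _ _ => U2_ge0 v w) (fun v _ => mU2 v)).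
have iS : P.-integrable setT S.
  apply/integrableP; split => //.
  under eq_integral do rewrite gee0_abs//.
  rewrite integral_nneseries//; apply: (@le_lt_trans _ _ (a * (1 - 2^-1)^-1)%:E).
    apply: lime_le; first by apply: is_cvg_nneseries => v _ _; exact: integral_ge0.
    apply: nearW => n; apply: (@le_trans _ _ (\sum_(0 <= v < n) (a * 2^-1 ^+ v)%:E)%E).
      apply: lee_sum => v _; apply: le_trans (Ua v) _; rewrite lee_fin ler_wpM2l//.
      by apply: ler_iXnr; rewrite ?exprn_ge0// exprn_ile1// invf_le1// ler1n.
    rewrite sumEFin lee_fin; apply: geometric_le_lim => //.
    by rewrite gtr0_norm// invf_lt1// ltr1n.
  by rewrite ltry.
have := integrable_ae measurableT iS; apply: filterS => w /(_ I) fS.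
have cS : cvgn (series (fun v => U v w ^+ 2)).
  apply: nondecreasing_is_cvgn.
    apply/nondecreasing_seqP => n; rewrite /series /= big_nat_recr//= lerDl sqr_ge0 //.
  exists (fine (S w)) => _ [n _ <-] /=.
  rewrite -lee_fin fineK// /series /= -sumEFin.
  exact: nneseries_lim_ge.
have /cvgrPdist_lt U2 := cvg_series_cvg_0 cS.
apply/cvgrPdist_lt => e e0.
have := U2 (e ^+ 2) (exprn_gt0 _ e0); apply: filterS => v.
rewrite !sub0r !normrN normrX ltr_pXn2r//.
by rewrite nnegrE ltW.
Qed.

(** Fatou's lemma: almost surely the lower limit of the powers is the power of the limit. *)
Lemma ae_lim_moment (U : nat -> Omega -> R) (V : Omega -> R) p (C : R) :
  (forall n, measurable_fun setT (U n)) -> measurable_fun setT V ->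
  {ae P, forall w, U n w @[n --> \oo] --> V w} ->
  (forall n, \int[P]_w ((U n w ^+ 2) ^+ p)%:E <= C%:E)%E ->
  (\int[P]_w ((V w ^+ 2) ^+ p)%:E <= C%:E)%E.
Proof.
move=> mU mV UV UC.
have m2 (X : Omega -> R) : measurable_fun setT X ->
    measurable_fun setT (fun w => ((X w ^+ 2) ^+ p)%:E).
  by move=> mX; apply/measurable_EFinP; do 2 apply: measurable_funX.
have m2U n := m2 _ (mU n).
have ge0 (X : Omega -> R) w : (0 <= ((X w ^+ 2) ^+ p)%:E)%E.
  by rewrite lee_fin sqr_pow_ge0.
pose L w := limn_einf (fun n => ((U n w ^+ 2) ^+ p)%:E).
have L0 w : (0 <= L w)%E.
  rewrite /L limn_einf_lim; apply: lime_ge; first exact: is_cvg_einfs.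
  by apply: nearW => n; apply: le_ereal_inf_tmp => _ [k _ <-].
rewrite (ge0_ae_eq_integral (g := L) measurableT (m2 _ mV))//; first last.
- have := UV; apply: filterS => w UVw _; apply/esym.
  have cX k (u : nat -> R) (x : R) : u n @[n --> \oo] --> x -> u n ^+ k @[n --> \oo] --> x ^+ k.
    move=> ux; elim: k => [|k IHk]; first exact: cvg_cst.
    under eq_fun do rewrite (exprS _ k); rewrite (exprS x).
    exact: cvgM.
  have c2 : ((U n w ^+ 2) ^+ p)%:E @[n --> \oo] --> ((V w ^+ 2) ^+ p)%:E.
    apply: cvg_EFin; first exact: nearW.
    by apply: (cX p (fun n => U n w ^+ 2)); exact: (cX 2).
  by rewrite /L is_cvg_limn_einfE; [exact: cvg_lim c2|apply/cvg_ex; eexists; exact: c2].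
- apply: measurableT_comp => //; apply: measurable_fun_limn_esup => n.
  by apply: measurableT_comp => //; exact: m2U.
have := fatou P measurableT m2U (fun n w _ => ge0 (U n) w).
move=> /le_trans; apply.
rewrite limn_einf_lim; apply: lime_le; first exact: is_cvg_einfs.
apply: nearW => n; apply: le_trans (UC n).
by apply: ereal_inf_lbound; exists n => /=.
Qed.

End almost_sure_limits.

Section cells.
Context {R : realType}.
Variable T : R.
Hypothesis T0 : 0 < T.
Notation leb := (@lebesgue_measure R).
Notation grid := (grid T).

Lemma cell_cases n s : (0 < n)%N -> 0 <= s <= T ->
  (s = 0 /\ forall (V : lmodType R) (f : nat -> V),
     \sum_(j < n) (grid n j < s <= grid n j.+1)%R%:R *: f j = 0) \/
  exists k : nat, [/\ (k < n)%N, grid n k < s <= grid n k.+1 &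
    forall (V : lmodType R) (f : nat -> V),
      \sum_(j < n) (grid n j < s <= grid n j.+1)%R%:R *: f j = f k].
Proof.
move=> n0 /andP[]; rewrite le_eqVlt => /predU1P[<- _|s0 sT]; [left|right].
  split=> // V f; apply: big1 => j _.
  by have /le_gtF -> := grid_ge0 T0 n j; rewrite scale0r.
exact: grid_cell.
Qed.

(** The integral up to [t] is written over [[0, T]] with an indicator, so that the truncated cell
    lengths are overlaps with []0, t]]. *)
Lemma has_integral_cells n t (c : nat -> R) : 0 <= t <= T -> (0 < n)%N ->
  has_integral leb `[0, T]
    (fun s => (0 < s <= t)%R%:R *
       \sum_(k < n) c k * (grid n k < s <= grid n k.+1)%R%:R)
    (\sum_(k < n) c k * (Num.min (grid n k.+1) t - Num.min (grid n k) t)).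
Proof.
move=> /andP[t0 tT] n0.
have mD : measurable (`[0, T] : set (measurableTypeR R)) by exact: measurable_itv.
have H (k : 'I_n) := has_integralZ mD (c k) (@has_integral_indic_itv _ T (grid n k)
  (grid n k.+1) 0 t (grid_ge0 T0 _ _) (grid_leT T0 n0 (ltn_ord k))).
have := has_integral_sum mD (index_enum 'I_n) H.
rewrite (_ : \sum_(i < n) _ =
  \sum_(k < n) c k * (Num.min (grid n k.+1) t - Num.min (grid n k) t)).
  apply: (has_integral_eq mD) => s _; rewrite mulr_sumr; apply: eq_bigr => k _ /=.
  by rewrite [RHS]mulrCA; congr (_ * _); exact: mulrC.
apply: eq_bigr => k _; congr (_ * _); rewrite /overlap.
have g0 := grid_ge0 T0 n k; have g1 := grid_le T0 n (leqnSn k).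
by rewrite /Num.max /Num.min; repeat case: ifPn; rewrite -?leNgt => *; lra.
Qed.

(* The left endpoint of the grid cell containing [s], and [0] for [s = 0]. *)
Definition cell_left n s := \sum_(k < n) (grid n k < s <= grid n k.+1)%R%:R *: (grid n k : R^o).

Lemma cell_left_bounds n s : (0 < n)%N -> 0 <= s <= T ->
  0 <= cell_left n s <= s /\ s - T / n%:R <= cell_left n s.
Proof.
move=> n0 sT; rewrite /cell_left.
have Tn : 0 <= T / n%:R by rewrite divr_ge0// ltW.
have [[-> ->]|[k [kn /andP[ks sk] ->]]] := cell_cases n0 sT.
  by rewrite lexx sub0r oppr_le0.
by rewrite (grid_ge0 T0) (ltW ks) -(grid_step T n k); split=> //; lra.
Qed.

End cells.

Lemma ito_energy_bound {R : realType} disp (Omega : measurableType disp) (P : probability Omega R)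
    d (T : R) (B : R -> Omega -> 'rV[R]_d) (h : nat -> R -> 'rV[R]_d) (W : nat -> R -> Omega -> R) m :
  (forall i, is_ito_integral P T B (fun t _ => h i t) (W i)) ->
  exists2 K : R, 0 <= K & forall i, (i < m)%N ->
    (\int[@lebesgue_measure R]_(s in `[0%R, T]) (dotp (h i s) (h i s))%:E <= K%:E)%E.
Proof.
move=> hW.
have /choice[C HC] : forall i, exists C : R, 0 <= C /\
    (\int[@lebesgue_measure R]_(s in `[0%R, T]) (dotp (h i s) (h i s))%:E <= C%:E)%E.
  move=> i; have [[_ _ fh] _ _ _] := hW i.
  pose C := (\int[@lebesgue_measure R]_(s in `[0%R, T]) (dotp (h i s) (h i s))%:E)%E.
  have C0 : (0 <= C)%E by apply: integral_ge0 => s _; rewrite lee_fin dotp_ge0.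
  have Cf : C \is a fin_num.
    by rewrite ge0_fin_numE//; move: fh; rewrite integral_cst//= probability_setT mule1.
  by exists (fine C); split; [exact: fine_ge0|rewrite fineK].
exists (\sum_(i < m) C i) => [|i im]; first by apply: sumr_ge0 => i _; case: (HC i).
apply: le_trans (proj2 (HC i)) _; rewrite lee_fin (bigD1 (Ordinal im))//= lerDl.
by apply: sumr_ge0 => j _; case: (HC j).
Qed.

(** * Discretized integrals and their convergence to [W] *)

Section scheme.
Context {R : realType} {disp : measure_display} {Omega : measurableType disp}.
Variables (P : probability Omega R) (d : nat) (T : R) (B : R -> Omega -> 'rV[R]_d).
Hypothesis Pcomplete : measure_is_complete P.
Hypothesis BM : standard_brownian_motion P T B.
Hypothesis T0 : 0 < T.

Notation adm := (adm P B).
Notation incr := (incr B).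
Notation leb := (@lebesgue_measure R).
Notation grid := (grid T).

Variables (h : nat -> R -> 'rV[R]_d) (W : nat -> R -> Omega -> R).
Hypothesis hW : forall i, is_ito_integral P T B (fun t _ => h i t) (W i).
Variables (m : nat) (n : nat -> nat) (g : nat -> nat -> nat -> 'rV[R]_d).
Hypothesis n_gt0 : forall v, (0 < n v)%N.
Hypothesis g_dist : forall v i, (i < m)%N ->
  (\int[leb]_(s in `[0%R, T]) (let r := h i s - step T (n v) (g v i) s in dotp r r)%:E
    <= ((2^-1 ^+ v) ^+ 2)%:E)%E.
Hypothesis g_small : forall v i k, (i < m)%N ->
  dotp (g v i k) (g v i k) * (T / (n v)%:R) <= (2^-1 ^+ v) ^+ 2.

Let mD : measurable (`[0, T] : set (measurableTypeR R)).
Proof. exact: measurable_itv. Qed.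

(* Families of random variables are indexed by all real times, clamped to
   [[0, T]]. *)
Definition clamp (t : R) := Num.max 0 (Num.min t T).

Lemma clamp_in t : 0 <= clamp t <= T.
Proof. by rewrite /clamp le_max lexx/= ge_max (ltW T0) ge_min lexx orbT. Qed.

Lemma clamp_id t : 0 <= t <= T -> clamp t = t.
Proof. by move=> /andP[t0 tT]; rewrite /clamp (min_idPl tT) (max_idPr t0). Qed.

Definition Wd v i t (w : Omega) := simple_integral B (det_process T (n v) (g v i)) t w.

Lemma min_grid_le q k t : Num.min (grid q k) t <= Num.min (grid q k.+1) t.
Proof. by rewrite le_min !ge_min lexx orbT (grid_le T0). Qed.

(** At a truncated grid time the later increments degenerate and only those of the first [k] cells
    survive. *)
Lemma Wd_sum v i t w k : (k <= n v)%N ->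
  Wd v i (Num.min (grid (n v) k) t) w =
  \sum_(j < k) \sum_l g v i j 0 l *
    incr (Num.min (grid (n v) j) t) (Num.min (grid (n v) j.+1) t) l w.
Proof.
move=> kn; rewrite /Wd simple_integralE /=.
rewrite [RHS](big_ord_widen _ (fun j => \sum_l g v i j 0 l *
    incr (Num.min (grid (n v) j) t) (Num.min (grid (n v) j.+1) t) l w) kn).
rewrite [RHS]big_mkcond; apply: eq_bigr => j _.
case: ifPn => [jk|]; last rewrite -leqNgt => kj.
  by apply: eq_bigr => l _; rewrite !minA !(min_idPl (grid_le T0 _ _))// ltnW.
apply: big1 => l _.
rewrite !minA !(min_idPr (grid_le T0 _ _))//; last exact: leqW.
by rewrite incrxx mulr0.
Qed.

Lemma Wd0 v i w : Wd v i 0 w = 0.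
Proof.
by rewrite -[0 in LHS](min_idPl (lexx 0)) -[X in Num.min X](grid0 T (n v)) Wd_sum// big_ord0.
Qed.

Lemma adm_Wd v i t : 0 <= t -> adm t (Wd v i t).
Proof.
move=> t0; have E w : \sum_(k < n v) \sum_l g v i k 0 l *
    incr (Num.min (grid (n v) k) t) (Num.min (grid (n v) k.+1) t) l w = Wd v i t w.
  by rewrite /Wd simple_integralE.
refine (adm_eq _ E); apply: adm_sum => k; apply: adm_sum => l.
apply: admM; first exact: (@adm_cst _ _ _ P _ B _ (g v i k 0 l)).
apply: adm_incr.
- by rewrite le_min t0 grid_ge0.
- exact: min_grid_le.
- by rewrite ge_min lexx orbT.
Qed.

Lemma measurable_Wd v i t : 0 <= t <= T -> measurable_fun setT (Wd v i t).
Proof. by move=> tT; apply: (adm_measurable Pcomplete BM tT); apply: adm_Wd; case/andP: tT. Qed.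

Lemma step_dotp_integral v i j :
  has_integral leb `[0, T]
    (fun s => dotp (step T (n v) (g v i) s) (step T (n v) (g v j) s))
    (\sum_(k < n v) dotp (g v i k) (g v j k) * (T / (n v)%:R)).
Proof.
have TT : 0 <= T <= T by rewrite lexx ltW.
have := has_integral_cells T0 (fun k => dotp (g v i k) (g v j k)) TT (n_gt0 v).
rewrite (_ : \sum_(k < n v) _ = \sum_(k < n v) dotp (g v i k) (g v j k) * (T / (n v)%:R)).
  apply: (has_integral_eq mD) => s; rewrite inE /= in_itv /= => sT.
  rewrite /step; have [[-> H]|[k [kn ks H]]] := cell_cases T0 (n_gt0 v) sT.
    by rewrite !H ltxx /= mul0r /dotp big1// => l _; rewrite mxE mul0r.
  have := H R^o (fun k => dotp (g v i k) (g v j k) : R^o); rewrite /GRing.scale /= => E.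
  under eq_bigr do rewrite mulrC.
  rewrite E !H (_ : 0 < s <= T) ?mul1r//.
  by case/andP: sT => _ ->; case/andP: ks => /(le_lt_trans (grid_ge0 T0 _ _)) ->.
apply: eq_bigr => k _; rewrite -(grid_step T _ k).
by rewrite !(min_idPl _)// (grid_leT T0)// ltnW.
Qed.

(** The step functions are within L^2 distance 1 of the [h i], so their energies are at most
    [2 + 2 * C], with [C] a common bound for the energies of the [h i]. *)
Lemma g_energy : exists2 K : R, 0 <= K & forall v i, (i < m)%N ->
  \sum_(k < n v) dotp (g v i k) (g v i k) * (T / (n v)%:R) <= K.
Proof.
have [C C0 HC] := ito_energy_bound m hW.
exists (2 + 2 * C) => [|v i im]; first by rewrite addr_ge0// mulr_ge0.
rewrite -lee_fin -(proj2 (step_dotp_integral v i i)).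
have mhl l : measurable_fun `[0, T] (fun s : measurableTypeR R => h i s 0 l).
  by have [[mh _ _] _ _ _] := hW i; exact: (measurable_section (point : Omega) mD (mh l)).
have mst l : measurable_fun `[0, T] (fun s : measurableTypeR R => step T (n v) (g v i) s 0 l).
  exact: measurable_row_step.
have mr : measurable_fun `[0, T] (fun s : measurableTypeR R =>
    dotp (h i s - step T (n v) (g v i) s) (h i s - step T (n v) (g v i) s)).
  exact: measurable_dotpB.
have r1 : ((2^-1 ^+ v) ^+ 2 <= 1 :> R) by rewrite exprn_ile1 ?exprn_ge0// exprn_ile1// invf_le1// ler1n.
apply: (@le_trans _ _ (2%:E * (\int[leb]_(s in `[0%R, T])
    (let r := h i s - step T (n v) (g v i) s in dotp r r)%:E) +
    2%:E * \int[leb]_(s in `[0%R, T]) (dotp (h i s) (h i s))%:E)%E).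
  apply: integral_le_lin2 => //.
  - by apply/measurable_EFinP; apply: measurable_sum => l; apply: measurable_funM; exact: mst.
  - exact/measurable_EFinP.
  - by apply/measurable_EFinP; apply: measurable_sum => l; apply: measurable_funM; exact: mhl.
  - by move=> s; rewrite lee_fin dotp_ge0.
  - by move=> s; rewrite lee_fin dotp_ge0.
  - by move=> s; rewrite lee_fin dotp_ge0.
  move=> s _; rewrite -!EFinM -EFinD lee_fin /=.
  rewrite -[X in dotp X _](subrK (h i s)) -[X in dotp _ X](subrK (h i s)).
  apply: le_trans (dotpD_le _ _) _; rewrite lerD2r ler_wpM2l//.
  by apply: ler_sum => l _; rewrite !mxE; nra.
rewrite (EFinD 2 (2 * C)) (EFinM 2 C); apply: leeD; last first.
  by apply: lee_wpmul2l => //; exact: HC.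
rewrite -[leRHS]mule1; apply: lee_wpmul2l => //.
by apply: le_trans (g_dist v im) _; rewrite lee_fin.
Qed.

Lemma Wd_dist v i t : (i < m)%N -> 0 <= t <= T ->
  (\int[P]_w ((W i t w - Wd v i t w) ^+ 2)%:E <= (4 * (2^-1 ^+ v) ^+ 2)%:E)%E.
Proof.
move=> im tT.
have vd : simple_valid P T (augmented_filtration P B) (det_process T (n v) (g v i)).
  exact: (@det_process_valid _ _ _ P _ _ B T0 _ _ (n_gt0 v)).
have vs s (w : Omega) : simple_value (det_process T (n v) (g v i)) s w = step T (n v) (g v i) s.
  by [].
have D := ito_integral_dist Pcomplete BM (hW i) vd vs tT; apply: le_trans D _.
by rewrite EFinM; apply: lee_wpmul2l => //; exact: g_dist.
Qed.

(** Each component is a weighted sum of increments with total variance at most [K], whatever the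
    grid and the time, so [gauss_sum_moment] is uniform in [v] and [t]. *)
Lemma bounded_Wd i : (i < m)%N ->
  bounded_moments P (fun z : nat * R => Wd z.1 i (clamp z.2)).
Proof.
move=> im; have [K K0 HK] := g_energy.
pose U l (z : nat * R) w := \sum_(k < n z.1) g z.1 i k 0 l *
  incr (Num.min (grid (n z.1) k) (clamp z.2)) (Num.min (grid (n z.1) k.+1) (clamp z.2)) l w.
apply: (bounded_moments_eq (U := fun z w => \sum_l U l z w)) => [z w|].
  by rewrite /Wd simple_integralE /U exchange_big.
apply: bounded_moments_sum => l; split=> [z|p].
  have /andP[c0 cT] := clamp_in z.2.
  apply: measurable_sum => k; apply: measurable_funM => //.
  by apply: (measurable_incr BM); rewrite le_min c0 (grid_ge0 T0) ge_min cT orbT.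
exists ((2 * p)`!%:R * (expR (K / 2) * 2)) => z.
have /andP[c0 cT] := clamp_in z.2.
apply: (gauss_sum_moment Pcomplete BM (s := fun k => Num.min (grid (n z.1) k) (clamp z.2))
  (c := fun k => g z.1 i k 0 l)).
- by move=> k; rewrite le_min c0 (grid_ge0 T0).
- move=> k; exact: min_grid_le.
- by move=> k; rewrite ge_min cT orbT.
apply: le_trans (HK z.1 i im); apply: ler_sum => k _.
rewrite -(grid_step T (n z.1) k); apply: ler_pM.
- exact: sqr_ge0.
- by rewrite subr_ge0 min_grid_le.
- exact: sqr_le_dotp.
have g1 := grid_le T0 (n z.1) (leqnSn k).
by rewrite /Num.min; repeat case: ifPn; rewrite -?leNgt => *; lra.
Qed.

Lemma ae_cvg_Wd i t : (i < m)%N -> 0 <= t <= T ->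
  {ae P, forall w, Wd v i t w @[v --> \oo] --> W i t w}.
Proof.
move=> im tT.
have mW : measurable_fun setT (W i t) by have [_ + _ _] := hW i; exact.
have := ae_cvg_summable (a := 4) (U := fun v w => W i t w - Wd v i t w) (ler0n _ 4).
move=> /(_ P (fun v => measurable_funB mW (measurable_Wd v i tT)) (fun v => Wd_dist v im tT)).
apply: filterS => w c.
apply/cvgrPdist_lt => e e0; move/cvgrPdist_lt : c => /(_ e e0).
by apply: filterS => v; rewrite sub0r normrN.
Qed.

Lemma adm_W i t : (i < m)%N -> 0 <= t <= T -> adm t (W i t).
Proof.
move=> im tT; refine (adm_lim (fun v => _) (ae_cvg_Wd im tT)).
by apply: adm_Wd; case/andP: tT.
Qed.

Lemma measurable_W i t : 0 <= t <= T -> measurable_fun setT (W i t).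
Proof. by move=> tT; have [_ + _ _] := hW i; exact. Qed.

Lemma bounded_W i : (i < m)%N -> bounded_moments P (fun t => W i (clamp t)).
Proof.
move=> im; have [_ HC] := bounded_Wd im; split=> [t|p].
  exact: measurable_W (clamp_in t).
have [C {}HC] := HC p; exists C => t.
apply: (ae_lim_moment (U := fun v => Wd v i (clamp t))) => //.
- by move=> v; exact: measurable_Wd (clamp_in t).
- exact: measurable_W (clamp_in t).
- exact: ae_cvg_Wd (clamp_in t).
- by move=> v; exact: (HC (v, t)).
Qed.

Lemma W_zero i : (i < m)%N -> {ae P, forall w, W i 0 w = 0}.
Proof.
move=> im; have T00 : 0 <= (0 : R) <= T by rewrite lexx ltW.
have := ae_cvg_Wd im T00; apply: filterS => w c.
apply: (cvg_unique _ c) => //=.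
by under eq_fun do rewrite Wd0; exact: cvg_cst.
Qed.

Lemma geometric_small (c e : R) : 0 <= c -> 0 < e ->
  exists N, forall v, (N <= v)%N -> c * (2^-1 ^+ v) ^+ 2 <= e.
Proof.
move=> c0 e0; exists (Num.truncn (c / e)).+1 => v Nv.
have v1 : 2^-1 ^+ v <= 1 :> R by rewrite exprn_ile1// invf_le1// ler1n.
apply: (@le_trans _ _ (c * 2^-1 ^+ v)).
  by rewrite ler_wpM2l// ler_iXnr// exprn_ge0.
rewrite exprVn ler_pdivrMr ?exprn_gt0// [leRHS]mulrC -ler_pdivrMr//.
apply: ltW; apply: lt_le_trans (truncnS_gt _) _.
by rewrite -natrX ler_nat (leq_trans Nv)// ltnW// ltn_expl.
Qed.

(** L^2 convergence is raised to all moments by interpolation with the uniform bounds, since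
    products of Hermite polynomials call for high moments. *)
Lemma vanishing_Wd i : (i < m)%N ->
  vanishing_moments P (fun v t w => W i (clamp t) w - Wd v i (clamp t) w).
Proof.
move=> im; apply: vanishing_moments_L2.
  apply: bounded_momentsB; last exact: bounded_Wd.
  exact: (bounded_momentsW (fun z : nat * R => z.2) (bounded_W im)).
move=> e e0; have [N HN] := geometric_small (ler0n R 4) e0.
exists N => v t Nv; apply: le_trans (Wd_dist v im (clamp_in t)) _.
by rewrite lee_fin HN.
Qed.

(** The difference involves part of a single cell, with variance at most [dotp g g * (T / n)], which
    [g_small] controls; the factor [d] is Cauchy-Schwarz over the components. *)
Lemma Wd_cell v i t : (i < m)%N -> 0 <= t <= T ->
  (\int[P]_w ((Wd v i t w - Wd v i (cell_left T (n v) t) w) ^+ 2)%:E <=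
   (d%:R * (2^-1 ^+ v) ^+ 2)%:E)%E.
Proof.
move=> im tT; rewrite /cell_left.
have [[-> ->]|[k [kn /andP[kt tk] ->]]] := cell_cases T0 (n_gt0 v) tT.
  rewrite integral0_eq ?lee_fin ?mulr_ge0 ?sqr_ge0// => w _.
  by rewrite subrr expr0n.
have E w : Wd v i t w - Wd v i (grid (n v) k) w =
    \sum_l g v i k 0 l * incr (grid (n v) k) t l w.
  rewrite -[in Wd v i t w](min_idPr tk) -[in X in _ - X](min_idPl (ltW kt)).
  rewrite !Wd_sum//; last exact: ltnW.
  by rewrite big_ord_recr/= (min_idPr tk) (min_idPl (ltW kt)) addrC addrK.
have g0 := grid_ge0 T0 (n v) k; have /andP[_ tT'] := tT.
have H l := has_integralZ measurableT (g v i k 0 l ^+ 2)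
  (has_integral_incr_sqr BM l g0 (ltW kt) tT').
have HS := has_integralZ measurableT d%:R (has_integral_sum measurableT (index_enum 'I_d) H).
under eq_integral do rewrite E.
have mi l : measurable_fun setT (incr (grid (n v) k) t l).
  by apply: (measurable_incr BM) => //; rewrite g0 (le_trans (ltW kt)).
apply: (@le_trans _ _ (\int[P]_w (d%:R * \sum_l g v i k 0 l ^+ 2 * incr (grid (n v) k) t l w ^+ 2)%:E)%E).
  apply: ge0_le_integral => //.
  - by move=> w _; rewrite lee_fin sqr_ge0.
  - apply/measurable_EFinP; apply: measurable_funX; apply: measurable_sum => l.
    exact: measurable_funM.
  - exact: (measurable_int P (proj1 HS)).
  move=> w _; rewrite lee_fin; apply: le_trans (sqr_sum_fin_le _) _.
  by rewrite card_ord; under eq_bigr do rewrite exprMn.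
rewrite (proj2 HS) lee_fin -mulr_suml ler_wpM2l//.
apply: le_trans (g_small v k im).
rewrite -(grid_step T _ k) (_ : dotp _ _ = \sum_l g v i k 0 l ^+ 2)//.
by rewrite ler_wpM2l ?sumr_ge0// => [l _|]; rewrite ?sqr_ge0// lerB.
Qed.

Lemma vanishing_cell i : (i < m)%N ->
  vanishing_moments P (fun v t w =>
    W i (clamp t) w - Wd v i (cell_left T (n v) (clamp t)) w).
Proof.
move=> im; apply: (vanishing_moments_eq (U := fun v t w =>
  (W i (clamp t) w - Wd v i (clamp t) w) +
  (Wd v i (clamp t) w - Wd v i (cell_left T (n v) (clamp t)) w))).
  by move=> v t w; rewrite addrA subrK.
apply: vanishing_momentsD; first exact: vanishing_Wd.
have clT v t : clamp (cell_left T (n v) (clamp t)) = cell_left T (n v) (clamp t).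
  apply: clamp_id; have [/andP[-> ct] _] := cell_left_bounds T0 (n_gt0 v) (clamp_in t).
  by rewrite (le_trans ct)//; case/andP: (clamp_in t).
apply: vanishing_moments_L2.
  apply: bounded_momentsB; first exact: bounded_Wd.
  have := bounded_momentsW (fun z : nat * R => (z.1, cell_left T (n z.1) (clamp z.2)))
    (bounded_Wd im).
  by apply: bounded_moments_eq => z w /=; rewrite clT.
move=> e e0; have [N HN] := geometric_small (ler0n R d) e0.
exists N => v t Nv; apply: le_trans (Wd_cell v im (clamp_in t)) _.
by rewrite lee_fin HN.
Qed.

End scheme.

(** * Taylor expansion of products of Hermite polynomials *)

Section hermite_products.
Context {R : realType}.
Implicit Types (c : nat -> int) (x : nat -> R).

Definition hermitez_poly (z : int) : {poly R} := if z is Posz n then hermite_poly n else 0.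

Lemma hermitezE z (x : R) : hermitez z x = (hermitez_poly z).[x].
Proof. by case: z => n /=; rewrite ?hermiteE ?horner0. Qed.

Lemma deriv_hermitez_poly z : (hermitez_poly z)^`() = hermitez_poly (z - 1).
Proof.
case: z => [[|n]|n]; first exact: derivC.
  have -> : Posz n.+1 - 1 = Posz n by rewrite intS addrC addKr.
  exact: deriv_hermite_poly.
by rewrite NegzE -opprD addrC -intS; exact: deriv0.
Qed.

(** The indices are integers so that derivatives are index shifts throughout and a negative index
    annihilates the product, in agreement with [ext_coord]. *)
Definition hermite_prod m c x : R := \prod_(i < m) hermitez (c i) (x i).

Lemma hermite_prodS m c x :
  hermite_prod m.+1 c x = hermite_prod m c x * hermitez (c m) (x m).
Proof. by rewrite /hermite_prod big_ord_recr. Qed.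

Lemma eq_hermite_prod m c c' x x' : (forall i, (i < m)%N -> c i = c' i) ->
  (forall i, (i < m)%N -> x i = x' i) -> hermite_prod m c x = hermite_prod m c' x'.
Proof. by move=> cc xx; apply: eq_bigr => i _; rewrite cc// xx. Qed.

Lemma hermite_prod_unit m c x : hermite_prod m (c - unit_seq m) x = hermite_prod m c x.
Proof.
apply: eq_hermite_prod => // i im; rewrite /unit_seq !fctE ltn_eqF// subr0//.
Qed.

Lemma hermite_prod_unit2 m c x : hermite_prod m (c - unit_seq m *+ 2) x = hermite_prod m c x.
Proof. by rewrite mulr2n opprD addrA !hermite_prod_unit. Qed.

Lemma sub_unit_at c m : (c - unit_seq m) m = c m - 1.
Proof. by rewrite /unit_seq !fctE eqxx. Qed.

Lemma sub_unit_off c i m : (i < m)%N -> (c - unit_seq i) m = c m.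
Proof. by move=> im; rewrite /unit_seq !fctE gtn_eqF// subr0. Qed.

End hermite_products.

Section hermite_moments.
Context {R : realType} {disp : measure_display} {Omega : measurableType disp}.
Variable P : probability Omega R.
Notation bounded_moments := (bounded_moments P).
Notation vanishing_moments := (vanishing_moments P).

Lemma bounded_moments_hermitez (J : Type) z (x : J -> Omega -> R) :
  bounded_moments x -> bounded_moments (fun j w => hermitez z (x j w)).
Proof.
move=> bx; apply: (bounded_moments_eq (U := fun j w => (hermitez_poly z).[x j w])).
  by move=> j w; rewrite hermitezE.
exact: bounded_moments_horner.
Qed.

Lemma bounded_moments_hermite_prod (J : Type) m c (x : nat -> J -> Omega -> R) :
  (forall i, (i < m)%N -> bounded_moments (x i)) ->
  bounded_moments (fun j w => hermite_prod m c (x^~ j ^~ w)).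
Proof.
elim: m => [_|m IHm bx].
  apply: (bounded_moments_eq (U := fun j w => 1)) => [j w|].
    by rewrite /hermite_prod big_ord0.
  by apply: (bounded_moments_cst _ (M := 1)) => j; rewrite normr1.
apply: (bounded_moments_eq (U := fun j w =>
  hermite_prod m c (x^~ j ^~ w) * hermitez (c m) (x m j w))) => [j w|].
  by rewrite hermite_prodS.
apply: bounded_momentsM; last by apply: bounded_moments_hermitez; exact: bx.
by apply: IHm => i im; apply: bx; exact: ltnW.
Qed.

Lemma vanishing_moments_horner (J : Type) (p : {poly R}) (x y : nat -> J -> Omega -> R) :
  bounded_moments (fun z : nat * J => x z.1 z.2) ->
  bounded_moments (fun z : nat * J => y z.1 z.2) ->
  vanishing_moments (fun n j w => x n j w - y n j w) ->
  vanishing_moments (fun n j w => p.[x n j w] - p.[y n j w]).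
Proof.
move=> bx by_ vxy; elim/poly_ind: p => [|p c IHp].
  apply: vanishing_moments_eq (vanishing_moments0 _ _) => n j w.
  by rewrite !horner0 subrr.
apply: (vanishing_moments_eq (U := fun n j w => (p.[x n j w] - p.[y n j w]) * x n j w +
   (x n j w - y n j w) * p.[y n j w])).
  by move=> n j w; rewrite !hornerMXaddC; ring.
by apply: vanishing_momentsD; apply: vanishing_momentsM => //; exact: bounded_moments_horner.
Qed.

(** Telescoping [a b - a' b' = (a - a') b + a' (b - b')] factor by factor: each summand is a
    vanishing family times a bounded one. *)
Lemma vanishing_moments_hermite_prod (J : Type) m c (x y : nat -> nat -> J -> Omega -> R) :
  (forall i, (i < m)%N -> bounded_moments (fun z : nat * J => x i z.1 z.2)) ->
  (forall i, (i < m)%N -> bounded_moments (fun z : nat * J => y i z.1 z.2)) ->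
  (forall i, (i < m)%N -> vanishing_moments (fun n j w => x i n j w - y i n j w)) ->
  vanishing_moments (fun n j w => hermite_prod m c (fun i => x i n j w) -
    hermite_prod m c (fun i => y i n j w)).
Proof.
elim: m => [|m IHm] bx by_ vxy.
  apply: vanishing_moments_eq (vanishing_moments0 _ _) => n j w.
  by rewrite /hermite_prod !big_ord0 subrr.
have bx' i im := bx i (ltnW im : (i < m.+1)%N).
have by' i im := by_ i (ltnW im : (i < m.+1)%N).
have vxy' i im := vxy i (ltnW im : (i < m.+1)%N).
apply: (vanishing_moments_eq (U := fun n j w =>
   (hermite_prod m c (fun i => x i n j w) - hermite_prod m c (fun i => y i n j w)) *
     hermitez (c m) (x m n j w) +
   ((hermitez_poly (c m)).[x m n j w] - (hermitez_poly (c m)).[y m n j w]) *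
     hermite_prod m c (fun i => y i n j w))).
  by move=> n j w; rewrite !hermite_prodS -!hermitezE; ring.
apply: vanishing_momentsD; apply: vanishing_momentsM.
- exact: IHm.
- by apply: bounded_moments_hermitez; exact: bx.
- by apply: vanishing_moments_horner; [exact: bx|exact: by_|exact: vxy].
- exact: (@bounded_moments_hermite_prod _ m c (fun i (z : nat * J) => y i z.1 z.2)).
Qed.

End hermite_moments.

Section taylor.
Context {R : realType} {disp : measure_display} {Omega : measurableType disp}.
Variable P : probability Omega R.
Variables (J : Type) (r : J -> R) (rho : R).
Hypothesis r_bnd : forall j, 0 <= r j <= rho.
Notation bounded_moments := (bounded_moments P).

Lemma bounded_moments_powr k : bounded_moments (fun j (_ : Omega) => r j ^+ k).
Proof.
apply: (bounded_moments_cst _ (M := rho ^+ k)) => j.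
have /andP[r0 rr] := r_bnd j.
by rewrite normrX ger0_norm// lerXn2r// nnegrE (le_trans r0).
Qed.

(** The expansion of a polynomial is exact, so the remainder is an explicit polynomial in [x], [y]
    and [r]. The scale [r] is kept apart from the normalized direction [y]: all smallness sits in
    the powers of [r]. *)
Lemma hermitez_taylor z (x y : J -> Omega -> R) :
  bounded_moments x -> bounded_moments y ->
  exists2 D, bounded_moments D & forall j w,
    hermitez z (x j w + r j * y j w) = hermitez z (x j w) +
    r j * (hermitez (z - 1) (x j w) * y j w) +
    r j ^+ 2 * (2^-1 * hermitez (z - 2) (x j w) * y j w ^+ 2) + r j ^+ 3 * D j w.
Proof.
move=> bx by_; pose p : {poly R} := hermitez_poly z.
exists (fun j w => \sum_(i < size p)
    (p^`N(i.+3)).[x j w] * (y j w ^+ i.+3 * r j ^+ i)).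
  apply: bounded_moments_sum => i; apply: bounded_momentsM.
    exact: bounded_moments_horner.
  by apply: bounded_momentsM; [exact: bounded_momentsX|exact: bounded_moments_powr].
move=> j w; rewrite !hermitezE.
(* The sum is padded to [size p + 3] terms so that the orders 0, 1 and 2 can be split off in every
   degree. *)
rewrite (@nderiv_taylor_wide _ (size p).+3); [|exact: mulrC|by rewrite -addn3 leq_addr].
rewrite !big_ord_recl /= nderivn0 nderivn1 deriv_hermitez_poly.
have -> : p^`N(2) = 2^-1 *: hermitez_poly (z - 2).
  apply: (@scalerI _ _ 2); first by rewrite pnatr_eq0.
  rewrite scalerA divff ?scale1r ?pnatr_eq0// scaler_nat.
  rewrite -[_ *+ 2](nderivn_def 2) derivnS derivn1.
  by rewrite !deriv_hermitez_poly -addrA -opprD.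
rewrite hornerZ expr0 mulr1 expr1.
have -> : \sum_(i < size p) (p^`N(bump 0 (bump 0 (bump 0 i)))).[x j w] *
    (r j * y j w) ^+ bump 0 (bump 0 (bump 0 i)) =
    r j ^+ 3 * \sum_(i < size p) (p^`N(i.+3)).[x j w] * (y j w ^+ i.+3 * r j ^+ i).
  rewrite mulr_sumr; apply: eq_bigr => i _.
  rewrite /bump !leq0n !add1n (exprMn _ (r j)).
  by rewrite (_ : r j ^+ i.+3 = r j ^+ 3 * r j ^+ i); [ring|rewrite -exprD].
by rewrite (exprMn _ (r j)); ring.
Qed.

(** Induction on [m], multiplying the expansion of the first [m] factors by that of the last. The
    mixed second-order terms are products of a first-order term of an old factor with that of the
    new one, hence the pairs [i < k]. *)
Lemma hermite_prod_taylor m (c : nat -> int) (x y : nat -> J -> Omega -> R) :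
  (forall i, (i < m)%N -> bounded_moments (x i)) ->
  (forall i, (i < m)%N -> bounded_moments (y i)) ->
  exists2 D, bounded_moments D & forall j w,
    hermite_prod m c (fun i => x i j w + r j * y i j w) =
    hermite_prod m c (x^~ j ^~ w) +
    r j * (\sum_(i < m) hermite_prod m (c - unit_seq i) (x^~ j ^~ w) * y i j w) +
    r j ^+ 2 * (\sum_(k < m)
      (2^-1 * hermite_prod m (c - unit_seq k *+ 2) (x^~ j ^~ w) * y k j w ^+ 2 +
       \sum_(i < k) hermite_prod m (c - unit_seq i - unit_seq k) (x^~ j ^~ w)
         * (y i j w * y k j w))) + r j ^+ 3 * D j w.
Proof.
elim: m => [|m IHm] bx by_.
  exists (fun _ _ => 0) => [|j w]; first exact: bounded_moments0.
  by rewrite /hermite_prod !big_ord0 !mulr0 !addr0.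
have bx' i : (i < m)%N -> bounded_moments (x i) by move=> im; apply: bx; exact: ltnW.
have by' i : (i < m)%N -> bounded_moments (y i) by move=> im; apply: by_; exact: ltnW.
have [D bD HD] := IHm bx' by'.
have [E bE HE] := hermitez_taylor (c m) (bx _ (ltnSn m)) (by_ _ (ltnSn m)).
have bH z : bounded_moments (fun j w => hermitez z (x m j w)).
  by apply: bounded_moments_hermitez; exact: bx.
have bP c' : bounded_moments (fun j w => hermite_prod m c' (x^~ j ^~ w)).
  exact: bounded_moments_hermite_prod.
pose A j w := hermite_prod m c (x^~ j ^~ w).
pose A1 j w := \sum_(i < m) hermite_prod m (c - unit_seq i) (x^~ j ^~ w) * y i j w.
pose A2 j w := \sum_(k < m)
      (2^-1 * hermite_prod m (c - unit_seq k *+ 2) (x^~ j ^~ w) * y k j w ^+ 2 +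
       \sum_(i < k) hermite_prod m (c - unit_seq i - unit_seq k) (x^~ j ^~ w)
         * (y i j w * y k j w)).
pose H0 j w := hermitez (c m) (x m j w).
pose H1 j w := hermitez (c m - 1) (x m j w) * y m j w.
pose H2 j w := 2^-1 * hermitez (c m - 2) (x m j w) * y m j w ^+ 2.
(* All products of total order at least 3 in [r], divided by [r ^ 3]. *)
exists (fun j w => A j w * E j w + A1 j w * H2 j w + A2 j w * H1 j w + D j w * H0 j w +
  r j * (A1 j w * E j w + A2 j w * H2 j w + D j w * H1 j w) +
  r j ^+ 2 * (A2 j w * E j w + D j w * H2 j w) + r j ^+ 3 * (D j w * E j w)).
  have bA : bounded_moments A by exact: bP.
  have bA1 : bounded_moments A1.
    by apply: bounded_moments_sum => i; apply: bounded_momentsM; [exact: bP|exact: by'].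
  have bA2 : bounded_moments A2.
    apply: bounded_moments_sum => k; apply: bounded_momentsD.
      apply: bounded_momentsM; last by apply: bounded_momentsX; exact: by'.
      by apply: bounded_momentsZ; exact: bP.
    apply: bounded_moments_sum => i; apply: bounded_momentsM; first exact: bP.
    by apply: bounded_momentsM; apply: by' => //; exact: ltn_trans (ltn_ord k).
  have bH1 : bounded_moments H1 by apply: bounded_momentsM; [exact: bH|exact: by_].
  have bH2 : bounded_moments H2.
    apply: bounded_momentsM; last by apply: bounded_momentsX; exact: by_.
    by apply: bounded_momentsZ; exact: bH.
  have bH0 : bounded_moments H0 by exact: bH.
  have bM := bounded_momentsM; have bA' := bounded_momentsD.
  have bR1 : bounded_moments (fun j (_ : Omega) => r j).
    by apply: bounded_moments_eq (bounded_moments_powr 1) => j w; rewrite expr1.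
  by repeat (apply: bounded_momentsD || apply: bounded_momentsM) => //;
    exact: bounded_moments_powr.
move=> j w; rewrite !hermite_prodS HD HE.
have -> : \sum_(i < m.+1) hermite_prod m.+1 (c - unit_seq i) (x^~ j ^~ w) * y i j w =
    A1 j w * H0 j w + A j w * H1 j w.
  rewrite big_ord_recr /= hermite_prodS hermite_prod_unit sub_unit_at mulrA; congr (_ + _).
  rewrite mulr_suml; apply: eq_bigr => i _.
  by rewrite hermite_prodS sub_unit_off// mulrAC.
have -> : \sum_(k < m.+1)
      (2^-1 * hermite_prod m.+1 (c - unit_seq k *+ 2) (x^~ j ^~ w) * y k j w ^+ 2 +
       \sum_(i < k) hermite_prod m.+1 (c - unit_seq i - unit_seq k) (x^~ j ^~ w)
         * (y i j w * y k j w)) =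
    A2 j w * H0 j w + A1 j w * H1 j w + A j w * H2 j w.
  rewrite big_ord_recr /= hermite_prodS hermite_prod_unit2.
  rewrite [(c - unit_seq m *+ 2) m](_ : _ = c m - 2); last first.
    by rewrite mulr2n opprD addrA !sub_unit_at -addrA -opprD.
  rewrite -addrA; congr (_ + _).
    rewrite mulr_suml; apply: eq_bigr => k _.
    rewrite mulrDl mulr_suml; congr (_ + _).
      rewrite hermite_prodS [(c - unit_seq k *+ 2) m](_ : _ = c m) /H0; first by ring.
      by rewrite mulr2n opprD addrA !sub_unit_off.
    apply: eq_bigr => i _.
    rewrite hermite_prodS !sub_unit_off//; last exact: ltn_trans (ltn_ord k).
    by rewrite mulrAC.
  rewrite [LHS]addrC; congr (_ + _); last by rewrite /A /H2; ring.
  rewrite mulr_suml; apply: eq_bigr => i _.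
  rewrite hermite_prodS hermite_prod_unit sub_unit_at sub_unit_off//.
  by rewrite /H1; ring.
rewrite -/(A j w) -/(A1 j w) -/(A2 j w) -/(H0 j w) -/(H1 j w) -/(H2 j w).
by move: (r j) (A j w) (A1 j w) (A2 j w) (H0 j w) (H1 j w) (H2 j w) (D j w) (E j w) => *; ring.
Qed.

End taylor.

(** * Discrete Ito formula *)

Section discrete_ito.
Context {R : realType} {disp : measure_display} {Omega : measurableType disp}.
Variables (P : probability Omega R) (d : nat) (T : R) (B : R -> Omega -> 'rV[R]_d).
Hypothesis Pcomplete : measure_is_complete P.
Hypothesis BM : standard_brownian_motion P T B.
Hypothesis T0 : 0 < T.

Notation adm := (adm P B).
Notation incr := (incr B).
Notation grid := (grid T).

Variables (m : nat) (n : nat -> nat) (g : nat -> nat -> nat -> 'rV[R]_d) (K : R).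
Hypothesis K0 : 0 <= K.
Hypothesis n_gt0 : forall v, (0 < n v)%N.
Hypothesis g_small : forall v i k, (i < m)%N ->
  dotp (g v i k) (g v i k) * (T / (n v)%:R) <= (2^-1 ^+ v) ^+ 2.
Hypothesis g_energy : forall v i, (i < m)%N ->
  \sum_(k < n v) dotp (g v i k) (g v i k) * (T / (n v)%:R) <= K.
Hypothesis bounded_Wd : forall i, (i < m)%N ->
  bounded_moments P (fun z : nat * R => Wd T B n g z.1 i (clamp T z.2)).
Variable t : R.
Hypothesis tT : 0 <= t <= T.

(** Grid times stopped at [t]: the cells beyond [t] collapse, so one scheme on [[0, T]] handles
    every time. *)
Let sk v k := Num.min (grid (n v) k) t.
Let tau v k := sk v k.+1 - sk v k.
Let V i (z : nat * nat) w := Wd T B n g z.1 i (sk z.1 z.2) w.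
Let y i (z : nat * nat) w := \sum_l g z.1 i z.2 0 l * incr (sk z.1 z.2) (sk z.1 z.2.+1) l w.

Let sk_in v k : 0 <= sk v k <= T.
Proof. by have /andP[? ?] := tT; rewrite le_min (grid_ge0 T0)// ge_min; apply/andP; split=> //; apply/orP; right. Qed.

Let sk_le v k : sk v k <= sk v k.+1. Proof. exact: min_grid_le. Qed.

Let tau_ge0 v k : 0 <= tau v k. Proof. by rewrite subr_ge0. Qed.

Let tau_le v k : tau v k <= T / (n v)%:R.
Proof.
rewrite -(grid_step T (n v) k) /tau /sk; have := grid_le T0 (n v) (leqnSn k).
by rewrite /Num.min; repeat case: ifPn; rewrite -?leNgt => *; lra.
Qed.

Let bounded_V i : (i < m)%N -> bounded_moments P (V i).
Proof.
move=> im; have := bounded_momentsW (fun z : nat * nat => (z.1, sk z.1 z.2)) (bounded_Wd im).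
by apply: bounded_moments_eq => z w; rewrite /= clamp_id.
Qed.

Let adm_V i z : adm (sk z.1 z.2) (V i z).
Proof. by apply: adm_Wd => //; case/andP: (sk_in z.1 z.2). Qed.

Let adm_y i z : adm (sk z.1 z.2.+1) (y i z).
Proof.
apply: adm_sum => l; apply: admM; first exact: (@adm_cst _ _ _ P _ B _ (g z.1 i z.2 0 l)).
by apply: adm_incr => //; case/andP: (sk_in z.1 z.2).
Qed.

Let V_S i v k w : (k < n v)%N -> V i (v, k.+1) w = V i (v, k) w + y i (v, k) w.
Proof.
by move=> kn; rewrite /V /= /sk !Wd_sum// ?(ltnW kn)// big_ord_recr.
Qed.

Let G z i j := dotp (g z.1 i z.2) (g z.1 j z.2) * tau z.1 z.2.

Let q i j z w := y i z w * y j z w - G z i j.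

(** [G] is the conditional expectation of [y i * y j], so [q] is orthogonal to everything known at
    the start of the cell. *)
Let q_orth i j z Z c : adm (sk z.1 z.2) Z -> has_integral P setT Z c ->
  has_integral P setT (fun w => Z w * q i j z w) 0.
Proof.
move=> aZ iZ; have /andP[s0 _] := sk_in z.1 z.2; have /andP[_ s1] := sk_in z.1 z.2.+1.
have H l l' := has_integralZ measurableT (g z.1 i z.2 0 l * g z.1 j z.2 0 l')
  (has_integral_adm_incr2 Pcomplete BM l l' s0 (sk_le z.1 z.2) s1 aZ iZ).
have HS := has_integral_sum measurableT (index_enum 'I_d) (fun l =>
  has_integral_sum measurableT (index_enum 'I_d) (H l)).
have := has_integralD measurableT HS (has_integralZ measurableT (- G z i j) iZ).
have -> : \sum_l \sum_l' g z.1 i z.2 0 l * g z.1 j z.2 0 l' *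
    (c * ((sk z.1 z.2.+1 - sk z.1 z.2) *+ (l == l'))) + - G z i j * c = 0.
  rewrite /G /dotp mulNr mulrAC -/(tau z.1 z.2) [X in _ - X]mulrAC !mulr_suml.
  apply/eqP; rewrite subr_eq0; apply/eqP; apply: eq_bigr => l _.
  rewrite (bigD1 l)//= eqxx big1 ?addr0 => [|l' /negbTE]; first by rewrite mulr1n; ring.
  by rewrite eq_sym => ->; rewrite mulr0n !mulr0.
apply: (has_integral_eq measurableT) => w _.
rewrite mulrBr /y big_distrlr /= mulr_sumr; congr (_ + _); last by rewrite mulNr mulrC.
by apply: eq_bigr => l _; rewrite mulr_sumr; apply: eq_bigr => l' _; ring.
Qed.

(* [delta] dominates the conditional variance of the increments [y], so that
   [y = sqrt delta * eta] with a family [eta] of bounded moments; in the Taylor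
   expansion the terms of second order then sum up to a martingale with summands
   of size [delta] plus the drift, and the remainder is of size [delta ^ (3/2)]. *)
Let delta z := \sum_(i < m) dotp (g z.1 i z.2) (g z.1 i z.2) * tau z.1 z.2.
Let r z := Num.sqrt (delta z).

Let delta_ge0 z : 0 <= delta z.
Proof. by apply: sumr_ge0 => i _; rewrite mulr_ge0 ?dotp_ge0. Qed.

Let r_sqr z : r z ^+ 2 = delta z. Proof. exact: sqr_sqrtr. Qed.

(** [delta] is a sum of [m] terms, each at most [4^-v]; [m] is weakened to [(m+1)^2] to have an
    explicit square root. *)
Let r_le z : r z <= m.+1%:R * 2^-1 ^+ z.1.
Proof.
have e0 : 0 <= 2^-1 ^+ z.1 :> R by rewrite exprn_ge0.
rewrite -(@ler_pXn2r _ 2)// ?nnegrE ?sqrtr_ge0 ?mulr_ge0// r_sqr.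
apply: (@le_trans _ _ (m%:R * (2^-1 ^+ z.1) ^+ 2)).
  rewrite -[m in m%:R]card_ord -sum1_card natr_sum mulr_suml; apply: ler_sum => i _.
  rewrite mul1r; apply: le_trans (g_small _ z.2 (ltn_ord i)).
  by rewrite ler_wpM2l ?dotp_ge0.
rewrite (exprMn _ m.+1%:R) ler_wpM2r ?sqr_ge0// -natrX ler_nat.
by rewrite expnS expn1 (leq_trans (leqnSn m))// leq_pmulr.
Qed.

Let r_bnd z : 0 <= r z <= m.+1%:R.
Proof.
rewrite sqrtr_ge0 (le_trans (r_le z))// ler_piMr// exprn_ile1//.
by rewrite invf_le1// ler1n.
Qed.

(** The coefficients of [y i] after division by the scale [r] and normalization of the increment. If
    [r z = 0] the quotient is 0, and [aE] persists because the numerator vanishes too. *)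
Let a i l z := g z.1 i z.2 0 l * Num.sqrt (tau z.1 z.2) / r z.

Let gtau_le i l z : (i < m)%N ->
  (g z.1 i z.2 0 l * Num.sqrt (tau z.1 z.2)) ^+ 2 <= r z ^+ 2.
Proof.
move=> im; rewrite r_sqr (exprMn _ (g z.1 i z.2 0 l)) sqr_sqrtr//.
rewrite /delta (bigD1 (Ordinal im))//=.
apply: (@le_trans _ _ (dotp (g z.1 i z.2) (g z.1 i z.2) * tau z.1 z.2)).
  by rewrite ler_wpM2r ?sqr_le_dotp.
by rewrite lerDl; apply: sumr_ge0 => j _; rewrite mulr_ge0 ?dotp_ge0.
Qed.

Let aE i l z : (i < m)%N -> r z * a i l z = g z.1 i z.2 0 l * Num.sqrt (tau z.1 z.2).
Proof.
move=> im; rewrite /a; have [r0|r0] := eqVneq (r z) 0; last by rewrite mulrC divfK.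
rewrite r0 mul0r; apply/esym/eqP; rewrite -sqrf_eq0 eq_le sqr_ge0 andbT.
by have := gtau_le l z im; rewrite r0 [0 ^+ 2]expr0n.
Qed.

Let a_le1 i l z : (i < m)%N -> `|a i l z| <= 1.
Proof.
move=> im; rewrite /a; have [->|r0] := eqVneq (r z) 0; first by rewrite invr0 mulr0 normr0.
rewrite -(@ler_pXn2r _ 2)// ?nnegrE// -normrX expr1n ger0_norm ?sqr_ge0//.
rewrite (exprMn _ (_ * _)) exprVn ler_pdivrMr ?mul1r; first exact: gtau_le.
by rewrite exprn_even_gt0.
Qed.

Let eta i z w := \sum_l a i l z * normalized_incr B (sk z.1 z.2) (sk z.1 z.2.+1) l w.

Let y_eta i z w : (i < m)%N -> y i z w = r z * eta i z w.
Proof.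
move=> im; rewrite /y /eta mulr_sumr; apply: eq_bigr => l _.
by rewrite mulrA aE// -mulrA -incr_normalized.
Qed.

Let bounded_eta i : (i < m)%N -> bounded_moments P (eta i).
Proof.
move=> im; apply: bounded_moments_sum => l; apply: bounded_momentsM.
  by apply: (bounded_moments_cst _ (M := 1)) => z; exact: a_le1.
apply: (normalized_incr_bounded Pcomplete BM (s := fun z => sk z.1 z.2)
  (t := fun z : nat * nat => sk z.1 z.2.+1)) => z.
- by case/andP: (sk_in z.1 z.2).
- exact: sk_le.
- by case/andP: (sk_in z.1 z.2.+1).
Qed.

Let G_eta i j z : (i < m)%N -> (j < m)%N -> G z i j = r z ^+ 2 * \sum_l a i l z * a j l z.
Proof.
move=> im jm; rewrite /G /dotp mulr_suml mulr_sumr; apply: eq_bigr => l _.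
have -> : r z ^+ 2 * (a i l z * a j l z) = (r z * a i l z) * (r z * a j l z) by ring.
rewrite !aE// mulrACA -expr2 sqr_sqrtr//.
Qed.

Variable c : nat -> int.
Let Phi (e : nat -> int) z w := hermite_prod m e (fun i => V i z w).

(** The second-order Taylor term splits into its centered part [M] and its conditional mean [Q]
    given the start of the cell; the sum of [Q] is the discrete drift. *)
Let M z w := \sum_(j < m)
  (2^-1 * Phi (c - unit_seq j *+ 2) z w * q j j z w +
   \sum_(i < j) Phi (c - unit_seq i - unit_seq j) z w * q i j z w).

Let Q z w := \sum_(j < m)
  (2^-1 * Phi (c - unit_seq j *+ 2) z w * G z j j +
   \sum_(i < j) Phi (c - unit_seq i - unit_seq j) z w * G z i j).

Let bounded_Phi e : bounded_moments P (Phi e).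
Proof. by apply: bounded_moments_hermite_prod => i; exact: bounded_V. Qed.

Let adm_Phi e z : adm (sk z.1 z.2) (Phi e z).
Proof.
apply: adm_prod => i; have aV := @adm_V i z.
have mH : measurable_fun setT (fun x : R^o => (hermitez_poly (e i)).[x]).
  exact: measurable_poly.
refine (adm_eq (adm_comp mH aV) _) => w.
by rewrite /= hermitezE.
Qed.

Let bounded_q : exists2 N, bounded_moments P N & forall z w, M z w = r z ^+ 2 * N z w.
Proof.
pose N i j z w := eta i z w * eta j z w - \sum_l a i l z * a j l z.
have qN i j z w : (i < m)%N -> (j < m)%N -> q i j z w = r z ^+ 2 * N i j z w.
  by move=> im jm; rewrite /q /N !y_eta// G_eta//; ring.
have bN i j : (i < m)%N -> (j < m)%N -> bounded_moments P (N i j).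
  move=> im jm; apply: bounded_momentsB; first by apply: bounded_momentsM; exact: bounded_eta.
  apply: bounded_moments_sum => l; apply: bounded_momentsM;
    by apply: (bounded_moments_cst _ (M := 1)) => z; exact: a_le1.
exists (fun z w => \sum_(j < m)
  (2^-1 * Phi (c - unit_seq j *+ 2) z w * N j j z w +
   \sum_(i < j) Phi (c - unit_seq i - unit_seq j) z w * N i j z w)).
  apply: bounded_moments_sum => j; apply: bounded_momentsD.
    by apply: bounded_momentsM; [apply: bounded_momentsZ|exact: bN].
  apply: bounded_moments_sum => i; apply: bounded_momentsM => //.
  by apply: bN => //; exact: ltn_trans (ltn_ord j).
move=> z w; rewrite /M mulr_sumr; apply: eq_bigr => j _.
rewrite (qN j j)// [RHS]mulrDr [in RHS]mulr_sumr; congr (_ + _); first by ring.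
by apply: eq_bigr => i _; rewrite qN ?(ltn_trans (ltn_ord i))//; ring.
Qed.

Let M_orth z S : adm (sk z.1 z.2) S -> bounded_moments P (fun _ : unit => S) ->
  has_integral P setT (fun w => S w * M z w) 0.
Proof.
move=> aS bS.
have H e k i j : has_integral P setT (fun w => (S w * (k * Phi e z w)) * q i j z w) 0.
  apply: q_orth.
    by apply: admM => //; apply: admM; [exact: (@adm_cst _ _ _ P _ B _ k)|exact: adm_Phi].
  apply: has_integral_integrable => //.
  apply: (bounded_moments_integrable (U := fun (_ : unit) w => S w * (k * Phi e z w)) tt).
  apply: bounded_momentsM => //; apply: bounded_momentsZ.
  exact: (bounded_momentsW (fun _ : unit => z) (bounded_Phi e)).
have := has_integral_sum measurableT (index_enum 'I_m) (fun j =>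
  has_integralD measurableT (H (c - unit_seq j *+ 2) 2^-1 j j)
  (has_integral_sum measurableT (index_enum 'I_j) (fun i =>
    H (c - unit_seq i - unit_seq j) 1 i j))).
rewrite big1 => [|j _]; last by rewrite big1 ?addr0.
apply: (has_integral_eq measurableT) => w _.
rewrite /M mulr_sumr; apply: eq_bigr => j _; rewrite [RHS]mulrDr mulr_sumr; congr (_ + _).
  by rewrite !mulrA.
by apply: eq_bigr => i _; rewrite mul1r mulrA.
Qed.

Let adm_M z : adm (sk z.1 z.2.+1) (M z).
Proof.
have aP e : adm (sk z.1 z.2.+1) (Phi e z).
  by have aP := @adm_Phi e z; apply: adm_le aP; exact: sk_le.
have ac k : adm (sk z.1 z.2.+1) (fun _ => k) by exact: (@adm_cst _ _ _ P _ B _ k).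
have aq i j : adm (sk z.1 z.2.+1) (q i j z).
  by apply: admB; [apply: admM; exact: adm_y|exact: ac].
apply: adm_sum => j; apply: admD.
  by apply: admM => //; apply: admM.
by apply: adm_sum => i; apply: admM.
Qed.

(** Pythagoras: the partial sum is known at the start of the next cell, where [M_orth] kills the
    cross term, so second moments add up, each of size [r ^ 4]. The triangle inequality would only
    give the sum of [r ^ 2], which is merely bounded. *)
Let M_second : exists2 C, 0 <= C & forall v p,
  (\int[P]_w ((\sum_(k < p) M (v, k : nat) w) ^+ 2)%:E <=
   (\sum_(k < p) r (v, k : nat) ^+ 4 * C)%:E)%E.
Proof.
have [N bN MN] := bounded_q; have [_ /(_ 1%N)[C HC]] := bN.
have bM : bounded_moments P M.
  apply: (bounded_moments_eq (U := fun z w => r z ^+ 2 * N z w)) => [z w|]; first by rewrite MN.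
  apply: bounded_momentsM => //; exact: bounded_moments_powr.
have C0 : 0 <= C.
  rewrite -lee_fin; apply: le_trans (HC (0%N, 0%N)); apply: integral_ge0 => w _.
  by rewrite lee_fin sqr_pow_ge0.
have iM z : has_integral P setT (fun w => M z w ^+ 2) (fine (\int[P]_w (M z w ^+ 2)%:E)).
  apply: has_integral_integrable => //.
  apply: (bounded_moments_integrable (U := fun z w => M z w ^+ 2)).
  exact: bounded_momentsX.
have M2 z : fine (\int[P]_w (M z w ^+ 2)%:E) <= r z ^+ 4 * C.
  have iN : has_integral P setT (fun w => N z w ^+ 2) (fine (\int[P]_w (N z w ^+ 2)%:E)).
    apply: has_integral_integrable => //.
    apply: (bounded_moments_integrable (U := fun z w => N z w ^+ 2)).
    exact: bounded_momentsX.
  have -> : fine (\int[P]_w (M z w ^+ 2)%:E) = r z ^+ 4 * fine (\int[P]_w (N z w ^+ 2)%:E).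
    apply: (has_integral_unique (iM z)).
    apply: (has_integral_eq measurableT _ (has_integralZ measurableT (r z ^+ 4) iN)) => w _.
    by rewrite MN (exprMn _ (r z ^+ 2)) -exprM.
  rewrite ler_wpM2l ?exprn_ge0 ?sqrtr_ge0// -lee_fin -(proj2 iN).
  by apply: le_trans (HC z); rewrite le_eqVlt; apply/orP; left; apply/eqP.
exists C => // v p.
suff H : has_integral P setT (fun w => (\sum_(k < p) M (v, k : nat) w) ^+ 2)
    (\sum_(k < p) fine (\int[P]_w (M (v, k : nat) w ^+ 2)%:E)).
  by rewrite (proj2 H) lee_fin; apply: ler_sum => k _.
elim: p => [|p IHp].
  rewrite big_ord0; apply: (has_integral_eq measurableT _ (has_integral0 P setT)) => w _.
  by rewrite big_ord0 expr0n.
have aS : adm (sk v p) (fun w => 2 * \sum_(k < p) M (v, k : nat) w).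
  apply: admM; first exact: (@adm_cst _ _ _ P _ B _ 2).
  apply: adm_sum => k; have aM := @adm_M (v, k : nat).
  apply: adm_le aM; rewrite /sk le_min !ge_min lexx orbT andbT.
  by rewrite (grid_le T0)// ltn_ord.
have bS : bounded_moments P (fun (_ : unit) w => 2 * \sum_(k < p) M (v, k : nat) w).
  apply: bounded_momentsZ; apply: bounded_moments_sum => k.
  exact: (bounded_momentsW (fun _ : unit => (v, k : nat)) bM).
have := has_integralD measurableT (has_integralD measurableT IHp (iM (v, p)))
  (M_orth (z := (v, p)) aS bS).
rewrite addr0 big_ord_recr; apply: (has_integral_eq measurableT) => w _.
by rewrite big_ord_recr /=; ring.
Qed.

Let r_sum v : \sum_(k < n v) r (v, k : nat) ^+ 2 <= m%:R * K.
Proof.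
under eq_bigr do rewrite r_sqr /delta /=.
rewrite exchange_big /= -[m in m%:R]card_ord -sum1_card natr_sum mulr_suml.
apply: ler_sum => i _; rewrite mul1r; apply: le_trans (g_energy v (ltn_ord i)).
by apply: ler_sum => k _; rewrite ler_wpM2l ?dotp_ge0.
Qed.

Lemma discrete_ito (e : R) : 0 < e -> exists N, forall v, (N <= v)%N ->
  measurable_fun setT (fun w => hermite_prod m c (fun i => Wd T B n g v i t w) -
     hermite_prod m c (fun=> 0) -
     \sum_(k < n v) \sum_(i < m) Phi (c - unit_seq i) (v, k : nat) w * y i (v, k : nat) w -
     \sum_(k < n v) Q (v, k : nat) w) /\
  (\int[P]_w ((hermite_prod m c (fun i => Wd T B n g v i t w) -
     hermite_prod m c (fun=> 0) -
     \sum_(k < n v) \sum_(i < m) Phi (c - unit_seq i) (v, k : nat) w * y i (v, k : nat) w -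
     \sum_(k < n v) Q (v, k : nat) w) ^+ 2)%:E <= e%:E)%E.
Proof.
move=> e0.
have [C C0 HM] := M_second.
have [D bD HD] := hermite_prod_taylor r_bnd c bounded_V bounded_eta.
have [mD /(_ 1%N)[C' HC']] := bD.
have C'0 : 0 <= C'.
  rewrite -lee_fin; apply: le_trans (HC' (0%N, 0%N)); apply: integral_ge0 => w _.
  by rewrite lee_fin sqr_pow_ge0.
have [N bN MN] := bounded_q.
have mM z : measurable_fun setT (M z).
  rewrite (_ : M z = fun w => r z ^+ 2 * N z w); last by apply/funext => w; exact: MN.
  by apply: measurable_funM => //; exact: (proj1 bN).
have E v w : hermite_prod m c (fun i => Wd T B n g v i t w) -
     hermite_prod m c (fun=> 0) -
     \sum_(k < n v) \sum_(i < m) Phi (c - unit_seq i) (v, k : nat) w * y i (v, k : nat) w -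
     \sum_(k < n v) Q (v, k : nat) w =
   \sum_(k < n v) M (v, k : nat) w + \sum_(k < n v) r (v, k : nat) ^+ 3 * D (v, k : nat) w.
  have P1 : hermite_prod m c (fun i => Wd T B n g v i t w) = Phi c (v, n v) w.
    apply: eq_hermite_prod => // i im; rewrite /V /sk /= gridn//.
    by rewrite (min_idPr _)//; case/andP: tT.
  have P0 : hermite_prod m c (fun=> 0) = Phi c (v, 0%N) w.
    apply: eq_hermite_prod => // i im; rewrite /V /sk /= grid0.
    by rewrite (min_idPl _) ?Wd0//; case/andP: tT.
  have stp k : (k < n v)%N -> Phi c (v, k.+1) w = Phi c (v, k) w +
      (\sum_(i < m) Phi (c - unit_seq i) (v, k) w * y i (v, k) w + Q (v, k) w) +
      (M (v, k) w + r (v, k) ^+ 3 * D (v, k) w).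
    move=> kn; have -> : Phi c (v, k.+1) w =
        hermite_prod m c (fun i => V i (v, k) w + r (v, k) * eta i (v, k) w).
      by apply: eq_hermite_prod => // i im; rewrite V_S// y_eta.
    rewrite HD -/(Phi c (v, k) w).
    have -> : r (v, k) * (\sum_(i < m) hermite_prod m (c - unit_seq i) (V^~ (v, k) ^~ w) * eta i (v, k) w)
        = \sum_(i < m) Phi (c - unit_seq i) (v, k) w * y i (v, k) w.
      by rewrite mulr_sumr; apply: eq_bigr => i _; rewrite y_eta// mulrCA.
    rewrite -!addrA; congr (_ + (_ + _)); rewrite !addrA; congr (_ + _).
    rewrite /Q /M -big_split /= mulr_sumr; apply: eq_bigr => j _.
    rewrite mulrDr [RHS]addrACA; congr (_ + _).
      by rewrite /q !y_eta// /Phi; ring.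
    rewrite -big_split /= mulr_sumr; apply: eq_bigr => i _.
    by rewrite /q !y_eta ?(ltn_trans (ltn_ord i))// /Phi; ring.
  rewrite P1 P0.
  have tele p : (p <= n v)%N -> Phi c (v, p) w = Phi c (v, 0%N) w +
      (\sum_(k < p) \sum_(i < m) Phi (c - unit_seq i) (v, k : nat) w * y i (v, k : nat) w +
       \sum_(k < p) Q (v, k : nat) w) +
      (\sum_(k < p) M (v, k : nat) w + \sum_(k < p) r (v, k : nat) ^+ 3 * D (v, k : nat) w).
    elim: p => [_|p IHp pn]; first by rewrite !big_ord0 !addr0.
    by rewrite stp// IHp ?(ltnW pn)// !big_ord_recr /=; ring.
  by rewrite (tele _ (leqnn _)); ring.
(* With [m K] bounding the sum of [r ^ 2] and [(m+1) 2^-v] bounding each [r], the sum of [r ^ 3] is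
   at most [A 2^-v] and that of [r ^ 4] at most [A (m+1) 4^-v]. *)
pose A := m%:R * K * m.+1%:R.
have mK : 0 <= m%:R * K by apply: le_trans (r_sum 0); apply: sumr_ge0 => k _; exact: sqr_ge0.
have A0 : 0 <= A by rewrite mulr_ge0.
have r3 v : \sum_(k < n v) r (v, k : nat) ^+ 3 <= A * 2^-1 ^+ v.
  apply: (@le_trans _ _ (\sum_(k < n v) r (v, k : nat) ^+ 2 * (m.+1%:R * 2^-1 ^+ v))).
    by apply: ler_sum => k _; rewrite (exprSr _ 2) ler_wpM2l ?sqr_ge0// (r_le (v, k : nat)).
  rewrite -mulr_suml /A -[leRHS]mulrA ler_wpM2r ?mulr_ge0 ?exprn_ge0//.
have r4 v : \sum_(k < n v) r (v, k : nat) ^+ 4 <= A * m.+1%:R * (2^-1 ^+ v) ^+ 2.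
  apply: (@le_trans _ _ (\sum_(k < n v) r (v, k : nat) ^+ 2 * (m.+1%:R * 2^-1 ^+ v) ^+ 2)).
    apply: ler_sum => k _; rewrite (exprD (r _) 2 2) ler_wpM2l ?sqr_ge0//.
    by rewrite ler_pXn2r ?(r_le (v, k : nat))// nnegrE ?sqrtr_ge0 ?mulr_ge0 ?exprn_ge0.
  rewrite -mulr_suml (exprMn _ m.+1%:R) (expr2 m.+1%:R) /A.
  rewrite (_ : _ * _ * _ * _ * _ = m%:R * K * (m.+1%:R * m.+1%:R * (2^-1 ^+ v) ^+ 2)); last by rewrite !mulrA.
  by rewrite ler_wpM2r// mulr_ge0 ?sqr_ge0// mulr_ge0.
have F0 : 0 <= 2 * (A * m.+1%:R * C) + 2 * (A ^+ 2 * C').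
  by rewrite addr_ge0// mulr_ge0// mulr_ge0 ?sqr_ge0// mulr_ge0.
have [N0 HN0] := geometric_small F0 e0.
exists N0 => v Nv; rewrite (_ : (fun w => _) = fun w => \sum_(k < n v) M (v, k : nat) w +
  \sum_(k < n v) r (v, k : nat) ^+ 3 * D (v, k : nat) w); last by apply/funext => w; exact: E.
under eq_integral do rewrite E.
have mS1 : measurable_fun setT (fun w => \sum_(k < n v) M (v, k : nat) w).
  exact: measurable_sum.
have mS2 : measurable_fun setT (fun w => \sum_(k < n v) r (v, k : nat) ^+ 3 * D (v, k : nat) w).
  by apply: measurable_sum => k; apply: measurable_funM => //; exact: mD.
split; first exact: measurable_funD.
(* The remainders are not centered; Cauchy-Schwarz with weights [r ^ 3] suffices for them, as these
   weights already have a vanishing sum. *)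
have I2 : (\int[P]_w ((\sum_(k < n v) r (v, k : nat) ^+ 3 * D (v, k : nat) w) ^+ 2)%:E <=
    ((\sum_(k < n v) r (v, k : nat) ^+ 3) ^+ 2 * C')%:E)%E.
  have iD z : has_integral P setT (fun w => D z w ^+ 2) (fine (\int[P]_w (D z w ^+ 2)%:E)).
    apply: has_integral_integrable => //.
    apply: (bounded_moments_integrable (U := fun z w => D z w ^+ 2)).
    exact: bounded_momentsX.
  pose a3 := \sum_(k < n v) r (v, k : nat) ^+ 3.
  have HS := has_integralZ measurableT a3 (has_integral_sum measurableT (index_enum 'I_(n v))
    (fun k => has_integralZ measurableT (r (v, k : nat) ^+ 3) (iD (v, k : nat)))).
  have r30 (k : 'I_(n v)) : 0 <= r (v, k : nat) ^+ 3 by rewrite exprn_ge0// sqrtr_ge0.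
  apply: (@le_trans _ _ (a3 * \sum_(k < n v) r (v, k : nat) ^+ 3 *
    fine (\int[P]_w (D (v, k : nat) w ^+ 2)%:E))%:E).
    rewrite -(proj2 HS); apply: ge0_le_integral => //.
    - by move=> w _; rewrite lee_fin sqr_ge0.
    - by apply/measurable_EFinP; apply: measurable_funX.
    - exact: (measurable_int P (proj1 HS)).
    - by move=> w _; rewrite lee_fin; apply: weighted_sqr_sum_le => k.
  rewrite lee_fin expr2 -[leRHS]mulrA ler_wpM2l ?sumr_ge0//.
  rewrite mulr_suml; apply: ler_sum => k _; rewrite ler_wpM2l// -lee_fin -(proj2 (iD _)).
  by apply: le_trans (HC' (v, k : nat)); rewrite le_eqVlt; apply/orP; left; apply/eqP.
apply: (@le_trans _ _ ((2 * (\sum_(k < n v) r (v, k : nat) ^+ 4 * C) +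
    2 * ((\sum_(k < n v) r (v, k : nat) ^+ 3) ^+ 2 * C'))%:E)%E).
  apply: (le_moment (g := fun w => 2 * (\sum_(k < n v) M (v, k : nat) w) ^+ 2 +
    2 * (\sum_(k < n v) r (v, k : nat) ^+ 3 * D (v, k : nat) w) ^+ 2)).
  - by apply: measurable_funX; exact: measurable_funD.
  - by apply: measurable_funD; apply: measurable_funM => //; exact: measurable_funX.
  - by move=> w; exact: sqr_ge0.
  - by move=> w; set x := \sum_(k < _) M _ _; set x' := \sum_(k < _) _; have := sqr_ge0 (x - x'); nra.
  - by apply: moment_lin => //; try exact: measurable_funX; move=> w; exact: sqr_ge0.
rewrite lee_fin; apply: le_trans (HN0 _ Nv).
have e2 : 0 <= (2^-1 ^+ v) ^+ 2 :> R by exact: sqr_ge0.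
rewrite (_ : _ * (2^-1 ^+ v) ^+ 2 = 2 * (A * m.+1%:R * (2^-1 ^+ v) ^+ 2 * C) +
  2 * ((A * 2^-1 ^+ v) ^+ 2 * C')); last by rewrite (exprMn _ A); ring.
apply: lerD; rewrite ler_wpM2l//.
  by rewrite -mulr_suml ler_wpM2r.
rewrite ler_wpM2r// ler_pXn2r// ?nnegrE ?mulr_ge0 ?exprn_ge0//.
by apply: sumr_ge0 => k _; rewrite exprn_ge0// sqrtr_ge0.
Qed.

End discrete_ito.

(** * Passage to the limit *)

Lemma dotp_young {R : realType} d (u v : 'rV[R]_d) c : 0 < c ->
  `|dotp u v| <= c^-1 / 2 * dotp u u + c / 2 * dotp v v.
Proof.
move=> c0; apply: le_trans (ler_norm_sum _ _ _) _; rewrite /dotp !mulr_sumr -big_split /=.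
apply: ler_sum => l _; rewrite normrM.
have := sqr_ge0 (`|u 0 l| - c * `|v 0 l|); rewrite sqrrB exprMn !real_normK ?num_real// => H.
rewrite -!expr2 -(ler_pM2l c0) mulrDr !mulrA divff ?gt_eqF// mul1r.
by lra.
Qed.

Lemma dotpB_bilinear {R : realType} d (u v u' v' : 'rV[R]_d) :
  dotp u v - dotp u' v' = dotp (u - u') v + dotp u' (v - v').
Proof.
by rewrite /dotp -sumrB -big_split /=; apply: eq_bigr => l _; rewrite !mxE; ring.
Qed.

(** The parameter [c] will be [2^-v]: it balances squared distances of order [4^-v] against bounded
    energies. *)
Lemma dotp_dist {R : realType} d (u v u' v' : 'rV[R]_d) c : 0 < c ->
  `|dotp u v - dotp u' v'| <=
  c^-1 / 2 * (dotp (u - u') (u - u') + dotp (v - v') (v - v')) +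
  c / 2 * (dotp v v + dotp u' u').
Proof.
move=> c0; rewrite dotpB_bilinear; apply: le_trans (ler_normD _ _) _.
have h1 := dotp_young (u - u') v c0.
have h2 := dotp_young (v - v') u' c0.
have -> : dotp u' (v - v') = dotp (v - v') u' by apply: eq_bigr => l _; exact: mulrC.
by rewrite !mulrDr addrACA lerD.
Qed.

Lemma dotp_sum_le {R : realType} d m (u : 'I_m -> 'rV[R]_d) :
  dotp (\sum_i u i) (\sum_i u i) <= m%:R * \sum_i dotp (u i) (u i).
Proof.
rewrite /dotp exchange_big mulr_sumr; apply: ler_sum => l _.
rewrite summxE -expr2; apply: le_trans (sqr_sum_fin_le _) _.
by rewrite card_ord ler_wpM2l//; apply: ler_sum => i _; rewrite expr2.
Qed.

Lemma measurable_dotp {R : realType} d n (S : measurableType d) (D : set S)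
    (u v : S -> 'rV[R]_n) :
  (forall l, measurable_fun D (fun x => u x 0 l)) ->
  (forall l, measurable_fun D (fun x => v x 0 l)) ->
  measurable_fun D (fun x => dotp (u x) (v x)).
Proof. by move=> mu mv; apply: measurable_sum => l; apply: measurable_funM. Qed.

Lemma measurable_fst_comp {R : realType} d d1 d2 (S1 : measurableType d1)
    (S2 : measurableType d2) (S3 : measurableType d) (D : set S1) (f : S1 -> S3) :
  measurable D -> measurable_fun D f -> measurable_fun (D `*` setT) (fun z : S1 * S2 => f z.1).
Proof.
move=> mD mf; apply: (measurable_comp (F := D)) => //.
  by move=> _ [z [zD _] <-].
by apply: measurable_funTS.
Qed.

Lemma measurable_section_expectation {R : realType} disp (Omega : measurableType disp)
    (P : probability Omega R) (D : set (measurableTypeR R))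
    (f : measurableTypeR R * Omega -> R) :
  measurable D -> measurable_fun (D `*` setT) f -> (forall z, 0 <= f z) ->
  measurable_fun D (fun s => \int[P]_w (f (s, w))%:E)%E.
Proof.
move=> mD mf f0; pose g := (fun z => (f z)%:E) \_ (D `*` [set: Omega]).
have mg : measurable_fun setT g.
  apply/(measurable_restrictT _ _).1 => //; first exact: measurableX.
  exact/measurable_EFinP.
have g0 z : (0 <= g z)%E by rewrite /g patchE; case: ifP => // _; rewrite lee_fin.
apply: (eq_measurable_fun (fubini_F P g)) => [s sD|].
  apply: eq_integral => w _; rewrite /g patchE in_setX sD.
  by rewrite in_setT.
by apply: measurable_funTS; exact: measurable_fun_fubini_tonelli_F.
Qed.

(** * Second moments of time integrals with an integrable weight *)

Section integral_bounds.
Context {R : realType} {disp : measure_display} {Omega : measurableType disp}.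
Variables (P : probability Omega R) (D : set (measurableTypeR R)).
Hypothesis mD : measurable D.
Notation leb := (@lebesgue_measure R).
Variables (Z : measurableTypeR R * Omega -> R) (psi : measurableTypeR R -> R) (C L : R).
Hypothesis mZ : measurable_fun (D `*` setT) Z.
Hypothesis mpsi : measurable_fun D psi.
Hypothesis C0 : 0 <= C.
Hypothesis psi_L : (\int[leb]_(s in D) `|psi s|%:E <= L%:E)%E.
Hypothesis Z_C : forall s, D s -> (\int[P]_w (Z (s, w) ^+ 2)%:E <= C%:E)%E.

Let Zpsi z := Z z ^+ 2 * `|psi z.1|.

Let mZpsi : measurable_fun (D `*` setT) Zpsi.
Proof.
apply: measurable_funM; first exact: measurable_funX.
by apply: (measurable_fst_comp (f := fun s => `|psi s|)) => //; apply: measurableT_comp.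
Qed.

Let Zpsi0 z : 0 <= Zpsi z. Proof. by rewrite mulr_ge0// sqr_ge0. Qed.

Lemma energy_bound : (\int[P]_w \int[leb]_(s in D) (Z (s, w) ^+ 2 * `|psi s|)%:E <= (C * L)%:E)%E.
Proof.
rewrite (tonelli_swap P mD mZpsi Zpsi0).
apply: (@le_trans _ _ (C%:E * \int[leb]_(s in D) `|psi s|%:E)%E); last first.
  by rewrite EFinM lee_wpmul2l.
have mpsi' : measurable_fun D (fun s => `|psi s|%:E).
  by apply/measurable_EFinP; exact: measurableT_comp.
rewrite -ge0_integralZl//.
apply: ge0_le_integral => //.
- by move=> s _; apply: integral_ge0 => w _; rewrite lee_fin.
- exact: (measurable_section_expectation P mD mZpsi Zpsi0).
- exact: measurable_funeM.
move=> s sD; rewrite /Zpsi /=; under eq_integral do rewrite mulrC EFinM.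
rewrite ge0_integralZl//.
- by rewrite muleC; apply: lee_wpmul2r; [rewrite lee_fin|exact: Z_C].
- apply/measurable_EFinP; apply: measurable_funX.
  apply: (measurable_comp (F := D `*` setT)) mZ _ => //; first exact: measurableX.
    by move=> _ [w _ <-].
- by move=> w _; rewrite lee_fin sqr_ge0.
Qed.

(** Cauchy-Schwarz for the measure [|psi| ds], then Tonelli. The weights [dotp (h i) (h j)] are only
    integrable, so [psi] enters through its L^1 norm and [Z] through its second moments at fixed
    times. *)
Lemma sqr_integral_bound (J : Omega -> R) : 0 < L -> measurable_fun setT J ->
  (forall w, `|J w|%:E <= \int[leb]_(s in D) `|Z (s, w) * psi s|%:E)%E ->
  (\int[P]_w (J w ^+ 2)%:E <= (C * L ^+ 2)%:E)%E.
Proof.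
move=> L0 mJ HJ.
have mI := measurable_section_integral mD mZpsi Zpsi0.
have I0 w : (0 <= \int[leb]_(s in D) (Zpsi (s, w))%:E)%E.
  by apply: integral_ge0 => s _; rewrite lee_fin.
have mZw w : measurable_fun D (fun s => Z (s, w)) by exact: measurable_section.
have mpsi' : measurable_fun D (fun s => `|psi s|) by exact: measurableT_comp.
apply: (@le_trans _ _ (\int[P]_w (L%:E * \int[leb]_(s in D) (Zpsi (s, w))%:E))%E); last first.
  rewrite ge0_integralZl//; last by rewrite lee_fin ltW.
  apply: (@le_trans _ _ (L%:E * (C * L)%:E)%E).
    by apply: lee_wpmul2l; [rewrite lee_fin ltW|exact: energy_bound].
  by rewrite -EFinM lee_fin expr2 mulrCA.
apply: ge0_le_integral => //.
- by move=> w _; rewrite lee_fin sqr_ge0.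
- by apply/measurable_EFinP; exact: measurable_funX.
- exact: measurable_funeM.
(* Cauchy-Schwarz from [2 c |Z psi| <= (Z ^ 2 + c ^ 2) |psi|], which requires no
   integrability of the right-hand side. *)
move=> w _; set c := `|J w| / L.
have c0 : 0 <= c by rewrite divr_ge0// ltW.
have H : ((2 * c)%:E * \int[leb]_(s in D) `|Z (s, w) * psi s|%:E <=
    1%:E * \int[leb]_(s in D) (Zpsi (s, w))%:E + (c ^+ 2)%:E * \int[leb]_(s in D) `|psi s|%:E)%E.
  rewrite -ge0_integralZl//; last 2 first.
  - by apply/measurable_EFinP; apply: measurableT_comp => //; exact: measurable_funM.
  - by rewrite lee_fin mulr_ge0.
  apply: integral_le_lin2 => //.
  - apply: measurable_funeM; apply/measurable_EFinP; apply: measurableT_comp => //.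
    exact: measurable_funM.
  - apply/measurable_EFinP; apply: measurable_funM => //; exact: measurable_funX.
  - exact/measurable_EFinP.
  - by move=> s; rewrite -EFinM lee_fin mulr_ge0// mulr_ge0.
  - by move=> s; rewrite lee_fin.
  - exact: sqr_ge0.
  move=> s _; rewrite mul1e -!EFinM -EFinD lee_fin /Zpsi /= normrM.
  have := sqr_ge0 (`|Z (s, w)| - c); have := normr_ge0 (psi s).
  rewrite -[in X in _ -> _ -> _ <= X](real_normK (num_real (Z (s, w)))).
  by move: `|Z (s, w)| `|psi s| => z p p0 zc; nra.
have {}H : ((2 * c * `|J w|)%:E <= \int[leb]_(s in D) (Zpsi (s, w))%:E + (c ^+ 2 * L)%:E)%E.
  apply: (@le_trans _ _ ((2 * c)%:E * \int[leb]_(s in D) `|Z (s, w) * psi s|%:E)%E).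
    by rewrite EFinM; apply: lee_wpmul2l => //; rewrite lee_fin mulr_ge0.
  apply: le_trans H _; rewrite mul1e leeD2l// (EFinM (c ^+ 2) L); apply: lee_wpmul2l => //.
  by rewrite lee_fin sqr_ge0.
have {}H : ((c * `|J w|)%:E <= \int[leb]_(s in D) (Zpsi (s, w))%:E)%E.
  move: H; case: (\int[leb]_(s in D) (Zpsi (s, w))%:E)%E (I0 w) => [I|//|//] _.
    rewrite -EFinD !lee_fin => H.
    have cL : c * L = `|J w| by rewrite /c divfK// gt_eqF.
    by rewrite -cL in H *; nra.
  by move=> _; rewrite leey.
apply: (@le_trans _ _ (L%:E * (c * `|J w|)%:E)%E).
  rewrite -EFinM lee_fin /c mulrA mulrCA divff ?gt_eqF// mulr1 -expr2.
  by rewrite real_normK ?num_real.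
by apply: lee_wpmul2l => //; rewrite lee_fin ltW.
Qed.

End integral_bounds.

Lemma within_continuous_seq {R : realType} (A : set R) (f : R -> R) (u : nat -> R) (s : R) :
  {within A, continuous f} -> A s -> (forall k, A (u k)) ->
  u k @[k --> \oo] --> s -> f (u k) @[k --> \oo] --> f s.
Proof.
move=> /subspace_continuousP cf As Au us.
apply: (cvg_comp _ _ _ (cf s As)) => V /=; rewrite /within /= => VA.
have H : \forall k \near \oo, A (u k) -> V (u k) := us _ VA.
by apply: filterS H => k; apply; exact: Au.
Qed.

Lemma within_continuousM {R : realType} (A : set R) (f k : R -> R) :
  {within A, continuous f} -> {within A, continuous k} ->
  {within A, continuous (fun x => f x * k x)}.
Proof. by move=> cf ck x; apply: cvgM; [exact: cf|exact: ck]. Qed.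

Lemma within_continuous_horner {R : realType} (A : set R) (f : R -> R) (p : {poly R}) :
  {within A, continuous f} -> {within A, continuous (fun x => p.[f x])}.
Proof.
move=> cf; elim/poly_ind: p => [|p c IHp].
  by rewrite (_ : (fun x => _) = fun=> 0) => [x|]; [exact: cvg_cst|apply/funext => x; rewrite horner0].
rewrite (_ : (fun x => _) = fun x => p.[f x] * f x + c); last first.
  by apply/funext => x; rewrite hornerMXaddC.
by move=> x; apply: cvgD; [exact: (within_continuousM IHp cf)|exact: cvg_cst].
Qed.

Lemma within_continuous_bounded {R : realType} (a b : R) (f : R -> R) :
  {within `[a, b], continuous f} -> exists M, forall s, a <= s <= b -> `|f s| <= M.
Proof.
move=> cf; have /compact_bounded[M [_ HM]] := continuous_compact cf (@segment_compact _ a b).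
exists (M + 1) => s sab; apply: (HM (M + 1)); first by rewrite ltrDl.
by exists s => //=; rewrite in_itv.
Qed.

Lemma integrable_mul_bounded {R : realType} (D : set (measurableTypeR R)) (f k : measurableTypeR R -> R) M :
  measurable D -> measurable_fun D f -> (forall s, D s -> `|f s| <= M) ->
  (@lebesgue_measure R).-integrable D (EFin \o k) ->
  (@lebesgue_measure R).-integrable D (EFin \o (fun s => f s * k s)).
Proof.
move=> mD mf fM ik; have := integrableMr mD mf _ ik; apply.
by exists M; split; [exact: num_real|move=> x Mx s sD; exact: le_trans (fM s sD) (ltW Mx)].
Qed.

(** * Joint measurability of continuous processes *)

Section joint_measurability.
Context {R : realType} {disp : measure_display} {Omega : measurableType disp}.
Variable T : R.
Hypothesis T0 : 0 < T.
Notation grid := (grid T).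

Let mD : measurable (`[0, T] : set (measurableTypeR R)).
Proof. exact: measurable_itv. Qed.

Lemma measurable_step_process n (X : nat -> Omega -> R) :
  (forall k, (k < n)%N -> measurable_fun setT (X k)) ->
  measurable_fun setT (fun z : measurableTypeR R * Omega =>
    \sum_(k < n) (grid n k < z.1 <= grid n k.+1)%R%:R * X k z.2).
Proof.
move=> mX; apply: measurable_sum => k; apply: measurable_funM.
  exact: (measurableT_comp (@measurable_step _ setT (grid n k) (grid n k.+1))).
exact: (measurableT_comp (mX k (ltn_ord k))).
Qed.

Lemma cell_leftE n (Y : R -> Omega -> R) (s : R) w : (0 < n)%N -> 0 <= s <= T ->
  Y (cell_left T n s) w =
  Y 0 w + \sum_(k < n) (grid n k < s <= grid n k.+1)%R%:R * (Y (grid n k) w - Y 0 w).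
Proof.
move=> n0 sT; rewrite /cell_left.
have [[-> H]|[k [kn ks H]]] := cell_cases T0 n0 sT.
  rewrite H; have := H R^o (fun k => (Y (grid n k) w - Y 0 w) : R^o).
  by rewrite /GRing.scale /= => ->; rewrite addr0.
rewrite H; have := H R^o (fun k => (Y (grid n k) w - Y 0 w) : R^o).
by rewrite /GRing.scale /= => ->; rewrite addrC subrK.
Qed.

Lemma measurable_cell_left n (Y : R -> Omega -> R) : (0 < n)%N ->
  (forall t, 0 <= t <= T -> measurable_fun setT (Y t)) ->
  measurable_fun (`[0, T] `*` setT)
    (fun z : measurableTypeR R * Omega => Y (cell_left T n z.1) z.2).
Proof.
move=> n0 mY.
have m0 : measurable_fun setT (Y 0) by apply: mY; rewrite lexx ltW.
apply: (eq_measurable_fun (fun z : measurableTypeR R * Omega => Y 0 z.2 +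
  \sum_(k < n) (grid n k < z.1 <= grid n k.+1)%R%:R * (Y (grid n k) z.2 - Y 0 z.2))).
  by move=> z; rewrite inE => -[/=]; rewrite in_itv /= => sT _; rewrite cell_leftE.
apply: measurable_funTS; apply: measurable_funD; first exact: (measurableT_comp m0).
apply: (measurable_step_process (X := fun k w => Y (grid n k) w - Y 0 w)) => k kn.
apply: measurable_funB => //; apply: mY.
by rewrite (grid_ge0 T0) (grid_leT T0)// ltnW.
Qed.

Lemma cvg_cell_left (s : R) : 0 <= s <= T -> cell_left T k.+1 s @[k --> \oo] --> s.
Proof.
move=> sT; apply/cvgrPdist_le => e e0; near=> k.
have [/andP[c0 cs] sc] := cell_left_bounds T0 (ltn0Sn k) sT.
rewrite ger0_norm ?subr_ge0//; apply: (@le_trans _ _ (T / k.+1%:R)); first by rewrite lerBlDl -lerBlDr.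
rewrite ler_pdivrMr ?ltr0n// mulrC -ler_pdivrMr//.
apply: ltW; apply: lt_le_trans (truncnS_gt _) _; rewrite ler_nat ltnS.
by near: k; exact: nbhs_infty_ge.
Unshelve. all: by end_near. Qed.

(* The process is the limit of its samples at the left endpoints of the cells. *)
Lemma measurable_continuous_process (Y : R -> Omega -> R) :
  (forall t, 0 <= t <= T -> measurable_fun setT (Y t)) ->
  (forall w, {within `[0, T], continuous (fun t => Y t w)}) ->
  measurable_fun (`[0, T] `*` setT) (fun z : measurableTypeR R * Omega => Y z.1 z.2).
Proof.
move=> mY cY; apply: (measurable_fun_cvg (h := fun k z => Y (cell_left T k.+1 z.1) z.2)).
  by move=> k; exact: measurable_cell_left.
move=> [s w] [/=]; rewrite in_itv /= => sT _.
apply: (within_continuous_seq (cY w)) => [|k|]; last exact: cvg_cell_left.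
  by rewrite /= in_itv.
have [/andP[c0 cs] _] := cell_left_bounds T0 (ltn0Sn k) sT.
by rewrite /= in_itv /= c0 (le_trans cs)//; case/andP: sT.
Qed.

End joint_measurability.

Lemma within_continuous_hermite_prod {R : realType} (A : set R) m e (x : nat -> R -> R) :
  (forall i, (i < m)%N -> {within A, continuous (x i)}) ->
  {within A, continuous (fun s => hermite_prod m e (x^~ s))}.
Proof.
elim: m => [_|m IHm cx].
  rewrite (_ : (fun z => _) = fun=> 1) => [s|]; first exact: cvg_cst.
  by apply/funext => z; rewrite /hermite_prod big_ord0.
rewrite (_ : (fun z => _) = fun z => hermite_prod m e (x^~ z) * (hermitez_poly (e m)).[x m z]).
  apply: within_continuousM; first by apply: IHm => i im; apply: cx; exact: ltnW.
  by apply: within_continuous_horner; exact: cx.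
by apply/funext => z; rewrite hermite_prodS hermitezE.
Qed.

Section vanishing_L2.
Context {R : realType} {disp : measure_display} {Omega : measurableType disp}.
Variable P : probability Omega R.

(** Measurability is part of the condition, for large [v], in the form in which [discrete_ito]
    delivers it. *)
Definition vanishing_L2 (U : nat -> Omega -> R) : Prop :=
  forall e : R, 0 < e -> exists N, forall v, (N <= v)%N ->
    measurable_fun setT (U v) /\ (\int[P]_w (U v w ^+ 2)%:E <= e%:E)%E.

Lemma vanishing_L2_eq U V : (forall v w, U v w = V v w) -> vanishing_L2 U -> vanishing_L2 V.
Proof. by move=> UV; rewrite (_ : U = V)//; apply/funext => v; apply/funext. Qed.

Lemma vanishing_L2D U V : vanishing_L2 U -> vanishing_L2 V ->
  vanishing_L2 (fun v w => U v w + V v w).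
Proof.
move=> vU vV e e0; have e4 : 0 < e / 4 by rewrite divr_gt0.
have [N HN] := vU _ e4; have [N' HN'] := vV _ e4.
exists (maxn N N') => v; rewrite geq_max => /andP[/HN[mU UC] /HN'[mV VC]].
split; first exact: measurable_funD.
apply: (le_moment (g := fun w => 2 * U v w ^+ 2 + 2 * V v w ^+ 2)).
- by apply: measurable_funX; exact: measurable_funD.
- by apply: measurable_funD; apply: measurable_funM => //; exact: measurable_funX.
- by move=> w; exact: sqr_ge0.
- by move=> w; have := sqr_ge0 (U v w - V v w); nra.
rewrite (_ : e = 2 * (e / 4) + 2 * (e / 4)); last by field.
by apply: moment_lin => //; try exact: measurable_funX; move=> w; exact: sqr_ge0.
Qed.

Lemma vanishing_L2_0 : vanishing_L2 (fun _ _ => 0).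
Proof.
move=> e e0; exists 0%N => v _; split; first exact: measurable_cst.
by under eq_integral do rewrite expr0n; rewrite integral0 lee_fin ltW.
Qed.

Lemma vanishing_L2Z U (k : R) : vanishing_L2 U -> vanishing_L2 (fun v w => k * U v w).
Proof.
move=> vU e e0; have k0 : 0 < k ^+ 2 + 1 by rewrite ltr_wpDl ?sqr_ge0.
have [N HN] := vU _ (divr_gt0 e0 k0); exists N => v /HN[mU UC].
split; first exact: measurable_funM.
under eq_integral do rewrite (exprMn _ k) EFinM.
rewrite ge0_integralZl//; last 3 first.
- by apply/measurable_EFinP; exact: measurable_funX.
- by move=> w _; rewrite lee_fin sqr_ge0.
- by rewrite lee_fin sqr_ge0.
apply: (@le_trans _ _ ((k ^+ 2)%:E * (e / (k ^+ 2 + 1))%:E)%E).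
  by apply: lee_wpmul2l => //; rewrite lee_fin sqr_ge0.
rewrite -EFinM lee_fin mulrA ler_pdivrMr// mulrC ler_wpM2l ?(ltW e0)//.
by rewrite lerDl.
Qed.

Lemma vanishing_L2B U V : vanishing_L2 U -> vanishing_L2 V ->
  vanishing_L2 (fun v w => U v w - V v w).
Proof.
move=> vU vV; apply: (vanishing_L2_eq (U := fun v w => U v w + (-1) * V v w)).
  by move=> v w; rewrite mulN1r.
by apply: vanishing_L2D => //; exact: vanishing_L2Z.
Qed.

Lemma vanishing_L2_sum I (s : seq I) (U : I -> nat -> Omega -> R) :
  (forall i, vanishing_L2 (U i)) -> vanishing_L2 (fun v w => \sum_(i <- s) U i v w).
Proof.
move=> vU; elim: s => [|i s IHs].
  by apply: vanishing_L2_eq vanishing_L2_0 => v w; rewrite big_nil.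
apply: (vanishing_L2_eq (U := fun v w => U i v w + \sum_(i <- s) U i v w)).
  by move=> v w; rewrite big_cons.
exact: vanishing_L2D.
Qed.

Lemma vanishing_moments_vanishing_L2 J (U : nat -> J -> Omega -> R) j :
  vanishing_moments P U -> vanishing_L2 (fun v => U v j).
Proof.
move=> [mU vU] e e0; have [N HN] := vU 0%N e e0.
by exists N => v Nv; split => //; exact: HN.
Qed.

End vanishing_L2.

Section section_integrals.
Context {R : realType} {disp : measure_display} {Omega : measurableType disp}.
Variables (P : probability Omega R) (D : set (measurableTypeR R)).
Hypothesis mD : measurable D.
Notation leb := (@lebesgue_measure R).

(** The nonnegative parts [(|f| + f) / 2] and [(|f| - f) / 2] have measurable integrals by Tonelli,
    and integrability makes these finite. *)
Lemma measurable_section_Rintegral (f : measurableTypeR R * Omega -> R) :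
  measurable_fun (D `*` setT) f ->
  (forall w, leb.-integrable D (EFin \o (fun s => f (s, w)))) ->
  measurable_fun setT (fun w => (\int[leb]_(s in D) f (s, w))%R).
Proof.
move=> mf If; pose fp z := (`|f z| + f z) / 2; pose fn z := (`|f z| - f z) / 2.
have mp : measurable_fun (D `*` setT) fp.
  by apply: measurable_funM => //; apply: measurable_funD => //; exact: measurableT_comp.
have mn : measurable_fun (D `*` setT) fn.
  by apply: measurable_funM => //; apply: measurable_funB => //; exact: measurableT_comp.
have p0 z : 0 <= fp z by rewrite divr_ge0//; have := ler_norm (- f z); rewrite normrN; lra.
have n0 z : 0 <= fn z by rewrite divr_ge0// subr_ge0 ler_norm.
have Ia w : leb.-integrable D (EFin \o (fun s => `|f (s, w)|)).
  by apply: eq_integrable (integrable_abse (If w)).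
have Ip w : leb.-integrable D (EFin \o (fun s => fp (s, w))).
  have [] := has_integralZ mD 2^-1 (has_integralD mD (has_integral_integrable mD (Ia w))
    (has_integral_integrable mD (If w))).
  by move=> + _; apply: eq_integrable => // s _ /=; rewrite mulrC.
have In w : leb.-integrable D (EFin \o (fun s => fn (s, w))).
  have [] := has_integralZ mD 2^-1 (has_integralD mD (has_integral_integrable mD (Ia w))
    (has_integralZ mD (-1) (has_integral_integrable mD (If w)))).
  by move=> + _; apply: eq_integrable => // s _ /=; rewrite mulrC mulN1r.
rewrite (_ : (fun w => _) = fun w => fine (\int[leb]_(s in D) (fp (s, w))%:E)%E -
    fine (\int[leb]_(s in D) (fn (s, w))%:E)%E).
  apply: measurable_funB; apply: measurableT_comp => //.
    exact: (measurable_section_integral mD mp p0).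
  exact: (measurable_section_integral mD mn n0).
apply/funext => w; rewrite -[LHS]/(Rintegral leb D (fun s => f (s, w))).
transitivity (Rintegral leb D (fun s => fp (s, w) - fn (s, w))).
  by apply: eq_Rintegral => s _; rewrite /fp /fn; field.
by rewrite RintegralB.
Qed.

Variables (Z : measurableTypeR R * Omega -> R) (psi : measurableTypeR R -> R) (C L : R).
Hypothesis mZ : measurable_fun (D `*` setT) Z.
Hypothesis Zb : forall w, exists M, forall s, D s -> `|Z (s, w)| <= M.
Hypothesis ipsi : leb.-integrable D (EFin \o psi).

Lemma integrable_section_mul w : leb.-integrable D (EFin \o (fun s => Z (s, w) * psi s)).
Proof.
have [M HM] := Zb w.
by apply: (integrable_mul_bounded (M := M)) => //; exact: measurable_section.
Qed.

Lemma sqr_Rintegral_bound : 0 <= C -> 0 < L ->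
  (\int[leb]_(s in D) `|psi s|%:E <= L%:E)%E ->
  (forall s, D s -> (\int[P]_w (Z (s, w) ^+ 2)%:E <= C%:E)%E) ->
  measurable_fun setT (fun w => (\int[leb]_(s in D) (Z (s, w) * psi s))%R) /\
  (\int[P]_w ((\int[leb]_(s in D) (Z (s, w) * psi s))%R ^+ 2)%:E <= (C * L ^+ 2)%:E)%E.
Proof.
move=> C0 L0 psiL ZC.
have mpsi : measurable_fun D psi by apply/measurable_EFinP; exact: (measurable_int leb).
have mJ : measurable_fun setT (fun w => (\int[leb]_(s in D) (Z (s, w) * psi s))%R).
  apply: (measurable_section_Rintegral (f := fun z => Z z * psi z.1)).
    by apply: measurable_funM => //; exact: measurable_fst_comp.
  exact: integrable_section_mul.
split => //; apply: (sqr_integral_bound mD mZ mpsi C0 psiL ZC L0 mJ) => w.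
rewrite EFin_normr_Rintegral//; last exact: integrable_section_mul.
apply: le_abse_integral => //.
by have := integrable_section_mul w; exact: measurable_int.
Qed.

End section_integrals.

(** Integrals up to different times are moved to the single domain [[0, T]]. The indicator is
    half-open like the grid cells; the lost point 0 is null. *)
Lemma Rintegral_itv_indic {R : realType} (T t : R) (f : measurableTypeR R -> R) : 0 <= t <= T ->
  (@lebesgue_measure R).-integrable `[0, T] (EFin \o f) ->
  (\int[@lebesgue_measure R]_(s in `[0, t]) f s =
   \int[@lebesgue_measure R]_(s in `[0, T]) ((0 < s <= t)%R%:R * f s))%R.
Proof.
move=> /andP[t0 tT] If.
rewrite -Rintegral_itv_obnd_cbnd; last first.
  apply: integrableS If => //; try exact: measurable_itv.
  move=> s /=; rewrite !in_itv /= => /andP[s0 st].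
  by rewrite (ltW s0) (le_trans st).
rewrite Rintegral_mkcond [RHS]Rintegral_mkcond; congr (Rintegral _ _ _).
apply/funext => s; rewrite !patchE !mem_setE !in_itv /=.
case: (boolP (0 < s <= t)) => [/andP[s0 st]|_]; last by rewrite mul0r; case: ifP.
by rewrite (ltW s0) (le_trans st tT) mul1r.
Qed.

Lemma double_integral_sum_le {R : realType} disp (Omega : measurableType disp)
    (P : probability Omega R) (D : set (measurableTypeR R)) (I : finType) (k : R)
    (f : measurableTypeR R * Omega -> R) (F : I -> measurableTypeR R * Omega -> R) :
  measurable D -> 0 <= k ->
  measurable_fun (D `*` setT) f -> (forall z, 0 <= f z) ->
  (forall i, measurable_fun (D `*` setT) (F i)) -> (forall i z, 0 <= F i z) ->
  (forall s w, D s -> f (s, w) <= k * \sum_i F i (s, w)) ->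
  (\int[P]_w \int[@lebesgue_measure R]_(s in D) (f (s, w))%:E <=
   k%:E * \sum_i \int[P]_w \int[@lebesgue_measure R]_(s in D) (F i (s, w))%:E)%E.
Proof.
move=> mD k0 mf f0 mF F0 fF.
have mFi i w : measurable_fun D (fun s => (F i (s, w))%:E).
  by apply/measurable_EFinP; exact: measurable_section.
have mI i := measurable_section_integral mD (mF i) (F0 i).
have I0 i w : (0 <= \int[@lebesgue_measure R]_(s in D) (F i (s, w))%:E)%E.
  by apply: integral_ge0 => s _; rewrite lee_fin.
have mS : measurable_fun setT
    (fun w => \sum_i \int[@lebesgue_measure R]_(s in D) (F i (s, w))%:E)%E.
  exact: emeasurable_sum.
have S0 w : (0 <= \sum_i \int[@lebesgue_measure R]_(s in D) (F i (s, w))%:E)%E.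
  exact: sume_ge0.
rewrite -ge0_integral_sum// -ge0_integralZl//.
apply: ge0_le_integral => //.
- by move=> w _; apply: integral_ge0 => s _; rewrite lee_fin.
- exact: (measurable_section_integral mD mf f0).
- exact: measurable_funeM.
move=> w _.
have mSw : measurable_fun D (fun s => \sum_i (F i (s, w))%:E)%E by exact: emeasurable_sum.
have Sw0 s : (0 <= \sum_i (F i (s, w))%:E)%E.
  by apply: sume_ge0 => i _; rewrite lee_fin.
rewrite -ge0_integral_sum//; last by move=> i s _; rewrite lee_fin.
rewrite -ge0_integralZl//.
apply: ge0_le_integral => //.
- by move=> s _; rewrite lee_fin.
- by apply/measurable_EFinP; exact: measurable_section.
- exact: measurable_funeM.
by move=> s sD; rewrite sumEFin -EFinM lee_fin; exact: fF.
Qed.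

(** * The Ito integral as limit of the scheme *)

Section limit_process.
Context {R : realType} {disp : measure_display} {Omega : measurableType disp}.
Variables (P : probability Omega R) (d : nat) (T : R) (B : R -> Omega -> 'rV[R]_d).
Hypothesis Pcomplete : measure_is_complete P.
Hypothesis BM : standard_brownian_motion P T B.
Hypothesis T0 : 0 < T.

Notation adm := (adm P B).
Notation incr := (incr B).
Notation leb := (@lebesgue_measure R).
Notation grid := (grid T).

Variables (h : nat -> R -> 'rV[R]_d) (W : nat -> R -> Omega -> R).
Hypothesis hW : forall i, is_ito_integral P T B (fun t _ => h i t) (W i).
Variables (m : nat) (n : nat -> nat) (g : nat -> nat -> nat -> 'rV[R]_d) (K : R).
Hypothesis K0 : 0 <= K.
Hypothesis n_gt0 : forall v, (0 < n v)%N.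
Hypothesis g_dist : forall v i, (i < m)%N ->
  (\int[leb]_(s in `[0%R, T]) (let r := h i s - step T (n v) (g v i) s in dotp r r)%:E
    <= ((2^-1 ^+ v) ^+ 2)%:E)%E.
Hypothesis g_small : forall v i k, (i < m)%N ->
  dotp (g v i k) (g v i k) * (T / (n v)%:R) <= (2^-1 ^+ v) ^+ 2.
Hypothesis g_en : forall v i, (i < m)%N ->
  \sum_(k < n v) dotp (g v i k) (g v i k) * (T / (n v)%:R) <= K.
Hypothesis h_en : forall i, (i < m)%N ->
  (\int[leb]_(s in `[0%R, T]) (dotp (h i s) (h i s))%:E <= K%:E)%E.

Let mD : measurable (`[0, T] : set (measurableTypeR R)).
Proof. exact: measurable_itv. Qed.

Definition hprod e s w := hermite_prod m e (fun i => W i s w).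
Definition hprod_d e v s w := hermite_prod m e (fun i => Wd T B n g v i s w).

Notation ph := hprod.
Notation phd := hprod_d.
Let kap v s := cell_left T (n v) s.
Let st v i s := step T (n v) (g v i) s.

Let clampE t (tT : 0 <= t <= T) : clamp T t = t. Proof. exact: clamp_id. Qed.

Let kap_in v s : 0 <= s <= T -> 0 <= kap v s <= T.
Proof.
move=> sT; have [/andP[-> ct] _] := cell_left_bounds T0 (n_gt0 v) sT.
by rewrite (le_trans ct)//; case/andP: sT.
Qed.

Lemma bounded_hprod e : bounded_moments P (fun t => ph e (clamp T t)).
Proof.
apply: (bounded_moments_hermite_prod e (x := fun i t w => W i (clamp T t) w)) => i im.
exact: (bounded_W Pcomplete BM T0 hW n_gt0 g_dist im).
Qed.

Lemma bounded_hprod_d e : bounded_moments P (fun z : nat * R => phd e z.1 (clamp T z.2)).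
Proof.
apply: (bounded_moments_hermite_prod e (x := fun i (z : nat * R) w => Wd T B n g z.1 i (clamp T z.2) w)) => i im.
exact: (bounded_Wd Pcomplete BM T0 hW n_gt0 g_dist im).
Qed.

Lemma bounded_hprod_cell e :
  bounded_moments P (fun z : nat * R => phd e z.1 (kap z.1 (clamp T z.2))).
Proof.
have := bounded_momentsW (fun z : nat * R => (z.1, kap z.1 (clamp T z.2))) (bounded_hprod_d e).
apply: bounded_moments_eq => z w /=; rewrite clampE//.
by apply: kap_in; exact: clamp_in.
Qed.

Lemma vanishing_hprod e : vanishing_moments P
  (fun v t w => ph e (clamp T t) w - phd e v (clamp T t) w).
Proof.
apply: (vanishing_moments_hermite_prod e (x := fun i v t w => W i (clamp T t) w)
  (y := fun i v t w => Wd T B n g v i (clamp T t) w)) => i im.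
- have := bounded_W Pcomplete BM T0 hW n_gt0 g_dist im.
  by move/(bounded_momentsW (fun z : nat * R => z.2)).
- exact: (bounded_Wd Pcomplete BM T0 hW n_gt0 g_dist im).
- exact: (vanishing_Wd Pcomplete BM T0 hW n_gt0 g_dist im).
Qed.

Lemma vanishing_hprod_cell e : vanishing_moments P
  (fun v t w => ph e (clamp T t) w - phd e v (kap v (clamp T t)) w).
Proof.
apply: (vanishing_moments_hermite_prod e (x := fun i v t w => W i (clamp T t) w)
  (y := fun i v t w => Wd T B n g v i (kap v (clamp T t)) w)) => i im.
- have := bounded_W Pcomplete BM T0 hW n_gt0 g_dist im.
  by move/(bounded_momentsW (fun z : nat * R => z.2)).
- have := bounded_momentsW (fun z : nat * R => (z.1, kap z.1 (clamp T z.2)))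
    (bounded_Wd Pcomplete BM T0 hW n_gt0 g_dist im).
  apply: bounded_moments_eq => z w /=; rewrite clampE//.
  by apply: kap_in; exact: clamp_in.
- exact: (vanishing_cell Pcomplete BM T0 hW n_gt0 g_dist g_small im).
Qed.

Lemma continuous_hprod e w : {within `[0, T], continuous (fun s => ph e s w)}.
Proof.
apply: (within_continuous_hermite_prod (x := fun i s => W i s w)) => i _.
by have [_ _ + _] := hW i; exact.
Qed.

Lemma measurable_hprod e t : 0 <= t <= T -> measurable_fun setT (ph e t).
Proof.
move=> tT; have [+ _] := bounded_hprod e; move=> /(_ t); rewrite clampE//.
Qed.

Lemma measurable_hprod_d e v t : 0 <= t <= T -> measurable_fun setT (phd e v t).
Proof.
move=> tT; have [+ _] := bounded_hprod_d e; move=> /(_ (v, t)) /=; rewrite clampE//.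
Qed.

Lemma measurable_joint_hprod e :
  measurable_fun (`[0, T] `*` setT) (fun z : measurableTypeR R * Omega => ph e z.1 z.2).
Proof.
by apply: measurable_continuous_process => // [t tT|w];
  [exact: measurable_hprod|exact: continuous_hprod].
Qed.

Lemma measurable_joint_hprod_cell e v : measurable_fun (`[0, T] `*` setT)
  (fun z : measurableTypeR R * Omega => phd e v (kap v z.1) z.2).
Proof.
by apply: (measurable_cell_left T0 (Y := phd e v)) => // t tT; exact: measurable_hprod_d.
Qed.

(** Boundedness of each path makes its product with the integrable [dotp (h i) (h j)] integrable for
    every [w]. *)
Lemma bounded_path_hprod e w : exists M, forall s, 0 <= s <= T -> `|ph e s w| <= M.
Proof. by apply: within_continuous_bounded; exact: continuous_hprod. Qed.

Lemma bounded_path_hprod_cell e v w : exists M, forall s, 0 <= s <= T -> `|phd e v (kap v s) w| <= M.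
Proof.
exists (`|phd e v 0 w| + \sum_(k < n v) `|phd e v (grid (n v) k) w|) => s sT.
rewrite /kap /cell_left; have [[-> ->]|[k [kn _ ->]]] := cell_cases T0 (n_gt0 v) sT.
  by rewrite lerDl sumr_ge0.
by rewrite (bigD1 (Ordinal kn))//= addrCA lerDl addr_ge0// sumr_ge0.
Qed.

Lemma adm_hprod e t : 0 <= t <= T -> adm t (ph e t).
Proof.
move=> tT; apply: adm_prod => i.
have aW := @adm_W _ _ _ P _ _ _ Pcomplete BM T0 _ _ hW _ _ _ n_gt0 g_dist _ _ (ltn_ord i) tT.
have mH : measurable_fun setT (fun x : R^o => (hermitez_poly (e i)).[x]).
  exact: measurable_poly.
by refine (adm_eq (adm_comp mH aW) _) => w; rewrite /= hermitezE.
Qed.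

Lemma adm_hprod_d e v t : 0 <= t -> adm t (phd e v t).
Proof.
move=> t0; apply: adm_prod => i.
have aW := @adm_Wd _ _ _ P _ _ B T0 n g v i _ t0.
have mH : measurable_fun setT (fun x : R^o => (hermitez_poly (e i)).[x]).
  exact: measurable_poly.
by refine (adm_eq (adm_comp mH aW) _) => w; rewrite /= hermitezE.
Qed.

Lemma measurable_h i l : measurable_fun `[0, T] (fun s : measurableTypeR R => h i s 0 l).
Proof.
by have [[mh _ _] _ _ _] := hW i; exact: (measurable_section (point : Omega) mD (mh l)).
Qed.

Let mh2 i j : measurable_fun `[0, T] (fun s : measurableTypeR R => dotp (h i s) (h j s)).
Proof. by apply: measurable_dotp => l; exact: measurable_h. Qed.

Let mst v i l : measurable_fun `[0, T] (fun s : measurableTypeR R => st v i s 0 l).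
Proof. exact: measurable_row_step. Qed.

Let mst2 v i j : measurable_fun `[0, T] (fun s : measurableTypeR R => dotp (st v i s) (st v j s)).
Proof. by apply: measurable_dotp => l; exact: mst. Qed.

Let st_en v i : (i < m)%N ->
  (\int[leb]_(s in `[0%R, T]) (dotp (st v i s) (st v i s))%:E <= K%:E)%E.
Proof.
by move=> im; rewrite (proj2 (step_dotp_integral T0 g n_gt0 v i i)) lee_fin g_en.
Qed.

Lemma dotp_h_integral i j : (i < m)%N -> (j < m)%N ->
  (\int[leb]_(s in `[0%R, T]) `|dotp (h i s) (h j s)|%:E <= K%:E)%E.
Proof.
move=> im jm.
apply: (@le_trans _ _ (2^-1%:E * \int[leb]_(s in `[0%R, T]) (dotp (h i s) (h i s))%:E +
  2^-1%:E * \int[leb]_(s in `[0%R, T]) (dotp (h j s) (h j s))%:E)%E).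
  apply: integral_le_lin2 => //.
  - by apply/measurable_EFinP; apply: measurableT_comp => //; exact: mh2.
  - by apply/measurable_EFinP; exact: mh2.
  - by apply/measurable_EFinP; exact: mh2.
  - by move=> s; rewrite lee_fin dotp_ge0.
  - by move=> s; rewrite lee_fin dotp_ge0.
  move=> s _; rewrite -!EFinM -EFinD lee_fin.
  by have := dotp_young (h i s) (h j s) ltr01; rewrite invr1 !mul1r.
apply: (@le_trans _ _ (2^-1%:E * K%:E + 2^-1%:E * K%:E)%E).
  by apply: leeD; apply: lee_wpmul2l; rewrite ?lee_fin ?invr_ge0//; exact: h_en.
by rewrite -!EFinM -EFinD lee_fin; lra.
Qed.

Lemma integrable_dotp_h i j : (i < m)%N -> (j < m)%N ->
  leb.-integrable `[0, T] (EFin \o (fun s => dotp (h i s) (h j s))).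
Proof.
move=> im jm; apply/integrableP; split; first by apply/measurable_EFinP; exact: mh2.
by apply: le_lt_trans (dotp_h_integral im jm) (ltry _).
Qed.

(** [dotp_dist] with [c = e = 2^-v] gives [e^-1 / 2 * 2 e^2 + e / 2 * 2 K = (1 + K) e]. *)
Lemma dotp_dist_integral v i j : (i < m)%N -> (j < m)%N ->
  (\int[leb]_(s in `[0%R, T]) `|dotp (st v i s) (st v j s) - dotp (h i s) (h j s)|%:E <=
   ((1 + K) * 2^-1 ^+ v)%:E)%E.
Proof.
move=> im jm; pose e : R := 2^-1 ^+ v.
have e0 : 0 < e by rewrite exprn_gt0.
have mr k : measurable_fun `[0, T] (fun s : measurableTypeR R =>
    dotp (st v k s - h k s) (st v k s - h k s)).
  by apply: measurable_dotpB => l; [exact: mst|exact: measurable_h].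
have ge0r k s : 0 <= dotp (st v k s - h k s) (st v k s - h k s) by exact: dotp_ge0.
have dist k : (k < m)%N -> (\int[leb]_(s in `[0%R, T])
    (dotp (st v k s - h k s) (st v k s - h k s))%:E <= (e ^+ 2)%:E)%E.
  move=> km; apply: le_trans (g_dist v km); rewrite le_eqVlt; apply/orP; left; apply/eqP.
  apply: eq_integral => s _; congr (_%:E); apply: eq_bigr => l _.
  by rewrite /st !mxE; ring.
apply: (@le_trans _ _ ((e^-1 / 2)%:E * \int[leb]_(s in `[0%R, T])
    (dotp (st v i s - h i s) (st v i s - h i s) + dotp (st v j s - h j s) (st v j s - h j s))%:E +
  (e / 2)%:E * \int[leb]_(s in `[0%R, T])
    (dotp (st v j s) (st v j s) + dotp (h i s) (h i s))%:E)%E).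
  apply: integral_le_lin2 => //.
  - by apply/measurable_EFinP; apply: measurableT_comp => //; apply: measurable_funB; [exact: mst2|exact: mh2].
  - by apply/measurable_EFinP; apply: measurable_funD; exact: mr.
  - by apply/measurable_EFinP; apply: measurable_funD; [exact: mst2|exact: mh2].
  - by move=> s; rewrite lee_fin addr_ge0.
  - by move=> s; rewrite lee_fin addr_ge0// dotp_ge0.
  - by rewrite divr_ge0// invr_ge0 ltW.
  - by rewrite divr_ge0// ltW.
  by move=> s _; rewrite -!EFinM -EFinD lee_fin; exact: dotp_dist.
apply: (@le_trans _ _ ((e^-1 / 2)%:E * (e ^+ 2 + e ^+ 2)%:E + (e / 2)%:E * (K + K)%:E)%E).
  apply: leeD; apply: lee_wpmul2l.
  - by rewrite lee_fin divr_ge0// invr_ge0 ltW.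
  - under eq_integral do rewrite EFinD.
    rewrite ge0_integralD//; first by rewrite EFinD leeD// dist.
    + by move=> s _; rewrite lee_fin.
    + by apply/measurable_EFinP; exact: mr.
    + by move=> s _; rewrite lee_fin.
    + by apply/measurable_EFinP; exact: mr.
  - by rewrite lee_fin divr_ge0// ltW.
  - under eq_integral do rewrite EFinD.
    rewrite ge0_integralD//; first by rewrite EFinD leeD// ?st_en// h_en.
    + by move=> s _; rewrite lee_fin dotp_ge0.
    + by apply/measurable_EFinP; exact: mst2.
    + by move=> s _; rewrite lee_fin dotp_ge0.
    + by apply/measurable_EFinP; exact: mh2.
rewrite -!EFinM -EFinD lee_fin -/e le_eqVlt; apply/orP; left; apply/eqP.
by field; rewrite gt_eqF.
Qed.

Lemma hprod_moment2 e : exists2 C, 0 <= C &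
  forall s, 0 <= s <= T -> (\int[P]_w (ph e s w ^+ 2)%:E <= C%:E)%E.
Proof.
have [_ /(_ 1%N)[C HC]] := bounded_hprod e.
exists C => [|s sT]; last by have := HC s; rewrite clampE.
rewrite -lee_fin; apply: le_trans (HC 0); apply: integral_ge0 => w _.
by rewrite lee_fin sqr_pow_ge0.
Qed.

Lemma hprod_cell_moment2 e : exists2 C, 0 <= C &
  forall v s, 0 <= s <= T -> (\int[P]_w (phd e v (kap v s) w ^+ 2)%:E <= C%:E)%E.
Proof.
have [_ /(_ 1%N)[C HC]] := bounded_hprod_cell e.
exists C => [|v s sT]; last by have := HC (v, s); rewrite /= clampE.
rewrite -lee_fin; apply: le_trans (HC (0%N, 0)); apply: integral_ge0 => w _.
by rewrite lee_fin sqr_pow_ge0.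
Qed.

Lemma hprod_cell_dist e (eps : R) : 0 < eps -> exists N, forall v s, (N <= v)%N -> 0 <= s <= T ->
  (\int[P]_w ((phd e v (kap v s) w - ph e s w) ^+ 2)%:E <= eps%:E)%E.
Proof.
move=> e0; have [_ /(_ 0%N _ e0)[N HN]] := vanishing_hprod_cell e.
exists N => v s Nv sT; have := HN v s Nv; rewrite clampE//; apply: le_trans.
rewrite le_eqVlt; apply/orP; left; apply/eqP; apply: eq_integral => w _.
by congr (_%:E); rewrite -sqrrN opprB.
Qed.

Lemma drift_term e i j t : (i < m)%N -> (j < m)%N -> 0 <= t <= T ->
  vanishing_L2 P (fun v w =>
    \sum_(k < n v) phd e v (Num.min (grid (n v) k) t) w *
      (dotp (g v i k) (g v j k) * (Num.min (grid (n v) k.+1) t - Num.min (grid (n v) k) t)) -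
    (\int[leb]_(s in `[0%R, t]) (ph e s w * dotp (h i s) (h j s)))%R).
Proof.
move=> im jm tT; pose ind (s : measurableTypeR R) : R := (0 < s <= t)%R%:R.
have ind1 s : `|ind s| <= 1 by rewrite /ind; case: (_ < _ <= _); rewrite ?normr1 ?normr0.
have mind : measurable_fun `[0, T] ind by exact: measurable_step.
have indI (f : measurableTypeR R -> R) : leb.-integrable `[0, T] (EFin \o f) ->
    leb.-integrable `[0, T] (EFin \o (fun s => ind s * f s)).
  exact: (integrable_mul_bounded (M := 1)).
have indL (f : measurableTypeR R -> R) (L : R) : leb.-integrable `[0, T] (EFin \o f) ->
    (\int[leb]_(s in `[0%R, T]) `|f s|%:E <= L%:E)%E ->
    (\int[leb]_(s in `[0%R, T]) `|ind s * f s|%:E <= L%:E)%E.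
  move=> If; apply: le_trans; apply: ge0_le_integral => //.
  - have := measurable_int leb (indI _ If) => mf.
    by apply/measurable_EFinP; apply: measurableT_comp => //; apply/measurable_EFinP.
  - have := measurable_int leb If => mf.
    by apply/measurable_EFinP; apply: measurableT_comp => //; apply/measurable_EFinP.
  - by move=> s _; rewrite lee_fin normrM ler_piMl.
have Ihh : leb.-integrable `[0, T] (EFin \o (fun s => dotp (h i s) (h j s))).
  exact: integrable_dotp_h.
have Iss v : leb.-integrable `[0, T] (EFin \o (fun s => dotp (st v i s) (st v j s))).
  exact: (proj1 (step_dotp_integral T0 g n_gt0 v i j)).
have Id v : leb.-integrable `[0, T]
    (EFin \o (fun s => dotp (st v i s) (st v j s) - dotp (h i s) (h j s))).
  have [+ _] := has_integralD mD (has_integral_integrable mD (Iss v))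
    (has_integralZ mD (-1) (has_integral_integrable mD Ihh)).
  by apply: eq_integrable => // s _ /=; rewrite mulN1r.
pose psi1 v s := ind s * (dotp (st v i s) (st v j s) - dotp (h i s) (h j s)).
pose psi2 s := ind s * dotp (h i s) (h j s).
pose Z1 v (z : measurableTypeR R * Omega) := phd e v (kap v z.1) z.2.
pose Z0 (z : measurableTypeR R * Omega) := ph e z.1 z.2.
have mZ1 v : measurable_fun (`[0, T] `*` setT) (Z1 v) by exact: measurable_joint_hprod_cell.
have mZ0 : measurable_fun (`[0, T] `*` setT) Z0 by exact: measurable_joint_hprod.
have bZ1 v w : exists M, forall s, [set` `[0, T]] s -> `|Z1 v (s, w)| <= M.
  have [M HM] := bounded_path_hprod_cell e v w; exists M => s /=; rewrite in_itv /=; exact: HM.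
have bZ0 w : exists M, forall s, [set` `[0, T]] s -> `|Z0 (s, w)| <= M.
  have [M HM] := bounded_path_hprod e w; exists M => s /=; rewrite in_itv /=; exact: HM.
have bZ v w : exists M, forall s, [set` `[0, T]] s -> `|Z1 v (s, w) - Z0 (s, w)| <= M.
  have [M HM] := bZ1 v w; have [M' HM'] := bZ0 w; exists (M + M') => s sD.
  by apply: le_trans (ler_normB _ _) _; apply: lerD; [exact: HM|exact: HM'].
have mZ v : measurable_fun (`[0, T] `*` setT) (fun z => Z1 v z - Z0 z).
  exact: measurable_funB.
have I1 v w : leb.-integrable `[0, T] (EFin \o (fun s => Z1 v (s, w) * psi1 v s)).
  exact: (integrable_section_mul mD (mZ1 v) (bZ1 v) (indI _ (Id v))).
have I2 v w : leb.-integrable `[0, T] (EFin \o (fun s => (Z1 v (s, w) - Z0 (s, w)) * psi2 s)).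
  exact: (integrable_section_mul mD (mZ v) (bZ v) (indI _ Ihh)).
have I0 w : leb.-integrable `[0, T] (EFin \o (fun s => Z0 (s, w) * dotp (h i s) (h j s))).
  exact: (integrable_section_mul mD mZ0 bZ0 Ihh).
apply: (vanishing_L2_eq (U := fun v w =>
    (\int[leb]_(s in `[0%R, T]) (Z1 v (s, w) * psi1 v s))%R +
    (\int[leb]_(s in `[0%R, T]) ((Z1 v (s, w) - Z0 (s, w)) * psi2 s))%R)) => [v w|].
  rewrite (Rintegral_itv_indic tT (I0 w)).
  have H := has_integral_cells T0 (fun k => phd e v (Num.min (grid (n v) k) t) w *
    dotp (g v i k) (g v j k)) tT (n_gt0 v).
  have [_] : has_integral leb `[0, T] (fun s => ind s * (Z1 v (s, w) * dotp (st v i s) (st v j s)))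
      (\sum_(k < n v) phd e v (Num.min (grid (n v) k) t) w *
      (dotp (g v i k) (g v j k) * (Num.min (grid (n v) k.+1) t - Num.min (grid (n v) k) t))).
    rewrite (_ : \sum_(k < n v) _ = \sum_(k < n v) phd e v (Num.min (grid (n v) k) t) w *
      dotp (g v i k) (g v j k) * (Num.min (grid (n v) k.+1) t - Num.min (grid (n v) k) t)); last first.
      by apply: eq_bigr => k _; rewrite mulrA.
    apply: (has_integral_eq mD) H => s; rewrite inE /= in_itv /= => sT.
    rewrite /Z1 /st /step /kap /cell_left /ind /=.
    have [[-> H]|[k [kn /andP[ks _] H]]] := cell_cases T0 (n_gt0 v) sT.
      by rewrite ltxx !mul0r.
    have := H R^o (fun k => phd e v (Num.min (grid (n v) k) t) w * dotp (g v i k) (g v j k) : R^o).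
    rewrite /GRing.scale /= => E.
    under eq_bigr do rewrite mulrC.
    rewrite E !H; case: (boolP (_ < _ <= _)) => [/andP[_ st']|_]; last by rewrite !mul0r.
    (* The cell contains some [s <= t], so its left endpoint is not affected by the truncation at
       [t]. *)
    by rewrite (min_idPl (le_trans (ltW ks) st')).
  move=> /(congr1 fine) /= <-.
  rewrite -/(Rintegral leb `[0, T] (fun s => ind s * (Z1 v (s, w) * dotp (st v i s) (st v j s)))).
  have If' := indI _ (I0 w).
  have [+ _] := has_integralD mD (has_integral_integrable mD (I1 v w))
    (has_integral_integrable mD (I2 v w)) => I12.
  rewrite -RintegralD//; apply/esym/eqP; rewrite subr_eq; apply/eqP.
  rewrite -[X in _ + X]/(Rintegral leb `[0, T] (fun s => ind s * (Z0 (s, w) * dotp (h i s) (h j s)))).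
  rewrite -RintegralD//.
  by apply: eq_Rintegral => s _; rewrite /psi1 /psi2; ring.
apply: vanishing_L2D.
  have [C C0 HC] := hprod_cell_moment2 e.
  move=> eps eps0; have K1 : 0 <= C * (1 + K) ^+ 2 by rewrite mulr_ge0// sqr_ge0.
  have [N HN] := geometric_small K1 eps0; exists N => v Nv.
  have L0 : 0 < (1 + K) * 2^-1 ^+ v by rewrite mulr_gt0 ?exprn_gt0// ltr_pwDl.
  have HC' s : [set` `[0, T]] s -> (\int[P]_w (Z1 v (s, w) ^+ 2)%:E <= C%:E)%E.
    by rewrite /= in_itv /= => sT; exact: HC.
  have [mJ EJ] := sqr_Rintegral_bound mD (mZ1 v) (bZ1 v) (indI _ (Id v)) C0 L0
    (indL _ _ (Id v) (dotp_dist_integral v im jm)) HC'.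
  split => //; apply: le_trans EJ _.
  by rewrite lee_fin (exprMn _ (1 + K)) mulrA HN.
move=> eps eps0; have K1 : 0 < K + 1 by rewrite ltr_wpDl.
have [N HN] := hprod_cell_dist e (divr_gt0 eps0 (exprn_gt0 2 K1)).
exists N => v Nv.
have HL : (\int[leb]_(s in `[0%R, T]) `|psi2 s|%:E <= (K + 1)%:E)%E.
  apply: indL => //; apply: le_trans (dotp_h_integral im jm) _.
  by rewrite lee_fin lerDl.
have HN' s : [set` `[0, T]] s ->
    (\int[P]_w ((Z1 v (s, w) - Z0 (s, w)) ^+ 2)%:E <= (eps / (K + 1) ^+ 2)%:E)%E.
  by rewrite /= in_itv /= => sT; exact: HN.
have [mJ EJ] := sqr_Rintegral_bound mD (mZ v) (bZ v) (indI _ Ihh)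
  (ltW (divr_gt0 eps0 (exprn_gt0 2 K1))) K1 HL HN'.
split => //; apply: le_trans EJ _.
by rewrite lee_fin divfK// gt_eqF// exprn_gt0.
Qed.

Variable c : nat -> int.

Definition drift_process s w : R := \sum_(j < m)
  (2^-1 * (ph (c - unit_seq j *+ 2) s w * dotp (h j s) (h j s)) +
   \sum_(i < j) ph (c - unit_seq i - unit_seq j) s w * dotp (h i s) (h j s)).

Definition diffusion_process s w : 'rV[R]_d := \sum_(i < m) ph (c - unit_seq i) s w *: h i s.

(** Defined as what the drift leaves over, so the integral equation holds for every [w] and [t]; the
    content is that this is the Ito integral of the diffusion coefficient. *)
Definition martingale_part t w : R :=
  ph c t w - ph c 0 w - (\int[leb]_(s in `[0%R, t]) drift_process s w)%R.

Lemma drift_process_integral t w : 0 <= t <= T ->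
  has_integral leb `[0, t] (drift_process ^~ w)
   (\sum_(j < m)
     (2^-1 * (\int[leb]_(s in `[0%R, t]) (ph (c - unit_seq j *+ 2) s w * dotp (h j s) (h j s)))%R +
      \sum_(i < j) (\int[leb]_(s in `[0%R, t])
        (ph (c - unit_seq i - unit_seq j) s w * dotp (h i s) (h j s)))%R)).
Proof.
move=> /andP[t0 tT].
have mDt : measurable (`[0, t] : set (measurableTypeR R)) by exact: measurable_itv.
have H e i j : (i < m)%N -> (j < m)%N ->
    has_integral leb `[0, t] (fun s => ph e s w * dotp (h i s) (h j s))
      ((\int[leb]_(s in `[0%R, t]) (ph e s w * dotp (h i s) (h j s)))%R).
  move=> im jm; apply: has_integral_integrable => //.
  apply: (integrableS mD mDt).
    by move=> s /=; rewrite !in_itv /= => /andP[-> st']; exact: le_trans tT.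
  have [M HM] := bounded_path_hprod e w.
  apply: (integrable_mul_bounded (M := M) mD) (integrable_dotp_h im jm).
    exact: (measurable_section w mD (measurable_joint_hprod e)).
  by move=> s /=; rewrite in_itv /=; exact: HM.
apply: (has_integral_sum mDt) => j; apply: (has_integralD mDt).
  by apply: (has_integralZ mDt); exact: H.
apply: (has_integral_sum mDt) => i; apply: H => //; exact: ltn_trans (ltn_ord j).
Qed.

Lemma drift_processE t w : 0 <= t <= T ->
  (\int[leb]_(s in `[0%R, t]) drift_process s w)%R = \sum_(j < m)
     (2^-1 * (\int[leb]_(s in `[0%R, t]) (ph (c - unit_seq j *+ 2) s w * dotp (h j s) (h j s)))%R +
      \sum_(i < j) (\int[leb]_(s in `[0%R, t])
        (ph (c - unit_seq i - unit_seq j) s w * dotp (h i s) (h j s)))%R).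
Proof. by move=> tT; have [_ e] := drift_process_integral w tT; rewrite /Rintegral e. Qed.

Lemma measurable_drift_process :
  measurable_fun (`[0, T] `*` setT) (fun z : measurableTypeR R * Omega => drift_process z.1 z.2).
Proof.
have H e i j : measurable_fun (`[0, T] `*` setT)
    (fun z : measurableTypeR R * Omega => ph e z.1 z.2 * dotp (h i z.1) (h j z.1)).
  apply: measurable_funM; first exact: measurable_joint_hprod.
  by apply: (measurable_fst_comp (f := fun s => dotp (h i s) (h j s))) => //; exact: mh2.
apply: measurable_sum => j; apply: measurable_funD; first by apply: measurable_funM.
by apply: measurable_sum => i.
Qed.

Lemma measurable_martingale_part t : 0 <= t <= T -> measurable_fun setT (martingale_part t).
Proof.
move=> tT; have T00 : 0 <= (0 : R) <= T by rewrite lexx ltW.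
apply: measurable_funB; first by apply: measurable_funB; exact: measurable_hprod.
have mDt : measurable (`[0, t] : set (measurableTypeR R)) by exact: measurable_itv.
apply: (measurable_section_Rintegral mDt (f := fun z => drift_process z.1 z.2)) => //.
  apply: measurable_funS measurable_drift_process; first exact: measurableX.
  move=> z [/= + _]; rewrite !in_itv /= => /andP[-> zt]; split=> //.
  by rewrite (le_trans zt)//; case/andP: tT.
by move=> w; exact: (proj1 (drift_process_integral w tT)).
Qed.

Lemma continuous_martingale_part w :
  {within `[0, T], continuous (fun t => martingale_part t w)}.
Proof.
have TT : 0 <= T <= T by rewrite lexx ltW.
have c1 : {within `[0, T], continuous (fun s => ph c s w)} by exact: continuous_hprod.
have c2 := parameterized_integral_continuous (ltW T0) (proj1 (drift_process_integral w TT)).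
move=> t; apply: cvgB; last exact: c2.
by apply: cvgB; [exact: c1|exact: cvg_cst].
Qed.

Lemma measurable_diffusion_process l : measurable_fun (`[0, T] `*` setT)
  (fun z : measurableTypeR R * Omega => diffusion_process z.1 z.2 0 l).
Proof.
rewrite (_ : (fun z => _) = fun z : measurableTypeR R * Omega =>
    \sum_(i < m) ph (c - unit_seq i) z.1 z.2 * h i z.1 0 l).
  apply: measurable_sum => i; apply: measurable_funM; first exact: measurable_joint_hprod.
  by apply: (measurable_fst_comp (f := fun s => h i s 0 l)) => //; exact: measurable_h.
by apply/funext => z; rewrite /diffusion_process summxE; apply: eq_bigr => i _; rewrite mxE.
Qed.

Let dotpZ (a b : R) (u v : 'rV[R]_d) : dotp (a *: u) (b *: v) = a * b * dotp u v.
Proof. by rewrite /dotp mulr_sumr; apply: eq_bigr => l _; rewrite !mxE; ring. Qed.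

Lemma ito_integrand_diffusion : ito_integrand P T B diffusion_process.
Proof.
split=> [l|l t tT|].
- exact: measurable_diffusion_process.
- have a : adm t (fun w => diffusion_process t w 0 l).
    have E w : \sum_(i < m) ph (c - unit_seq i) t w * h i t 0 l = diffusion_process t w 0 l.
      by rewrite /diffusion_process summxE; apply: eq_bigr => i _; rewrite mxE.
    refine (adm_eq _ E); apply: adm_sum => i; apply: admM.
      exact: (adm_hprod _ tT).
    exact: (@adm_cst _ _ _ P _ B _ (h i t 0 l)).
  exact: a.
pose F (i : 'I_m) (z : measurableTypeR R * Omega) :=
  ph (c - unit_seq i) z.1 z.2 ^+ 2 * `|dotp (h i z.1) (h i z.1)|.
have mF i : measurable_fun (`[0, T] `*` setT) (F i).
  apply: measurable_funM; first by apply: measurable_funX; exact: measurable_joint_hprod.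
  apply: (measurable_fst_comp (f := fun s => `|dotp (h i s) (h i s)|)) => //.
  by apply: measurableT_comp => //; exact: mh2.
apply: (@le_lt_trans _ _ (m%:R%:E * \sum_i \int[P]_w \int[leb]_(s in `[0%R, T]) (F i (s, w))%:E)%E).
  apply: (double_integral_sum_le P (f := fun z : measurableTypeR R * Omega =>
    dotp (diffusion_process z.1 z.2) (diffusion_process z.1 z.2)) (F := F)) => //.
  - by apply: measurable_dotp => l; exact: measurable_diffusion_process.
  - by move=> z; exact: dotp_ge0.
  - by move=> i z; rewrite mulr_ge0// sqr_ge0.
  move=> s w _; apply: le_trans (dotp_sum_le _) _; rewrite ler_wpM2l//.
  apply: ler_sum => i _; rewrite dotpZ -expr2 /F /= ler_wpM2l ?sqr_ge0//.
  by rewrite ger0_norm ?dotp_ge0.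
have /choice[C HC] : forall i : 'I_m, exists C : R, (\int[P]_w \int[leb]_(s in `[0%R, T]) (F i (s, w))%:E <= C%:E)%E.
  move=> i; have [C C0 HC] := hprod_moment2 (c - unit_seq i); exists (C * K).
  apply: (energy_bound mD (psi := fun s => dotp (h i s) (h i s)) (Z := fun z => ph (c - unit_seq i) z.1 z.2)) => //.
  - exact: measurable_joint_hprod.
  - exact: mh2.
  - exact: dotp_h_integral.
apply: (@le_lt_trans _ _ (m%:R * \sum_i C i)%:E); last exact: ltry.
rewrite EFinM; apply: lee_wpmul2l; first by rewrite lee_fin.
by rewrite -sumEFin; apply: lee_sum => i _.
Qed.

(** The first-order Taylor coefficients, frozen at the left endpoint of the cell and hence
    adapted. *)
Definition approx_process v : simple_process R d Omega :=
  SimpleProcess (n v) (grid (n v))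
    (fun k w => \sum_(i < m) phd (c - unit_seq i) v (grid (n v) k) w *: g v i k).

Lemma approx_process_valid v :
  simple_valid P T (augmented_filtration P B) (approx_process v).
Proof.
move=> k kn; have g0 := grid_ge0 T0 (n v) k.
have gT : 0 <= grid (n v) k <= T by rewrite g0 (grid_leT T0)// ltnW.
split=> //.
- exact: grid_le.
- exact: grid_leT.
- move=> l; have a : adm (grid (n v) k) (fun w => sp_coef (approx_process v) k w 0 l).
    have E w : \sum_(i < m) phd (c - unit_seq i) v (grid (n v) k) w * g v i k 0 l =
        sp_coef (approx_process v) k w 0 l.
      by rewrite /= summxE; apply: eq_bigr => i _; rewrite mxE.
    refine (adm_eq _ E); apply: adm_sum => i; apply: admM.
      exact: (adm_hprod_d _ _ g0).
    exact: (@adm_cst _ _ _ P _ B _ (g v i k 0 l)).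
  exact: a.
have b : bounded_moments P (fun _ : unit => fun w =>
    dotp (sp_coef (approx_process v) k w) (sp_coef (approx_process v) k w)).
  have bl l : bounded_moments P (fun (_ : unit) w => sp_coef (approx_process v) k w 0 l).
    apply: (bounded_moments_eq (U := fun (_ : unit) w =>
      \sum_(i < m) g v i k 0 l * phd (c - unit_seq i) v (grid (n v) k) w)) => [_ w|].
      by rewrite /= summxE; apply: eq_bigr => i _; rewrite mxE mulrC.
    apply: bounded_moments_sum => i; apply: bounded_momentsZ.
    have := bounded_momentsW (fun _ : unit => (v, grid (n v) k)) (bounded_hprod_d (c - unit_seq i)).
    by apply: bounded_moments_eq => u w /=; rewrite clampE.
  by apply: bounded_moments_sum => l; apply: bounded_momentsM.
have := integrable_fin_num measurableT (bounded_moments_integrable tt b).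
by rewrite ge0_fin_numE//; apply: integral_ge0 => w _; rewrite lee_fin dotp_ge0.
Qed.

Lemma approx_process_value v s w : 0 <= s <= T ->
  simple_value (approx_process v) s w =
  \sum_(i < m) phd (c - unit_seq i) v (kap v s) w *: st v i s.
Proof.
move=> sT; rewrite /simple_value /st /step /kap /cell_left /=.
have [[_ H]|[k [kn ks H]]] := cell_cases T0 (n_gt0 v) sT.
  rewrite (H _ (fun k => \sum_(i < m) phd (c - unit_seq i) v (grid (n v) k) w *: g v i k)).
  by rewrite big1// => i _; rewrite (H _ (g v i)) scaler0.
rewrite (H _ (fun k => \sum_(i < m) phd (c - unit_seq i) v (grid (n v) k) w *: g v i k)).
by apply: eq_bigr => i _; rewrite (H _ (g v i)) (H R^o (grid (n v))).
Qed.

Lemma approx_process_dist (eps : R) : 0 < eps -> exists N, forall v, (N <= v)%N ->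
  (\int[P]_w \int[leb]_(s in `[0%R, T])
     (let r := (simple_value (approx_process v) s w - diffusion_process s w)%R in
      dotp r r)%:E <= eps%:E)%E.
Proof.
move=> eps0.
pose X1 (i : 'I_m) v (z : measurableTypeR R * Omega) := phd (c - unit_seq i) v (kap v z.1) z.2.
pose X0 (i : 'I_m) (z : measurableTypeR R * Omega) := ph (c - unit_seq i) z.1 z.2.
pose q v (i : 'I_m) (s : measurableTypeR R) := dotp (st v i s - h i s) (st v i s - h i s).
(* For each [i] the difference splits as [X1 (st - h) + (X1 - X0) h]; the boolean selects the
   summand. *)
pose F v (p : 'I_m * bool) (z : measurableTypeR R * Omega) := if p.2
  then X1 p.1 v z ^+ 2 * `|q v p.1 z.1|
  else (X1 p.1 v z - X0 p.1 z) ^+ 2 * `|dotp (h p.1 z.1) (h p.1 z.1)|.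
have mX1 i v : measurable_fun (`[0, T] `*` setT) (X1 i v) by exact: measurable_joint_hprod_cell.
have mX0 i : measurable_fun (`[0, T] `*` setT) (X0 i) by exact: measurable_joint_hprod.
have mX i v : measurable_fun (`[0, T] `*` setT) (fun z => X1 i v z - X0 i z).
  exact: measurable_funB.
have mq v i : measurable_fun `[0, T] (q v i).
  by apply: measurable_dotpB => l; [exact: mst|exact: measurable_h].
have mF v p : measurable_fun (`[0, T] `*` setT) (F v p).
  case: p => i [] /=; rewrite /F /=; (apply: measurable_funM; first exact: measurable_funX).
    apply: (measurable_fst_comp (f := fun s => `|q v i s|)) => //.
    by apply: measurableT_comp => //; exact: mq.
  apply: (measurable_fst_comp (f := fun s => `|dotp (h i s) (h i s)|)) => //.
  by apply: measurableT_comp => //; exact: mh2.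
have F0 v p z : 0 <= F v p z by case: p => i []; rewrite /F mulr_ge0// sqr_ge0.
have qL v i : (\int[leb]_(s in `[0%R, T]) `|q v i s|%:E <= ((2^-1 ^+ v) ^+ 2)%:E)%E.
  apply: le_trans (g_dist v (ltn_ord i)); rewrite le_eqVlt; apply/orP; left; apply/eqP.
  apply: eq_integral => s _; congr (_%:E); rewrite ger0_norm ?dotp_ge0//.
  by apply: eq_bigr => l _; rewrite /st !mxE; ring.
have m2 : 0 <= m%:R * 2 :> R by [].
have M0 : 0 < m%:R * 2 * (m%:R * 2) + 1 :> R by rewrite ltr_wpDl// mulr_ge0.
(* One factor [m * 2] comes from squaring a sum of [m] terms that are sums of two, the other counts
   the elements of ['I_m * bool]; adding 1 keeps the denominator positive for [m = 0]. *)
pose eta := eps / (m%:R * 2 * (m%:R * 2) + 1).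
have eta0 : 0 < eta by rewrite divr_gt0.
have small (p : 'I_m * bool) : exists N, forall v, (N <= v)%N ->
    (\int[P]_w \int[leb]_(s in `[0%R, T]) (F v p (s, w))%:E <= eta%:E)%E.
  case: p => i [].
    have [C C0 HC] := hprod_cell_moment2 (c - unit_seq i).
    have [N HN] := geometric_small C0 eta0; exists N => v Nv.
    apply: (@le_trans _ _ (C * (2^-1 ^+ v) ^+ 2)%:E); last by rewrite lee_fin HN.
    have HC' s : [set` `[0, T]] s -> (\int[P]_w (X1 i v (s, w) ^+ 2)%:E <= C%:E)%E.
      by rewrite /= in_itv /= => sT; exact: HC.
    exact: (energy_bound mD (mX1 i v) (mq v i) C0 (qL v i) HC').
  have K1 : 0 < K + 1 by rewrite ltr_wpDl.
  have [N HN] := hprod_cell_dist (c - unit_seq i) (divr_gt0 eta0 K1); exists N => v Nv.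
  have HN' s : [set` `[0, T]] s ->
      (\int[P]_w ((X1 i v (s, w) - X0 i (s, w)) ^+ 2)%:E <= (eta / (K + 1))%:E)%E.
    by rewrite /= in_itv /= => sT; exact: HN.
  apply: (@le_trans _ _ (eta / (K + 1) * K)%:E); last first.
    by rewrite lee_fin mulrAC ler_pdivrMr// ler_wpM2l ?(ltW eta0)// lerDl.
  exact: (energy_bound mD (mX i v) (mh2 i i) (ltW (divr_gt0 eta0 K1))
    (dotp_h_integral (ltn_ord i) (ltn_ord i)) HN').
have /choice[N HN] := small.
exists (\max_p N p) => v Nv.
have st1 s w : [set` `[0, T]] s ->
    simple_value (approx_process v) s w - diffusion_process s w =
    \sum_(i < m) (X1 i v (s, w) *: (st v i s - h i s) + (X1 i v (s, w) - X0 i (s, w)) *: h i s).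
  rewrite /= in_itv /= => sT; rewrite approx_process_value// /diffusion_process -sumrB.
  apply: eq_bigr => i _; rewrite /X1 /X0 /= scalerBr scalerBl.
  by rewrite addrA subrK.
pose f (z : measurableTypeR R * Omega) :=
  dotp (\sum_(i < m) (X1 i v z *: (st v i z.1 - h i z.1) + (X1 i v z - X0 i z) *: h i z.1))
    (\sum_(i < m) (X1 i v z *: (st v i z.1 - h i z.1) + (X1 i v z - X0 i z) *: h i z.1)).
rewrite (_ : (\int[P]_w _)%E = (\int[P]_w \int[leb]_(s in `[0%R, T]) (f (s, w))%:E)%E); last first.
  apply: eq_integral => w _; apply: eq_integral => s sD /=.
  by rewrite /f st1//; exact: set_mem.
have mf : measurable_fun (`[0, T] `*` setT) f.
  have mc l : measurable_fun (`[0, T] `*` setT) (fun z : measurableTypeR R * Omega =>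
      (\sum_(i < m) (X1 i v z *: (st v i z.1 - h i z.1) + (X1 i v z - X0 i z) *: h i z.1)) 0 l).
    rewrite (_ : (fun z => _) = fun z : measurableTypeR R * Omega => \sum_(i < m)
      (X1 i v z * (st v i z.1 0 l - h i z.1 0 l) + (X1 i v z - X0 i z) * h i z.1 0 l)).
      have mh' (i : 'I_m) : measurable_fun (`[0, T] `*` setT)
          (fun z : measurableTypeR R * Omega => h i z.1 0 l).
        by apply: (measurable_fst_comp (f := fun s => h i s 0 l)) => //; exact: measurable_h.
      have ms' (i : 'I_m) : measurable_fun (`[0, T] `*` setT)
          (fun z : measurableTypeR R * Omega => st v i z.1 0 l).
        by apply: (measurable_fst_comp (f := fun s => st v i s 0 l)) => //; exact: mst.
      apply: measurable_sum => i; apply: measurable_funD; apply: measurable_funM => //.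
      exact: measurable_funB.
    by apply/funext => z; rewrite summxE; apply: eq_bigr => i _; rewrite !mxE.
  exact: measurable_dotp.
have f0 z : 0 <= f z by exact: dotp_ge0.
apply: (@le_trans _ _ ((m%:R * 2)%:E *
  \sum_p \int[P]_w \int[leb]_(s in `[0%R, T]) (F v p (s, w))%:E)%E).
  apply: (double_integral_sum_le P mD m2 mf f0 (mF v) (F0 v)) => s w sD.
  apply: le_trans (dotp_sum_le _) _; rewrite -mulrA ler_wpM2l//.
  rewrite -(pair_bigA _ (fun i b => F v (i, b) (s, w)))/= mulr_sumr; apply: ler_sum => i _.
  apply: le_trans (dotpD_le _ _) _; rewrite big_bool /= mulrDr !dotpZ -!expr2 /F /=.
  by rewrite !ger0_norm ?dotp_ge0.
apply: (@le_trans _ _ ((m%:R * 2)%:E * (\sum_(p : 'I_m * bool) eta)%:E)%E).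
  apply: lee_wpmul2l; first by rewrite lee_fin.
  rewrite -sumEFin; apply: lee_sum => p _; apply: HN.
  by apply: leq_trans Nv; exact: leq_bigmax.
rewrite sumr_const card_prod card_ord card_bool -EFinM lee_fin -[eta *+ _]mulr_natr natrM.
rewrite mulrCA /eta mulrAC ler_pdivrMr// ler_wpM2l ?(ltW eps0)//.
by rewrite lerDl.
Qed.

Lemma approx_process_integral t : 0 <= t <= T -> vanishing_L2 P (fun v w =>
  simple_integral B (approx_process v) t w - martingale_part t w).
Proof.
move=> tT; have /andP[t0 tT'] := tT; have T00 : 0 <= (0 : R) <= T by rewrite lexx ltW.
pose I e i j w := (\int[leb]_(s in `[0%R, t]) (ph e s w * dotp (h i s) (h j s)))%R.
pose Iv e i j v w := \sum_(k < n v) phd e v (Num.min (grid (n v) k) t) w *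
  (dotp (g v i k) (g v j k) * (Num.min (grid (n v) k.+1) t - Num.min (grid (n v) k) t)).
have vI e i j : (i < m)%N -> (j < m)%N -> vanishing_L2 P (fun v w => Iv e i j v w - I e i j w).
  by move=> im jm; exact: drift_term.
have vQ : vanishing_L2 P (fun v w => \sum_(j < m)
   (2^-1 * (Iv (c - unit_seq j *+ 2) j j v w - I (c - unit_seq j *+ 2) j j w) +
    \sum_(i < j) (Iv (c - unit_seq i - unit_seq j) i j v w -
      I (c - unit_seq i - unit_seq j) i j w))).
  apply: vanishing_L2_sum => j; apply: vanishing_L2D.
    by apply: vanishing_L2Z; exact: vI.
  by apply: vanishing_L2_sum => i; apply: vI => //; exact: ltn_trans (ltn_ord j).
have vt := vanishing_moments_vanishing_L2 t (vanishing_hprod c).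
have v0 := vanishing_moments_vanishing_L2 0 (vanishing_hprod c).
have bWd i (im : (i < m)%N) := bounded_Wd Pcomplete BM T0 hW n_gt0 g_dist im.
have vA := discrete_ito Pcomplete BM T0 K0 n_gt0 g_small g_en bWd tT c.
have {}vA : vanishing_L2 P _ := vA.
(* In this combination the discrete products at times 0 and [t] and the discrete drift cancel; the
   simple integral minus [martingale_part] is left. *)
have := vanishing_L2B (vanishing_L2B (vanishing_L2B v0 vt) vQ) vA.
apply: vanishing_L2_eq => v w; rewrite !clampE//.
have E0 : phd c v 0 w = hermite_prod m c (fun=> 0).
  by apply: eq_hermite_prod => // i _; rewrite Wd0.
rewrite E0 /martingale_part drift_processE//.
have -> : simple_integral B (approx_process v) t w =
  \sum_(k < n v) \sum_(i < m) hermite_prod m (c - unit_seq i)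
    (fun i => Wd T B n g v i (Num.min (grid (n v) k) t) w) *
    \sum_l g v i k 0 l * incr (Num.min (grid (n v) k) t) (Num.min (grid (n v) k.+1) t) l w.
  rewrite simple_integralE /=; apply: eq_bigr => k _.
  have [kt|tk] := leP (grid (n v) k) t.
    under eq_bigr do rewrite summxE mulr_suml.
    rewrite exchange_big /=; apply: eq_bigr => i _; rewrite mulr_sumr.
    by apply: eq_bigr => l _; rewrite mxE mulrA.
  (* Past [t] the coefficients frozen at [grid k] and at [min (grid k) t] may differ, but both
     multiply an increment from [t] to [t]. *)
  have tk1 := le_trans (ltW tk) (grid_le T0 (n v) (leqnSn k)).
  rewrite (min_idPr tk1).
  rewrite big1 => [|l _]; last by rewrite incrxx mulr0.
  rewrite big1// => i _; rewrite big1 ?mulr0// => l _.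
  by rewrite incrxx mulr0.
have -> : \sum_(k < n v) \sum_(j < m)
   (2^-1 * hermite_prod m (c - unit_seq j *+ 2)
      (fun i => Wd T B n g v i (Num.min (grid (n v) k) t) w) *
      (dotp (g v j k) (g v j k) * (Num.min (grid (n v) k.+1) t - Num.min (grid (n v) k) t)) +
    \sum_(i < j) hermite_prod m (c - unit_seq i - unit_seq j)
      (fun i => Wd T B n g v i (Num.min (grid (n v) k) t) w) *
      (dotp (g v i k) (g v j k) * (Num.min (grid (n v) k.+1) t - Num.min (grid (n v) k) t))) =
   \sum_(j < m) (2^-1 * Iv (c - unit_seq j *+ 2) j j v w +
    \sum_(i < j) Iv (c - unit_seq i - unit_seq j) i j v w).
  rewrite exchange_big; apply: eq_bigr => j _ /=; rewrite big_split /= mulr_sumr.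
  congr (_ + _); first by apply: eq_bigr => k _; rewrite -mulrA.
  by rewrite exchange_big.
rewrite -/(phd c v t w).
have -> : \sum_(j < m)
   (2^-1 * (Iv (c - unit_seq j *+ 2) j j v w - I (c - unit_seq j *+ 2) j j w) +
    \sum_(i < j) (Iv (c - unit_seq i - unit_seq j) i j v w -
      I (c - unit_seq i - unit_seq j) i j w)) =
   \sum_(j < m) (2^-1 * Iv (c - unit_seq j *+ 2) j j v w +
    \sum_(i < j) Iv (c - unit_seq i - unit_seq j) i j v w) -
   \sum_(j < m) (2^-1 * I (c - unit_seq j *+ 2) j j w +
    \sum_(i < j) I (c - unit_seq i - unit_seq j) i j w).
  rewrite -sumrB; apply: eq_bigr => j _; rewrite sumrB mulrBr.
  by ring.
by rewrite /I; ring.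
Qed.

Lemma martingale_is_ito : is_ito_integral P T B diffusion_process martingale_part.
Proof.
split.
- exact: ito_integrand_diffusion.
- exact: measurable_martingale_part.
- exact: continuous_martingale_part.
exists approx_process; split.
- exact: approx_process_valid.
- apply: le_cvge0 => [v|eps eps0]; last exact: approx_process_dist.
  by apply: integral_ge0 => w _; apply: integral_ge0 => s _; rewrite lee_fin dotp_ge0.
move=> t tT; apply: le_cvge0 => [v|eps eps0].
  by apply: integral_ge0 => w _; rewrite lee_fin sqr_ge0.
by have [N HN] := approx_process_integral tT eps0; exists N => v /HN[].
Qed.

End limit_process.

(** * Coordinates indexed by finitely supported sequences *)

Lemma fsbig_nat (S : Type) (idx : S) (op : Monoid.com_law idx) m (F : nat -> S) :
  (forall i, (m <= i)%N -> F i = idx) ->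
  \big[op/idx]_(i \in [set: nat]) F i = \big[op/idx]_(i < m) F i.
Proof.
move=> F0; rewrite (fsbigE (iota 0 m)) ?iota_uniq// => [|i _].
  rewrite -[RHS](big_mkord xpredT) /index_iota subn0.
  by apply: eq_bigl => i; rewrite in_setT.
by rewrite mem_iota add0n /= -leqNgt; exact: F0.
Qed.

(** The larger index is the outer one because it alone is bounded by the condition on [F], and
    [drift_process] sums in this order. *)
Lemma fsbig_nat_pairs (S : Type) (idx : S) (op : Monoid.com_law idx) m (F : nat * nat -> S) :
  (forall i j, (i < j)%N -> (m <= j)%N -> F (i, j) = idx) ->
  \big[op/idx]_(p \in [set p : nat * nat | (p.1 < p.2)%N]) F p =
  \big[op/idx]_(j < m) \big[op/idx]_(i < j) F (i : nat, j : nat).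
Proof.
move=> F0.
pose r := [seq (i, j) | j <- iota 0 m, i <- iota 0 j].
have rP i j : ((i, j) \in r) = (i < j < m)%N.
  apply/allpairsPdep/andP => [[j' [i' []]]|[ij jm]].
    by rewrite !mem_iota !add0n /= => jm ij [-> ->].
  by exists j, i; rewrite !mem_iota !add0n.
rewrite (fsbigE r); last 1 first.
- move=> [i j] /= ij; rewrite rP ij /= -leqNgt; exact: F0.
- rewrite (_ : \big[op/idx]_(p <- r | _) F p = \big[op/idx]_(p <- r) F p); last first.
    rewrite big_mkcond [RHS]big_seq_cond [in LHS]big_seq_cond; apply: eq_bigr => -[i j].
    by rewrite rP andbT => /andP[ij _]; rewrite mem_set.
  rewrite big_allpairs_dep -[RHS](big_mkord xpredT (fun j => \big[op/idx]_(i < j) F (i : nat, j))).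
  rewrite /index_iota subn0; apply: eq_bigr => j _.
  by rewrite -[RHS](big_mkord xpredT (fun i => F (i, j))) /index_iota subn0.
- apply: allpairs_uniq_dep => [|j _|]; rewrite ?iota_uniq//.
  by move=> [j i] [j' i'] _ _ /= [-> ->].
- by move=> [i j]; rewrite /= rP => /andP[].
Qed.

Lemma ext_coord_neg {R : realType} (x : multiindex -> R) (c : nat -> int) k :
  c k < 0 -> ext_coord x c = 0.
Proof.
move=> ck; rewrite /ext_coord; case: pselect => // e.
by have [b bE] := e; move: ck; rewrite bE.
Qed.

Lemma sub_unit_seqE c i k : (c - unit_seq i) k = c k - (k == i)%:Z.
Proof. by []. Qed.

Section coordinates.
Context {R : realType} {disp : measure_display} {Omega : measurableType disp}.
Variables (W : nat -> R -> Omega -> R) (m : nat).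

Lemma hermite_processE (a : multiindex) t w : (forall i, (m <= i)%N -> a i = 0%N) ->
  hermite_process W t w a = hprod W m (to_seq a) t w.
Proof.
move=> a0; rewrite /hermite_process (@fsbig_nat _ _ _ m)// => i im.
by rewrite a0.
Qed.

(** The two conventions for negative entries agree: the left side is 0 by definition, and the right
    side contains a factor [hermitez] at a negative index. Otherwise [c] is the sequence of a
    multi-index. *)
Lemma ext_coord_hermite_process c t w : (forall i, (m <= i)%N -> c i = 0) ->
  ext_coord (hermite_process W t w) c = hprod W m c t w.
Proof.
move=> c0; have [[k ck]|pos] := pselect (exists k, c k < 0).
  rewrite (ext_coord_neg _ ck).
  have km : (k < m)%N by rewrite ltnNge; apply/negP => /c0 e; move: ck; rewrite e ltxx.
  rewrite /hprod /hermite_prod (bigD1 (Ordinal km))//=.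
  by case: (c k) ck => // p _; rewrite mul0r.
have {}pos k : 0 <= c k by rewrite leNgt; apply/negP => ck; apply: pos; exists k.
have cE : exists b : multiindex, forall k, c k = (b k)%:Z.
  exists [fsfun k in [fset i | i in iota 0 m]%fset => `|c k|%N] => k.
  rewrite fsfunE; case: ifPn => [_|]; first by rewrite gez0_abs.
  by rewrite !inE mem_iota add0n /= -leqNgt => /c0.
rewrite /ext_coord; case: pselect => // e; case: cid => b /= bE.
rewrite hermite_processE => [|i /c0]; last by rewrite bE => -[].
by congr (hprod W m _ t w); apply/funext => k; rewrite bE.
Qed.

End coordinates.

(** From index [m] on the sequence is 0 and a shift makes it negative, so the infinite sums reduce
    to indices below [m]. *)
Lemma drift_hermite_process {R : realType} disp (Omega : measurableType disp) d (h : nat -> R -> 'rV[R]_d)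
    (W : nat -> R -> Omega -> R) m (a : multiindex) t w :
  (forall i, (m <= i)%N -> a i = 0%N) ->
  drift h t (hermite_process W t w) a = drift_process h W m (to_seq a) t w.
Proof.
move=> a0.
have c0 i : (m <= i)%N -> to_seq a i = 0 by move=> /a0; rewrite /to_seq => ->.
rewrite /drift (@fsbig_nat _ _ _ m) => [|i im]; last first.
  rewrite (@ext_coord_neg _ _ _ i) ?mul0r// mulr2n opprD addrA !sub_unit_seqE eqxx.
  by rewrite c0.
rewrite (@fsbig_nat_pairs _ _ _ m) => [|i j ij jm]; last first.
  rewrite (@ext_coord_neg _ _ _ j) ?mul0r// !sub_unit_seqE eqxx c0//.
  by rewrite gtn_eqF.
rewrite mulr_sumr -big_split /=; apply: eq_bigr => j _; congr (_ + _).
  rewrite (@ext_coord_hermite_process _ _ _ W m)// => i mi.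
  rewrite mulr2n opprD addrA !sub_unit_seqE c0// gtn_eqF//.
  by rewrite (leq_trans (ltn_ord j)).
apply: eq_bigr => i _; rewrite (@ext_coord_hermite_process _ _ _ W m)// => k mk.
have jk : (j < k)%N by rewrite (leq_trans (ltn_ord j)).
by rewrite !sub_unit_seqE c0// !gtn_eqF// (ltn_trans (ltn_ord i)).
Qed.

Lemma diffusion_hermite_process {R : realType} disp (Omega : measurableType disp) d (h : nat -> R -> 'rV[R]_d)
    (W : nat -> R -> Omega -> R) m (a : multiindex) t w :
  (forall i, (m <= i)%N -> a i = 0%N) ->
  diffusion h t (hermite_process W t w) a = diffusion_process h W m (to_seq a) t w.
Proof.
move=> a0.
have c0 i : (m <= i)%N -> to_seq a i = 0 by move=> /a0; rewrite /to_seq => ->.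
rewrite /diffusion (@fsbig_nat _ _ _ m) => [|i im]; last first.
  by rewrite (@ext_coord_neg _ _ _ i) ?scale0r// sub_unit_seqE eqxx c0.
apply: eq_bigr => j _; rewrite (@ext_coord_hermite_process _ _ _ W m)// => i mi.
by rewrite sub_unit_seqE c0// gtn_eqF// (leq_trans (ltn_ord j)).
Qed.

Lemma multiindex_bound (a : multiindex) : exists m, forall i, (m <= i)%N -> a i = 0%N.
Proof.
exists (\max_(i <- finsupp a) i).+1 => i mi; apply/eqP; rewrite -memNfinsupp.
apply/negP => ai; move: mi; rewrite ltnNge => /negP; apply.
exact: (leq_bigmax_seq (F := id)).
Qed.

Theorem proposition3p2 (R : realType) (disp : measure_display)
    (Omega : measurableType disp) (P : probability Omega R)
    (d : nat) (T : R) (B : R -> Omega -> 'rV[R]_d)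
    (h : nat -> R -> 'rV[R]_d) (W : nat -> R -> Omega -> R)
    (Pcomplete : measure_is_complete P)
    (T_gt0 : 0 < T)
    (B_brownian : standard_brownian_motion P T B)
    (h_basis : orthonormal_basis T h)
    (W_integral : forall i, is_ito_integral P T B (fun t _ => h i t) (W i)) :
  [/\ satisfies_sde P T B (drift h) (diffusion h) (hermite_process W),
      forall a : multiindex, {ae P, forall w,
        hermite_process W 0 w a =
        \big[*%R/1]_(i \in [set: nat]) hermite (a i) (0 : R)},
      forall n, odd n -> hermite n (0 : R) = 0 &
      forall k, hermite k.*2 (0 : R) = (-1) ^+ k / (2 ^+ k * (k`!)%:R)].
Proof.
split; [move=> a|move=> a|exact: hermite0_odd|exact: hermite0_double].
  have [m a0] := multiindex_bound a.
  have [n [g Hng]] := det_sequence Pcomplete B_brownian T_gt0 m W_integral.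
  have n_gt0 v : (0 < n v)%N by case: (Hng v).
  have g_dist v i (im : (i < m)%N) := proj1 (proj2 (Hng v) i im).
  have g_small v i k (im : (i < m)%N) := proj2 (proj2 (Hng v) i im) k.
  have [K1 K10 HK1] := g_energy T_gt0 W_integral n_gt0 g_dist.
  have [K2 K20 HK2] := ito_energy_bound m W_integral.
  (* The limit argument takes one constant for the energies of the step functions and of the
     [h i]. *)
  have K0 : 0 <= K1 + K2 by rewrite addr_ge0.
  have g_en v i : (i < m)%N ->
      \sum_(k < n v) dotp (g v i k) (g v i k) * (T / (n v)%:R) <= K1 + K2.
    by move=> im; apply: le_trans (HK1 v i im) _; rewrite lerDl.
  have h_en i : (i < m)%N ->
      (\int[@lebesgue_measure R]_(s in `[0%R, T]) (dotp (h i s) (h i s))%:E <= (K1 + K2)%:E)%E.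
    by move=> im; apply: le_trans (HK2 i im) _; rewrite lee_fin lerDr.
  have XE : (fun t w => hermite_process W t w a) = hprod W m (to_seq a).
    by apply/funext => t; apply/funext => w; exact: hermite_processE.
  have bE : (fun t w => drift h t (hermite_process W t w) a) = drift_process h W m (to_seq a).
    by apply/funext => t; apply/funext => w; exact: drift_hermite_process.
  have sE : (fun t w => diffusion h t (hermite_process W t w) a) =
      diffusion_process h W m (to_seq a).
    by apply/funext => t; apply/funext => w; exact: diffusion_hermite_process.
  have TT : 0 <= T <= T by rewrite lexx ltW.
  split.
  - rewrite XE => t tT U mU.
    exact: (adm_hprod Pcomplete B_brownian T_gt0 W_integral n_gt0 g_dist (to_seq a) tT mU).
  - move=> w; rewrite (_ : (fun t => hermite_process W t w a) = hprod W m (to_seq a) ^~ w).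
      exact: (continuous_hprod W_integral).
    by apply/funext => t; exact: hermite_processE.
  - apply: aeW => w.
    rewrite (_ : (fun t => _) = EFin \o (drift_process h W m (to_seq a) ^~ w)).
      exact: (proj1 (drift_process_integral Pcomplete B_brownian T_gt0 W_integral n_gt0
        g_dist h_en (to_seq a) w TT)).
    by apply/funext => t; rewrite /= (drift_hermite_process _ _ _ _ a0).
  exists (martingale_part h W m (to_seq a)); split.
    rewrite sE; exact: (martingale_is_ito Pcomplete B_brownian T_gt0 W_integral K0 n_gt0
      g_dist g_small g_en h_en).
  apply: aeW => w t tT; rewrite !(hermite_processE _ _ _ a0) /martingale_part.
  under eq_Rintegral do rewrite (drift_hermite_process _ _ _ _ a0).
  by ring.
(* Each [W i] is known to start at 0 only almost surely; the exceptional sets are countably many and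
   are discarded together. *)
have W0 i : {ae P, forall w, W i 0 w = 0}.
  have [n [g Hng]] := det_sequence Pcomplete B_brownian T_gt0 i.+1 W_integral.
  have n_gt0 v : (0 < n v)%N by case: (Hng v).
  have g_dist v j (im : (j < i.+1)%N) := proj1 (proj2 (Hng v) j im).
  exact: (W_zero Pcomplete B_brownian T_gt0 W_integral n_gt0 g_dist (ltnSn i)).
have := ae_foralln W0; apply: filterS => w {}W0.
by apply: eq_fsbigr => i _; rewrite W0.
Qed.
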